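(* Let $C$ be a smooth projective curve of genus $g$ over the finite field $\mathbf{F}_q$ with $q\ge 5$. Let $d,i$ be integers such that either (i) $0\le d\le g-1$ and $i\ge 1$, or (ii) $g-1\le d\le 2g-2$ and $i-d-1+g\ge 1$. Then $$\bigl|\{\mathcal{L}\in(\operatorname{Pic}^d C)(\mathbf{F}_q)\mid h^0(\mathcal{L})\ge i\}\bigr|\le 16^g\,q^{d-2i+2}.$$
   Context: Curves are assumed geometrically irreducible. $(\operatorname{Pic}^d C)(\mathbf{F}_q)$ denotes the finite set of isomorphism classes of degree $d$ line bundles on $C$ defined over $\mathbf{F}_q$; equivalently (there being no period-index obstruction over a finite field) the set of linear equivalence classes of $\mathbf{F}_q$-rational divisors of degree $d$ on $C$. For a line bundle $\mathcal{L}$, $h^0(\mathcal{L})=\dim_{\mathbf{F}_q}H^0(C,\mathcal{L})$. *)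

(* Defs.v *)
(* Curves are presented classically, as closed subschemes of a projective
   space cut out by finitely many homogeneous equations, with points taken over
   an algebraic closure of the base field. *)
From HB Require Import structures.
From mathcomp Require Import all_boot all_order all_algebra.
From mathcomp Require Import finmap mpoly freeg.
From mathcomp Require Import boolp classical_sets functions cardinality.

Set Implicit Arguments.
Unset Strict Implicit.
Unset Printing Implicit Defensive.
Import Order.TTheory GRing.Theory Num.Theory.
Local Open Scope classical_set_scope.
Local Open Scope ring_scope.

Section ProjectiveSpace.
Variables (L : fieldType) (n : nat).

(* A point of P^n(L) has exactly one vector of homogeneous coordinates whose
   first nonzero entry is 1. *)
Definition normalized (a : {ffun 'I_n.+1 -> L}) : bool :=
  [exists i : 'I_n.+1, (a i == 1) && [forall k : 'I_n.+1, (k < i)%N ==> (a k == 0)]].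

Definition proj_point := {a : {ffun 'I_n.+1 -> L} | normalized a}.

Definition coords (P : proj_point) : 'I_n.+1 -> L := val P.

Definition zariski_closed (Z : set proj_point) : Prop :=
  exists2 S : set {mpoly L[n.+1]},
    (forall f, S f -> exists e : nat, f \is e.-homog) &
    Z = [set P | forall f, S f -> f.@[coords P] = 0].

Definition zariski_irreducible (Z : set proj_point) : Prop :=
  Z !=set0 /\
  forall Z1 Z2, zariski_closed Z1 -> zariski_closed Z2 ->
    Z `<=` Z1 `|` Z2 -> Z `<=` Z1 \/ Z `<=` Z2.

End ProjectiveSpace.

Definition zero_locus (F L : fieldType) (j : {rmorphism F -> L}) (n m : nat)
    (eqs : 'I_m -> {mpoly F[n.+1]}) (P : proj_point L n) : bool :=
  [forall k, mmap j (coords P) (eqs k) == 0].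

Section FieldExtensions.
Variables (F K : fieldType) (iota : {rmorphism F -> K}).

Definition alg_independent (r : nat) (y : 'I_r -> K) : Prop :=
  forall p : {mpoly F[r]}, mmap iota y p = 0 -> p = 0.

Definition has_trdeg (r : nat) : Prop :=
  (exists y : 'I_r -> K, alg_independent y) /\
  ~ (exists y : 'I_r.+1 -> K, alg_independent y).

(* For F-subspaces W' of W in a K-vector space V: the F-dimension of W / W'
   is r, i.e. W / W' has a basis of r elements. *)
Definition has_quotient_dim (V : lmodType K) (W W' : set V) (r : nat) : Prop :=
  exists b : 'I_r -> V, (forall k, W (b k)) /\
    forall w, W w ->
      exists! c : {ffun 'I_r -> F}, W' (w - \sum_k iota (c k) *: b k).

End FieldExtensions.

(* A smooth projective geometrically irreducible curve over F, together
   with a choice of an algebraic closure of F and of a function field; both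
   are unique up to isomorphism.  The function field K is specified by a
   generic point x in P^n(K): a form over F vanishes at x iff it vanishes on
   the curve, and K is the field of ratios f(x) / g(x) of forms of the same
   degree. *)
Record curve (F : finFieldType) := Curve {
  closure : closedFieldType;
  to_closure : {rmorphism F -> closure};
  closure_algebraic : forall z : closure, algebraicOver to_closure z;

  ambient_dim : nat;
  neqs : nat;
  eqs : 'I_neqs -> {mpoly F[ambient_dim.+1]};
  eqs_homog : forall k, exists e : nat, eqs k \is e.-homog;

  curve_geom_irreducible :
    zariski_irreducible [set P | zero_locus to_closure eqs P];

  funfield : fieldType;
  to_funfield : {rmorphism F -> funfield};
  generic_point : 'I_ambient_dim.+1 -> funfield;
  generic_pointP : forall (e : nat) (f : {mpoly F[ambient_dim.+1]}), f \is e.-homog ->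
    (mmap to_funfield generic_point f = 0 <->
     forall P, zero_locus to_closure eqs P -> mmap to_closure (coords P) f = 0);
  funfield_generated : forall h : funfield,
    exists (e : nat) (f u : {mpoly F[ambient_dim.+1]}),
      [/\ f \is e.-homog, u \is e.-homog, mmap to_funfield generic_point u != 0
        & h = mmap to_funfield generic_point f / mmap to_funfield generic_point u];

  curve_dim1 : has_trdeg to_funfield 1;

  (* the Jacobian criterion: the rank is the codimension ambient_dim - 1 *)
  curve_smooth : forall P, zero_locus to_closure eqs P ->
    (\rank (\matrix_(k < neqs, i < ambient_dim.+1)
              mmap to_closure (coords P) (mderiv i (eqs k)))).+1 = ambient_dim
}.

Section CurveTheory.
Variables (F : finFieldType) (C : curve F).
Local Notation L := (closure C).
Local Notation K := (funfield C).
Local Notation n := (ambient_dim C).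
Local Notation iota := (@to_funfield F C).
Local Notation x := (@generic_point F C).

Definition point := {P : proj_point L n | zero_locus (@to_closure F C) (@eqs F C) P}.

Definition eval_at (P : point) (f : {mpoly F[n.+1]}) : L :=
  mmap (@to_closure F C) (coords (val P)) f.

Definition conjugate_points (P Q : point) : Prop :=
  exists2 s : {rmorphism L -> L}, (forall c, s (to_closure C c) = to_closure C c) &
    forall i, coords (val Q) i = s (coords (val P) i).

Definition local_ring (P : point) : set K :=
  [set h | exists (e : nat) (f u : {mpoly F[n.+1]}),
    [/\ f \is e.-homog, u \is e.-homog, eval_at P u != 0 &
        h = mmap iota x f / mmap iota x u]].

Definition maximal_ideal (P : point) : set K :=
  [set h | exists (e : nat) (f u : {mpoly F[n.+1]}),
    [/\ f \is e.-homog, u \is e.-homog, eval_at P u != 0, eval_at P f = 0 &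
        h = mmap iota x f / mmap iota x u]].

Definition uniformizer (P : point) (t : K) : Prop :=
  maximal_ideal P t /\
  forall h, maximal_ideal P h -> exists2 u, local_ring P u & h = t * u.

(* At a geometric point P, the order of an element of K is the same in the
   local ring over F as over the algebraic closure, because F is perfect. *)
Definition has_order (P : point) (h : K) (k : int) : Prop :=
  exists t u, [/\ uniformizer P t, local_ring P u, ~ maximal_ideal P u &
                  h = t ^ k * u].

(* Divisors on the curve over the algebraic closure. *)
Definition divisor := {freeg point}.

Definition rational_divisor (D : divisor) : Prop :=
  forall P Q, conjugate_points P Q -> coeff Q D = coeff P D.

Definition linearly_equivalent (D E : divisor) : Prop :=
  exists2 h : K, h != 0 & forall P, has_order P h (coeff P D - coeff P E).

Definition divisor_class (D : divisor) : set divisor :=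
  [set E | rational_divisor E /\ linearly_equivalent D E].

(* (Pic^d C)(F) *)
Definition Pic (d : int) : set (set divisor) :=
  [set divisor_class D | D in [set D | rational_divisor D /\ deg D = d]].

(* H^0(C, O(D)), as a subset of K; the regular module K^o is K itself. *)
Definition global_sections (D : divisor) : set K^o :=
  [set h | h = 0 \/ forall P, exists2 k, has_order P h k & - coeff P D <= k].

Definition has_h0 (c : set divisor) (r : nat) : Prop :=
  exists2 D, c D & has_quotient_dim iota (global_sections D) [set 0] r.

(* Repartitions (adeles) of K: families of elements of K indexed by the closed
   points, almost all in the local ring.  Closed points are the Galois orbits
   of geometric points. *)
Definition repartition (r : point -> K^o) : Prop :=
  (forall P Q, conjugate_points P Q -> r Q = r P) /\
  finite_set [set P | ~ local_ring P (r P)].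

(* The genus is dim_F H^1(C, O_C).  The flasque resolution
   0 -> O_C -> K -> \bigoplus_P K / O_P -> 0 gives
   H^1(C, O_C) = R / (R(0) + K), where R is the space of repartitions and R(0)
   consists of those which lie in the local ring at every point. *)
Definition has_genus (g : nat) : Prop :=
  has_quotient_dim iota
    ([set r | repartition r] : set (point -> K^o))
    [set r | repartition r /\ exists h : K, forall P, local_ring P (r P - h)]
    g.

End CurveTheory.

Arguments Pic {F} C d.

(* Main.v *)
(* Write q = #|F| and let R be the space of repartitions. For an effective
   rational divisor E let Omega(E) be the space of linear functionals on
   R / (R(0) + K) = F^g which vanish on R(E). The proof counts pairs (E, v) with
   E effective of degree d and v a nonzero element of Omega(E).

   For fixed v, if v is in Omega(E) and in Omega(E') then it is in Omega(sup(E, E')),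
   so there is a largest such E. Multiplication embeds L(E) into Omega(0), hence
   h^0(E) <= g and deg E <= 2g - 1 by Riemann-Roch, so there are at most
   2^(2g-1) divisors E and fewer than q^g 2^(2g-1) pairs. On the other hand a class
   with h^0 = r >= i contains (q^r - 1) / (q - 1) effective divisors, and
   |Omega(E)| is at least the index of R(E) + K in R, which is q^(g - 1 - d + r).
   No duality between Omega and differentials is needed.

   Riemann-Roch in the form [R : R(D) + K] q^(deg D + 1) = q^g |L(D)| follows by
   adding one closed point at a time.

   The local ring at a smooth point with coordinates a is a discrete valuation
   ring for the following reason. Choose a power Q of q with a_k^Q = a_k for all k.
   As f(y)^Q = f(y^Q) for polynomials f over F, the maximal ideal is generated by the
   w_k = y_k^Q - y_k, and expanding the equations of the curve at y^Q = y + w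
   gives linear relations among the w_k whose matrix reduces to the Jacobian matrix
   at the point. *)
Require Import Defs.
From HB Require Import structures.
From mathcomp Require Import all_boot all_order all_algebra all_fingroup all_solvable all_field.
From mathcomp Require Import finmap mpoly freeg.
From mathcomp Require Import boolp classical_sets functions cardinality.
From mathcomp Require Import zify ring.
Set Implicit Arguments.
Unset Strict Implicit.
Unset Printing Implicit Defensive.
Import Order.TTheory GRing.Theory Num.Theory.
Local Open Scope classical_set_scope.
Local Open Scope ring_scope.

(** * Indices of subgroups *)

(** The two ranges of d in the theorem reduce to one condition: i, g and a = i - d - 1 + g are all
    at least 1. Riemann-Roch leaves at least q^a elements in Omega(E), and the estimate is symmetric
    in i and a. Its exponent is g + 1 - i - a = d - 2i + 2: a factor q^g for the choice of v, a
    factor q for the scalars relating sections with the same divisor, and a loss of about q^i and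
    q^a. Replacing q^i - 1 and q^a - 1 by q^i and q^a costs a factor 4, and 4 2^(2g-1) <= 16^g since
    g >= 1.

    R and K are infinite-dimensional and no L(D) is known to be finite at the start, so spaces are
    compared by the indices of subgroups, which over a finite field carry the same information as
    dimensions. The constants are not known at the start either: L(0) = F is deduced from one
    nonzero element of a finite L(D), which any class being counted supplies.

    The degree of a principal divisor is not taken for granted: its vanishing also comes out of
    Riemann-Roch. *)

Section Index.
Variable V : zmodType.
Implicit Types A B W : set V.

Definition subgroup W := W 0 /\ forall x y, W x -> W y -> W (x - y).

(** An explicit transversal makes sense for subsets of infinite groups and yields the index without
    forming a quotient. *)
Definition has_index W W' (N : nat) := exists b : 'I_N -> V,
  (forall k, W (b k)) /\ forall w, W w -> exists! k, W' (w - b k).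

Lemma subgroupN W x : subgroup W -> W x -> W (- x).
Proof. by case=> W0 WB Wx; rewrite -sub0r; apply: WB. Qed.

Lemma subgroupD W x y : subgroup W -> W x -> W y -> W (x + y).
Proof.
by move=> sW Wx Wy; rewrite -[y]opprK; apply: sW.2 => //; apply: subgroupN.
Qed.

Lemma subgroupBC W x y : subgroup W -> W (x - y) -> W (y - x).
Proof. by move=> sW; rewrite -(opprB x); apply: subgroupN. Qed.

Lemma subgroupBl W x y z : subgroup W -> W (x - z) -> W (x - y) -> W (y - z).
Proof.
move=> sW Wz Wy; have -> : y - z = (x - z) - (x - y).
  by rewrite opprB [RHS]addrC addrA subrK.
exact: sW.2.
Qed.

Lemma subgroup_sum W (I : finType) (f : I -> V) :
  subgroup W -> (forall i, W (f i)) -> W (\sum_i f i).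
Proof.
move=> sW Wf; elim/big_ind: _ => // [|x y]; first exact: sW.1.
exact: subgroupD.
Qed.

Lemma subgroup0 : subgroup [set 0 : V].
Proof. by split=> // x y /= -> ->; rewrite subr0. Qed.

Lemma has_index_finType W W' (T : finType) (b : T -> V) :
  (forall k, W (b k)) -> (forall w, W w -> exists! k, W' (w - b k)) ->
  has_index W W' #|T|.
Proof.
move=> Wb Hb; exists (fun k => b (enum_val k)); split=> // w /Hb [k [Wk uk]].
exists (enum_rank k); split; first by rewrite enum_rankK.
by move=> l /uk ->; rewrite enum_valK.
Qed.

Lemma has_index_gt0 W W' N : W 0 -> has_index W W' N -> (0 < N)%N.
Proof. by move=> W0 [b [_ /(_ _ W0) [k _]]]; case: N b k => // b []. Qed.

Lemma has_index_leq W W' M N : subgroup W' -> has_index W W' M -> has_index W W' N -> (M <= N)%N.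
Proof.
move=> sW' [b [Wb Hb]] [b' [_ Hb']].
have /choice[f fP] : forall k, exists l, W' (b k - b' l).
  by move=> k; have [l [? _]] := Hb' _ (Wb k); exists l.
suff inj : injective f by have := leq_card f inj; rewrite !card_ord.
move=> k l fkl; have [m [_ um]] := Hb _ (Wb k).
rewrite -(um k); last by rewrite subrr; apply: sW'.1.
apply: um; have := sW'.2 _ _ (fP k) (fP l).
by rewrite fkl opprB addrA subrK.
Qed.

Lemma has_index_inj W W' M N : subgroup W' -> has_index W W' M -> has_index W W' N -> M = N.
Proof.
by move=> sW' iM iN; apply/eqP; rewrite eqn_leq !(@has_index_leq W W').
Qed.

Lemma has_index_trans W W' W'' M N : subgroup W -> subgroup W' ->
  W' `<=` W -> W'' `<=` W' ->
  has_index W W' M -> has_index W' W'' N -> has_index W W'' (M * N)%N.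
Proof.
move=> sW sW' sub' sub'' [b [Wb Hb]] [c [Wc Hc]].
have -> : (M * N)%N = #|{: 'I_M * 'I_N}| by rewrite card_prod !card_ord.
apply: (@has_index_finType _ _ _ (fun k => b k.1 + c k.2)).
  by move=> k; apply: subgroupD => //; apply: sub'.
move=> w /Hb [k [Wk uk]]; have [l [Wl ul]] := Hc _ Wk.
exists (k, l); split=> /= [|[k' l'] /=]; rewrite opprD addrA // => Wkl.
have E : W' (w - b k').
  rewrite -(subrK (c l') (w - b k')); apply: subgroupD => //.
  exact: sub''.
by have ? := uk _ E; subst k'; rewrite (ul _ Wkl).
Qed.

(** Both intermediate indices are read off one transversal of W / W'': one representative for each
    class modulo W' serves W / W', and the representatives that lie in W' serve W' / W''. *)
Lemma has_index_sub W W' W'' N : subgroup W -> subgroup W' -> subgroup W'' ->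
  W' `<=` W -> W'' `<=` W' -> has_index W W'' N ->
  exists M M', [/\ has_index W W' M, has_index W' W'' M' & N = (M * M')%N].
Proof.
move=> sW sW' sW'' sub' sub'' iN; have [b [Wb Hb]] := iN.
(* [r k] depends only on the class of [b k] modulo W', so the k with [r k = Some k] are one for each
   class. *)
pose r k := [pick l | `[< W' (b k - b l) >]].
have i1 : exists M, has_index W W' M.
  exists #|{: {k | r k == Some k}}|.
  apply: (@has_index_finType _ _ _ (fun k => b (val k))) => [k|w Ww].
    exact: Wb.
  have [k [Wk _]] := Hb _ Ww.
  have [l El] : exists l, r k = Some l.
    rewrite /r; case: pickP => [l _|/(_ k)]; first by exists l.
    by rewrite subrr (asboolT sW'.1).
  have W'l : W' (b k - b l).
    by move: El; rewrite /r; case: pickP => // l' /asboolP ? [<-].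
  have rE k' : W' (b k - b k') -> r k' = Some l.
    move=> Wk'; rewrite -El; apply: eq_pick => m; apply/asbool_equiv_eq; split=> Hm.
      by rewrite -(subrK (b k') (b k)) -addrA; apply: subgroupD.
    exact: subgroupBl Hm Wk'.
  have rl : r l == Some l by rewrite rE.
  exists (exist _ l rl); split=> /= [|[k' rk'] /= Wk'].
    by rewrite -(subrK (b k) w) -addrA; apply: subgroupD => //; apply: sub''.
  apply/val_inj => /=.
  suff /rE : W' (b k - b k') by rewrite (eqP rk') => -[].
  by apply: (@subgroupBl _ w) => //; apply: sub''.
have i2 : exists M', has_index W' W'' M'.
  exists #|{: {k | `[< W' (b k) >]}}|.
  apply: (@has_index_finType _ _ _ (fun k => b (val k))) => [[k] /=/asboolP //|w Ww].
  have [k [Wk uk]] := Hb _ (sub' _ Ww).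
  have W'k : `[< W' (b k) >].
    apply/asboolP; rewrite -[b k]subr0.
    apply: (@subgroupBl _ w) => //; last exact: sub''.
    by rewrite subr0.
  exists (exist _ k W'k); split=> //= -[l W'l] /= /uk E.
  exact/val_inj.
have [[M iM] [M' iM']] := (i1, i2); exists M, M'; split=> //.
apply: (@has_index_inj W W'') => //; exact: (@has_index_trans _ W').
Qed.

End Index.

(* The isomorphism theorems, for the map A / A' -> W / W' induced by phi. *)
Section IndexHom.
Variables (V1 V2 : zmodType) (phi : {additive V1 -> V2}).
Variables (A A' : set V1) (W W' : set V2).
Hypotheses (sW' : subgroup W') (sA : subgroup A) (phiA : forall a, A a -> W (phi a))
  (kerA : forall a, A a -> (A' a <-> W' (phi a)))
  (surA : forall w, W w -> exists2 a, A a & W' (w - phi a)).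

Lemma has_index_hom N : has_index A A' N -> has_index W W' N.
Proof.
move=> [b [Ab Hb]]; exists (fun k => phi (b k)); split=> [k|w]; first exact: phiA.
move=> /surA [a Aa Wa]; have [k [Ak uk]] := Hb _ Aa.
exists k; split=> [|l Wl].
  rewrite -(subrK (phi a) w) -addrA; apply: subgroupD => //.
  by rewrite -raddfB; apply/kerA => //; apply: sA.2.
apply: uk; apply/kerA; first exact: sA.2.
rewrite raddfB -(subrK w (phi a)) -addrA; apply: subgroupD => //.
exact: subgroupBC.
Qed.

Lemma has_index_hom_inv N : has_index W W' N -> has_index A A' N.
Proof.
move=> [b [Wb Hb]].
have /choice[c cP] : forall k, exists a, A a /\ W' (b k - phi a).
  by move=> k; have [a Aa Wa] := surA (Wb k); exists a.
exists c; split=> [k|a Aa]; first exact: (cP k).1.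
have [k [Wk uk]] := Hb _ (phiA Aa).
exists k; split=> [|l /kerA H].
  apply/kerA; first by apply: sA.2 => //; exact: (cP k).1.
  rewrite raddfB -(subrK (b k) (phi a)) -addrA; apply: subgroupD => //.
  exact: (cP k).2.
apply: uk; rewrite -(subrK (phi (c l)) (phi a)) -addrA; apply: subgroupD => //.
  by rewrite -raddfB; apply: H; apply: sA.2 => //; exact: (cP l).1.
by apply: subgroupBC => //; exact: (cP l).2.
Qed.

End IndexHom.

(** * Annihilators in a finite vector space *)

Definition annihilator (F : finFieldType) (g : nat) (S : {set 'rV[F]_g}) :=
  [set v : 'rV[F]_g | [forall u in S, \sum_k v ord0 k * u ord0 k == 0]]%SET.

(** Pairing with a basis of the span U of S maps F^g linearly to F^(dim U), and the kernel
    annihilates S; by rank-nullity it has dimension at least g - dim U. The closure hypotheses say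
    that S is already U. *)
Lemma card_annihilator (F : finFieldType) (g : nat) (S : {set 'rV[F]_g}) :
  0 \in S -> (forall u v, u \in S -> v \in S -> u + v \in S) ->
  (forall a u, u \in S -> a *: u \in S) ->
  (#|F| ^ g <= #|S| * #|annihilator S|)%N.
Proof.
move=> S0 SD SZ; pose U := <<enum S>>%VS.
have SU u : (u \in U) = (u \in S).
  apply/idP/idP => [|uS]; last by apply: memv_span; rewrite mem_enum.
  move=> /coord_span ->; elim/big_ind: _ => // i _.
  by apply: SZ; rewrite -mem_enum; apply: mem_nth; rewrite -cardE.
have cardV (W : {vspace 'rV[F]_g}) : #|[set v | v \in W]%SET| = (#|F| ^ \dim W)%N.
  by rewrite cardsE; apply: card_vspace.
have -> : #|S| = (#|F| ^ \dim U)%N.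
  by rewrite -cardV; apply: eq_card => u; rewrite inE SU.
pose X := vbasis U.
pose f (v : 'rV[F]_g) : 'rV[F]_(\dim U) := \row_j \sum_k v 0 k * (tnth X j) 0 k.
have flin : linear f.
  move=> a u v; apply/rowP => j; rewrite !mxE mulr_sumr -big_split /=.
  by apply: eq_bigr => k _; rewrite !mxE mulrDl mulrA.
pose fL := GRing.isLinear.Build _ _ _ _ f flin.
pose f' : {linear 'rV[F]_g -> 'rV[F]_(\dim U)} := HB.pack f fL.
have := limg_ker_dim (linfun f') fullv; rewrite capfv => dimE.
have dle : (\dim (linfun f' @: fullv) <= \dim U)%N.
  by apply: leq_trans (dimvS (subvf _)) _; rewrite dimvf /dim /= mul1n.
have dg : \dim (fullv : {vspace 'rV[F]_g}) = g by rewrite dimvf /dim /= mul1n.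
apply: (@leq_trans (#|F| ^ (\dim U + \dim (lker (linfun f')))))%N.
  rewrite leq_exp2l ?finNzRing_gt1 //.
  by apply: leq_trans (eq_leq (esym dg)) _; rewrite -dimE addnC leq_add2r.
rewrite expnD leq_mul2l -(cardV (lker _)); apply/orP; right. apply: subset_leq_card.
apply/fintype.subsetP => v; rewrite inE memv_ker lfunE /= inE => /eqP fv0.
apply/forall_inP => u; rewrite -SU => /coord_vbasis ->.
under eq_bigr => k _ do rewrite summxE mulr_sumr.
rewrite exchange_big big1 //= => j _.
transitivity (coord X j u * (f v) 0 j); last by rewrite fv0 mxE mulr0.
rewrite mxE mulr_sumr; apply: eq_bigr => k _.
by rewrite mxE -/X (tnth_nth 0) mulrCA.
Qed.

(** * Divisors *)

Section Divisors.
Variable pt : choiceType.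
Implicit Types (D E : {freeg pt}) (s : seq pt).

Lemma coeff_sum_uniq s (f : pt -> int) Q : uniq s ->
  coeff Q (\sum_(P <- s) << f P *g P >>) = if Q \in s then f Q else 0.
Proof.
move=> us; rewrite raddf_sum /=; under eq_bigr => P _ do rewrite coeffU.
case: ifP => Qs.
  rewrite (bigD1_seq Q) //= eqxx mulr1 big1 ?addr0 // => P /negPf nPQ.
  by rewrite nPQ mulr0.
rewrite big_seq big1 // => P Ps; case: eqP => [PQ|]; last by rewrite mulr0.
by rewrite -PQ Ps in Qs.
Qed.

Lemma divisor_of_fun (f : pt -> int) s : (forall P, f P != 0 -> P \in s) ->
  exists D, forall P, coeff P D = f P.
Proof.
move=> fs; exists (\sum_(P <- undup s) << f P *g P >>) => Q.
rewrite coeff_sum_uniq ?undup_uniq // mem_undup; case: ifP => // Qs.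
by have [->//|/fs] := eqVneq (f Q) 0; rewrite Qs.
Qed.

Lemma divisorP D E : (forall P, coeff P D = coeff P E) -> D = E.
Proof. by move=> H; apply/eqP/freeg_eqP => P; apply: H. Qed.

Lemma deg_sum (s : seq pt) (f : pt -> int) :
  deg (\sum_(P <- s) << f P *g P >>) = \sum_(P <- s) f P.
Proof. by rewrite raddf_sum /=; apply: eq_bigr => P _; rewrite degU. Qed.

Lemma deg_ge0 D : (forall P, 0 <= coeff P D) -> 0 <= deg D.
Proof. by move=> D0; rewrite -(freeg_sumE D) deg_sum sumr_ge0. Qed.

Lemma effective_deg0 D : (forall P, 0 <= coeff P D) -> deg D = 0 -> D = 0.
Proof. by move=> /fgposP; exact: fgpos_eq0P. Qed.

(** A point of multiplicity m leaves m + 1 <= 2^m choices. The induction removes one point P from D: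
    either E is below D - P, or E has full multiplicity at P and E - P is below D - P. *)
Lemma subdivisors_bound D : (forall P, 0 <= coeff P D) ->
  exists2 s : seq {freeg pt}, (size s <= 2 ^ `|deg D|)%N &
    forall E, (forall P, 0 <= coeff P E <= coeff P D) -> E \in s.
Proof.
move=> D0; have [n] := ubnP `|deg D|%N; elim: n => // n IHn in D D0 *.
rewrite ltnS => degn.
have [/eqP dD0|] := eqVneq (dom D) [::].
  rewrite dom_eq0 in dD0; exists [:: 0].
    by rewrite expn_gt0.
  move=> E HE; rewrite inE; apply/eqP/divisorP => P.
  have := HE P; rewrite (eqP dD0) coeff0 => /andP[? ?].
  by apply/eqP; rewrite eq_le; apply/andP.
case dD: (dom D) => [//|P s'] _.
have DP : 1 <= coeff P D.
  have : P \in dom D by rewrite dD inE eqxx.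
  by rewrite mem_dom => DP; rewrite -gtz0_ge1 lt_def DP D0.
pose D' := D - << P >>.
have cD' Q : coeff Q D' = coeff Q D - (P == Q)%:R by rewrite coeffB coeffU mul1r.
have D'0 Q : 0 <= coeff Q D'.
  by rewrite cD'; case: eqP => [<-|_]; rewrite ?subr_ge0 ?subr0.
have dD' : deg D = deg D' + 1 by rewrite degB degU subrK.
have := deg_ge0 D'0 => dD'0.
have dE : `|deg D|%N = `|deg D'|.+1 by rewrite dD'; lia.
have [s sz Hs] := IHn D' D'0 ltac:(by rewrite -ltnS -dE).
exists (s ++ [seq << P >> + E | E <- s]).
  by rewrite size_cat size_map dE expnS mul2n -addnn leq_add.
move=> E HE; rewrite mem_cat.
have [EP|EP] := lerP (coeff P E) (coeff P D').
  rewrite Hs // => Q; have /andP[-> /=] := HE Q.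
  by have [<-//|PQ] := eqVneq P Q; rewrite cD' (negPf PQ) subr0.
apply/orP; right; apply/mapP; exists (E - << P >>); last by rewrite addrCA subrr addr0.
apply: Hs => Q; rewrite cD' coeffB coeffU mul1r; have /andP[E0 ED] := HE Q.
have [PQ|PQ] := eqVneq P Q; last by rewrite !subr0 E0.
rewrite -PQ cD' eqxx /= in EP E0 ED *.
by rewrite lerB // andbT subr_ge0; move: EP DP; lia.
Qed.

End Divisors.

(** * Valuations and repartitions *)

Section Adeles.
Variables (F : finFieldType) (K : fieldType) (iota : {rmorphism F -> K}).
Variables (pt : choiceType) (conj : pt -> pt -> Prop) (ord : pt -> K -> int).

(** [ord P] is a total function whose value at 0 means nothing, hence the separate clause for 0. *)
Definition vge (P : pt) (k : int) : set K := [set x | x = 0 \/ k <= ord P x].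

(** Everything about the curve that Riemann-Roch and the counting rely on. [orbit_residue]
    identifies the number of geometric points over a closed point with the degree of its residue
    field, and [constant_ex] is where geometric irreducibility enters. *)
Record valuations : Prop := {
  conj_refl : forall P, conj P P;
  conj_sym : forall P Q, conj P Q -> conj Q P;
  conj_trans : forall P Q R, conj P Q -> conj Q R -> conj P R;
  ordM : forall P x y, x != 0 -> y != 0 -> ord P (x * y) = ord P x + ord P y;
  vgeD : forall P k x y, vge P k x -> vge P k y -> vge P k (x + y);
  ord_iota : forall P c, c != 0 -> ord P (iota c) = 0;
  ord_conj : forall P Q x, conj P Q -> ord Q x = ord P x;
  ord_finite : forall x, x != 0 -> exists s : seq pt, forall P, ord P x != 0 -> P \in s;
  orbit_residue : forall P, exists s : seq pt,
    [/\ uniq s, forall Q, Q \in s <-> conj P Q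
      & has_index (vge P 0) (vge P 1) (#|F| ^ size s)];
  uniformizer_ex : forall P, exists2 t, t != 0 & ord P t = 1;
  constant_ex : forall h, (forall P, vge P 0 h) ->
    (exists2 p : {poly F}, p != 0 & root (map_poly iota p) h) -> exists c, h = iota c
}.

Hypothesis H : valuations.
Local Notation q := #|F|.
Implicit Types (D E : {freeg pt}) (P Q : pt) (r : pt -> K^o).

Lemma ord_one P : ord P 1 = 0.
Proof. by rewrite -(rmorph1 iota) (ord_iota H) ?oner_neq0. Qed.

Lemma ordV P x : x != 0 -> ord P x^-1 = - ord P x.
Proof.
move=> x0; apply/eqP; rewrite -addr_eq0 -(ordM H) ?invr_eq0 // mulVf //.
by rewrite ord_one.
Qed.

Lemma vge0 P k : vge P k 0. Proof. by left. Qed.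

Lemma vge_le P k l x : l <= k -> vge P k x -> vge P l x.
Proof. by move=> lk [->|kx]; [left|right; apply: le_trans kx]. Qed.

Lemma vgeM P k l x y : vge P k x -> vge P l y -> vge P (k + l) (x * y).
Proof.
have [->|x0] := eqVneq x 0; first by rewrite mul0r; left.
have [->|y0] := eqVneq y 0; first by rewrite mulr0; left.
move=> [/eqP|kx]; rewrite ?(negPf x0) // => -[/eqP|ly]; rewrite ?(negPf y0) //.
by right; rewrite (ordM H) // lerD.
Qed.

Lemma vge_iota P c : vge P 0 (iota c).
Proof.
have [->|c0] := eqVneq c 0; first by rewrite rmorph0; left.
by right; rewrite (ord_iota H).
Qed.

Lemma vge_scale P k x h : h != 0 -> vge P k (h * x) <-> vge P (k - ord P h) x.
Proof.
move=> h0; split=> Hx.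
  rewrite -(mulKf h0 x) addrC; apply: vgeM => //; right.
  by rewrite ordV.
by rewrite -(subrK (ord P h) k) addrC; apply: vgeM => //; right.
Qed.

Lemma vge_subgroup P k : subgroup (vge P k).
Proof.
split; first exact: vge0.
move=> x y Hx Hy; apply: (vgeD H) => //.
have -> : - y = iota (-1) * y by rewrite rmorphN1 mulN1r.
by rewrite -[k]add0r; apply: vgeM => //; apply: vge_iota.
Qed.

Lemma vge_conj P Q k x : conj P Q -> vge P k x -> vge Q k x.
Proof. by move=> /(ord_conj H x) E [->|Hx]; [left|right; rewrite E]. Qed.

Lemma ord_surj P k : exists2 t, t != 0 & ord P t = k.
Proof.
have [t t0 tP] := uniformizer_ex H P.
have nat_case (n : nat) : exists2 t, t != 0 & ord P t = n.
  elim: n => [|n [u u0 uP]]; first by exists 1; rewrite ?oner_neq0 ?ord_one.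
  by exists (u * t); rewrite ?mulf_neq0 // (ordM H) // uP tP; lia.
case: k => n; first exact: nat_case.
have [u u0 uP] := nat_case n.+1.
by exists u^-1; rewrite ?invr_eq0 // ordV // uP.
Qed.

Definition stable r := forall P Q, conj P Q -> r Q = r P.

Definition repartitions : set (pt -> K^o) :=
  [set r | stable r /\ finite_set [set P | ~ vge P 0 (r P)]].

Definition bounded_adeles D : set (pt -> K^o) :=
  [set r | stable r /\ forall P, vge P (- coeff P D) (r P)].

(** This is R(D) + K, with [h] the component in K. *)
Definition principal_adeles D : set (pt -> K^o) :=
  [set r | stable r /\ exists h : K, forall P, vge P (- coeff P D) (r P - h)].

Definition sections D : set K := [set h | forall P, vge P (- coeff P D) h].

Definition rational D := forall P Q, conj P Q -> coeff Q D = coeff P D.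

Local Notation R := repartitions.
Local Notation A := bounded_adeles.
Local Notation AK := principal_adeles.
Local Notation L := sections.

Lemma stableB r r' : stable r -> stable r' -> stable (r - r').
Proof. by move=> sr sr' P Q PQ; rewrite !fctE (sr _ _ PQ) (sr' _ _ PQ). Qed.

Lemma stableZ (h : K) r : stable r -> stable (h *: r).
Proof. by move=> sr P Q PQ; rewrite !fctE (sr _ _ PQ). Qed.

Lemma subgroup_A D : subgroup (A D).
Proof.
split; first by split=> // P; apply: vge0.
move=> r r' [sr Hr] [sr' Hr']; split; first exact: stableB.
by move=> P; apply: (vge_subgroup P _).2.
Qed.

Lemma subgroup_L D : subgroup (L D).
Proof.
by split=> [P|x y Hx Hy P]; [apply: vge0|apply: (vge_subgroup P _).2].
Qed.

Lemma subgroup_AK D : subgroup (AK D).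
Proof.
split; first by split=> //; exists 0 => P; rewrite subr0; apply: vge0.
move=> r r' [sr [h Hr]] [sr' [h' Hr']]; split; first exact: stableB.
exists (h - h') => P; rewrite !fctE.
have -> : r P - r' P - (h - h') = (r P - h) - (r' P - h') by rewrite !opprB [h' - h]addrC addrACA [- r' P + _]addrC.
exact: (vge_subgroup P _).2.
Qed.

Lemma subgroup_R : subgroup R.
Proof.
split.
  split=> //; apply: (sub_finite_set _ (@finite_set0 pt)) => P /=; apply.
  exact: vge0.
move=> r r' [sr fr] [sr' fr']; split; first exact: stableB.
apply: (@sub_finite_set _ _ ([set P | ~ vge P 0 (r P)] `|` [set P | ~ vge P 0 (r' P)])).
  move=> P /= nP; apply/not_andP => -[HP HP']; apply: nP.
  exact: (vge_subgroup P _).2.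
by rewrite finite_setU.
Qed.

Lemma AK_subR D : AK D `<=` R.
Proof.
move=> r [sr [h Hr]]; split=> //.
have [s hs] : exists s : seq pt, forall P, ~ vge P 0 h -> P \in s.
  have [->|h0] := eqVneq h 0; first by exists [::] => P []; apply: vge0.
  have [s hs] := ord_finite H h0; exists s => P nP; apply: hs.
  by apply/eqP => ohP; apply: nP; right; rewrite ohP.
apply: (@sub_finite_set _ _ [set` (s ++ dom D)]); last exact: finite_seq.
move=> P /= nP; rewrite mem_cat; apply/orP.
have [nD|] := boolP (P \in dom D); [by right|left; apply: hs => hP; apply: nP].
rewrite -(subrK h (r P)); apply: (vgeD H) => //.
by have := Hr P; rewrite coeff_outdom // oppr0.
Qed.

Lemma A_subAK D : A D `<=` AK D.
Proof. by move=> r [sr Hr]; split=> //; exists 0 => P; rewrite subr0. Qed.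

Lemma coeff_oppr_le D E : (forall P, coeff P D <= coeff P E) ->
  forall P, - coeff P E <= - coeff P D.
Proof. by move=> DE P; rewrite lerN2. Qed.

Lemma A_mono D E : (forall P, coeff P D <= coeff P E) -> A D `<=` A E.
Proof.
by move=> DE r [sr Hr]; split=> // P; apply: vge_le (Hr P); rewrite lerN2.
Qed.

Lemma AK_mono D E : (forall P, coeff P D <= coeff P E) -> AK D `<=` AK E.
Proof.
move=> DE r [sr [h Hr]]; split=> //; exists h => P.
by apply: vge_le (Hr P); rewrite lerN2.
Qed.

Lemma L_mono D E : (forall P, coeff P D <= coeff P E) -> L D `<=` L E.
Proof. by move=> DE h Hh P; apply: vge_le (Hh P); rewrite lerN2. Qed.

Lemma orbit_mem P Q Q' (s : seq pt) : (forall Q, Q \in s <-> conj P Q) ->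
  conj Q Q' -> (Q' \in s) = (Q \in s).
Proof.
move=> Ps QQ'; apply/idP/idP => /Ps PQ; apply/Ps; last exact: (conj_trans H) QQ'.
by apply: (conj_trans H) PQ _; exact: (conj_sym H).
Qed.

(** A stable family is determined on the orbit by its value at P. Multiplication by t of order
    [coeff P D + 1] carries the possible values at P to the local ring, and those allowed by D to
    its maximal ideal, so the quotient is the residue field. *)
Lemma index_A_orbit D P (s : seq pt) : rational D -> uniq s ->
  (forall Q, Q \in s <-> conj P Q) ->
  has_index (vge P 0) (vge P 1) (q ^ size s) ->
  has_index (A (D + \sum_(Q <- s) << Q >>)) (A D) (q ^ size s).
Proof.
move=> rD us Ps [b [Hb bP]]; set D' := D + _.
have cD' Q : coeff Q D' = coeff Q D + (Q \in s)%:R.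
  by rewrite coeffD coeff_sum_uniq //; case: (Q \in s).
have [t t0 tP] := ord_surj P (coeff P D + 1).
have PP : P \in s by apply/Ps; apply: (conj_refl H).
(* Representatives are constant on the orbit and zero off it; being constant there makes them
   stable. *)
exists (fun k Q => if Q \in s then t^-1 * b k else 0); split=> [k|r [sr Hr]].
  split=> [Q Q' QQ'|Q].
    by rewrite (orbit_mem Ps QQ').
  rewrite cD'; case: ifPn => Qs; last exact: vge0.
  apply: (vge_conj (proj1 (Ps Q) Qs)); rewrite (rD _ _ (proj1 (Ps Q) Qs)).
  by apply/(vge_scale _ _ _); rewrite ?invr_eq0 // ordV // tP opprK addNr.
have tr0 : vge P 0 (t * r P).
  by apply/(vge_scale _ _ _) => //; rewrite tP sub0r; have := Hr P; rewrite cD' PP.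
have key k : A D (r - (fun Q => if Q \in s then t^-1 * b k else 0 : K^o)) <->
   vge P 1 (t * r P - b k).
  have E : t * r P - b k = t * (r P - t^-1 * b k) by rewrite mulrBr mulVKf.
  rewrite E (vge_scale _ _ _ t0) tP opprD addrCA subrr addr0; split=> [[_ /(_ P)]|HP].
    by rewrite !fctE PP.
  split=> [Q Q' QQ'|Q].
    by rewrite !fctE (sr _ _ QQ') (orbit_mem Ps QQ').
  rewrite !fctE; case: ifPn => Qs; last first.
    by have := Hr Q; rewrite cD' (negPf Qs) addr0 subr0.
  have cPQ := proj1 (Ps Q) Qs.
  by rewrite (sr _ _ cPQ) (rD _ _ cPQ); apply: (vge_conj cPQ).
have [k [Hk uk]] := bP _ tr0; exists k; split; first exact/key.
by move=> l /key; exact: uk.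
Qed.

Lemma index_A D E : rational D -> rational E ->
  (forall P, coeff P D <= coeff P E) -> has_index (A E) (A D) (q ^ `|deg (E - D)|).
Proof.
move=> rD rE; have [n] := ubnP (absz (deg (E - D))); elim: n => // n IHn in D rD *.
rewrite ltnS => degn DE.
have ED0 P : 0 <= coeff P (E - D) by rewrite coeffB subr_ge0.
have [/eqP|] := eqVneq (dom (E - D)) [::].
  rewrite dom_eq0 subr_eq0 => /eqP ->; rewrite subrr deg0 absz0 expn0.
  exists (fun=> 0); split=> [_|w Aw]; first exact: (subgroup_A D).1.
  by exists ord0; split=> [|k _]; rewrite ?subr0 // (ord1 k).
case dED: (dom (E - D)) => [//|P s'] _.
have [s [us Ps iP]] := orbit_residue H P.
pose D' := D + \sum_(Q <- s) << Q >>.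
have cD' Q : coeff Q D' = coeff Q D + (Q \in s)%:R.
  by rewrite coeffD coeff_sum_uniq //; case: (Q \in s).
have rD' : rational D'.
  by move=> Q Q' QQ'; rewrite !cD' (rD _ _ QQ') (orbit_mem Ps QQ').
have DP : coeff P D + 1 <= coeff P E.
  have : P \in dom (E - D) by rewrite dED inE eqxx.
  rewrite mem_dom coeffB subr_eq0 => ne.
  by rewrite -ltzD1 ltrD2r lt_def ne DE.
have D'E Q : coeff Q D' <= coeff Q E.
  rewrite cD'; case: (boolP (Q \in s)) => [/Ps PQ|_]; last by rewrite addr0.
  by rewrite (rD _ _ PQ) (rE _ _ PQ).
have PP : P \in s by apply/Ps; apply: (conj_refl H).
have D'E0 : 0 <= deg (E - D') by apply: deg_ge0 => Q; rewrite coeffB subr_ge0.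
have dE : absz (deg (E - D)) = (absz (deg (E - D')%R) + size s)%N.
  have -> : E - D = (E - D') + \sum_(Q <- s) << Q >> by rewrite opprD addrA subrK.
  rewrite degD deg_sum big_const_seq count_predT iter_addr addr0.
  by move: D'E0; lia.
have s0 : (0 < size s)%N by case: (s) PP.
rewrite dE expnD; apply: (@has_index_trans _ _ (A D')).
- exact: subgroup_A.
- exact: subgroup_A.
- exact: A_mono.
- by apply: A_mono => Q; rewrite cD' lerDl.
- by apply: IHn => //; apply: leq_trans degn; rewrite dE -addn1 leq_add2l.
- exact: index_A_orbit.
Qed.

End Adeles.

(** * The Riemann-Roch formula *)

Section RiemannRoch.
Variables (F : finFieldType) (K : fieldType) (iota : {rmorphism F -> K}).
Variables (pt : choiceType) (conj : pt -> pt -> Prop) (ord : pt -> K -> int).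
Hypothesis H : valuations iota conj ord.
Local Notation q := #|F|.
Implicit Types (D E : {freeg pt}) (P Q : pt) (r : pt -> K^o).
Local Notation R := (repartitions conj ord).
Local Notation A := (bounded_adeles conj ord).
Local Notation AK := (principal_adeles conj ord).
Local Notation L := (sections ord).
Local Notation rational := (rational conj).

Definition constant_adele (h : K) : pt -> K^o := fun=> h.

Lemma constant_adele_additive : zmod_morphism constant_adele.
Proof. by []. Qed.

HB.instance Definition _ :=
  GRing.isZmodMorphism.Build K (pt -> K^o) constant_adele constant_adele_additive.

Lemma subgroupI (V : zmodType) (W W' : set V) :
  subgroup W -> subgroup W' -> subgroup (W `&` W').
Proof.
move=> [W0 WB] [W'0 W'B]; split=> // x y [Wx W'x] [Wy W'y].
by split; [apply: WB|apply: W'B].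
Qed.

(** The exact sequence 0 -> L(E)/L(D) -> R(E)/R(D) -> (R(E)+K)/(R(D)+K) -> 0. The intersection of
    R(E) with R(D) + K cuts R(E)/R(D) in two: the upper part is the right-hand term by the
    isomorphism theorem, and the lower part is L(E)/L(D) embedded diagonally. *)
Lemma index_exact D E : rational D -> rational E ->
  (forall P, coeff P D <= coeff P E) ->
  exists N M, [/\ has_index (AK E) (AK D) N, has_index (L E) (L D) M
    & (N * M = q ^ absz (deg (E - D)%R))%N].
Proof.
move=> rD rE DE; have iA := index_A H rD rE DE.
have sI : subgroup (A E `&` AK D).
  by apply: subgroupI; [apply: (subgroup_A H)|apply: (subgroup_AK H)].
have [|//|N [M [iN iM ->]]] := has_index_sub (subgroup_A H E) sI (subgroup_A H D) _ _ iA.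
- by move=> r [].
- by move=> r Ar; split; [apply: A_mono Ar|apply: A_subAK].
exists N, M; split=> //.
  apply: (@has_index_hom _ _ idfun (A E) (A E `&` AK D)) iN.
  - exact: (subgroup_AK H).
  - exact: (subgroup_A H).
  - exact: A_subAK.
  - by move=> r Ar /=; split=> [[]//|AKr]; split.
  - move=> r [sr [h Hr]]; exists (r - constant_adele h).
      by split=> //; exact: stableB.
    rewrite opprB addrC subrK; split=> //; exists h => P.
    by rewrite subrr; exact: vge0.
apply: (@has_index_hom_inv _ _ constant_adele _ _ (A E `&` AK D) (A D)) iM.
- exact: (subgroup_A H).
- exact: (subgroup_L H).
- move=> h Lh; split; first by split.
  by split=> //; exists h => P; rewrite subrr; exact: vge0.
- by move=> h Lh; split=> [LD|[_ LD]]; [split|].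
move=> r [[sr Hr] [_ [h Hh]]]; exists h.
  move=> P; have := (vge_subgroup H P (- coeff P E)).2 _ _ (Hr P).
  move=> /(_ _ (vge_le (coeff_oppr_le DE P) (Hh P))).
  by rewrite opprB addrC subrK.
by split=> [|P]; [exact: stableB|exact: Hh].
Qed.

Section Genus.
Variable g : nat.
Hypotheses (genus : has_index R (AK 0) (q ^ g)) (constants : has_index (L 0) [set 0] q).

Lemma rational0 : rational 0. Proof. by move=> P Q _; rewrite !coeff0. Qed.

Lemma rational_fgpos D : rational D -> rational (fgpos D).
Proof. by move=> rD P Q PQ; rewrite !coeff_fgposE (rD _ _ PQ). Qed.

(** The exact sequence for 0 <= D, inserted in the chain of R, R(D) + K and R(0) + K. The 1 added to
    the degree accounts for |L(0)| = q. *)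
Lemma riemann_roch_effective D : rational D -> (forall P, 0 <= coeff P D) ->
  exists N M, [/\ has_index R (AK D) N, has_index (L D) [set 0] M
    & (N * (q ^ (absz (deg D)).+1) = q ^ g * M)%N].
Proof.
move=> rD D0; have le0D P : coeff P 0 <= coeff P D by rewrite coeff0.
have [N0 [M0 [iN0 iM0 NM0]]] := index_exact rational0 rD le0D.
rewrite subr0 in NM0.
have [||N [N0' [iN iN0' NN]]] := has_index_sub (subgroup_R H) (subgroup_AK H D) (subgroup_AK H 0) _ _ genus.
- exact: (AK_subR H).
- exact: AK_mono.
have eN0 : N0' = N0 := has_index_inj (subgroup_AK H 0) iN0' iN0.
exists N, (M0 * q)%N; split=> //.
  apply: (@has_index_trans _ _ (L 0)) iM0 constants.
  - exact: (subgroup_L H).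
  - exact: (subgroup_L H).
  - exact: L_mono.
  - by move=> h /= ->; exact: (subgroup_L H 0).1.
by rewrite NN eN0 expnS -NM0 mulnA [(N * q)%N]mulnC; lia.
Qed.

(** With E the positive part of D, the effective case for E is divided by the exact sequence for D
    <= E. The identity lives in the rationals because deg D + 1 may be negative. *)
Lemma riemann_roch D : rational D ->
  exists N M, [/\ has_index R (AK D) N, has_index (L D) [set 0] M
    & (N%:R * q%:R ^ (deg D + 1) = q%:R ^+ g * M%:R :> rat)].
Proof.
move=> rD; have rE := rational_fgpos rD; set E := fgpos D in rE.
have E0 P : 0 <= coeff P E by rewrite coeff_fgposE le_max lexx.
have DE P : coeff P D <= coeff P E by rewrite coeff_fgposE le_max lexx orbT.
have [N1 [M1 [iN1 iM1 NM1]]] := riemann_roch_effective rE E0.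
have [N0 [M0 [iN0 iM0 NM0]]] := index_exact rD rE DE.
have [||M0' [M [iM0' iM MM]]] := has_index_sub (subgroup_L H E) (subgroup_L H D) (subgroup0 _) _ _ iM1.
- exact: L_mono.
- by move=> h /= ->; exact: (subgroup_L H D).1.
have eM0 : M0' = M0 := has_index_inj (subgroup_L H D) iM0' iM0.
exists (N1 * N0)%N, M; split=> //.
  apply: (@has_index_trans _ _ (AK E)) iN1 iN0.
  - exact: (subgroup_R H).
  - exact: (subgroup_AK H).
  - exact: (AK_subR H).
  - exact: AK_mono.
have q0 : (q%:R : rat) != 0 by rewrite pnatr_eq0 -lt0n ltnW // finNzRing_gt1.
have M0nz : (M0%:R : rat) != 0.
  rewrite pnatr_eq0 -lt0n; apply: has_index_gt0 iM0; exact: (subgroup_L H E).1.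
apply: (mulIf M0nz).
have {}NM0 : N0%:R * M0%:R = q%:R ^ (deg E - deg D) :> rat.
  rewrite -natrM NM0 natrX exprnP degB; congr (_ ^ _).
  by apply: gez0_abs; rewrite -degB; apply: deg_ge0 => P; rewrite coeffB subr_ge0.
have {}NM1 : N1%:R * q%:R ^ (deg E + 1) = q%:R ^+ g * (M0%:R * M%:R) :> rat.
  rewrite -natrM -eM0 -MM -natrX -natrM -NM1 natrM natrX exprnP; congr (_ * _ ^ _).
  by rewrite -addn1 PoszD gez0_abs //; apply: deg_ge0.
rewrite natrM; transitivity (N1%:R * ((N0%:R * M0%:R) * q%:R ^ (deg D + 1)) : rat).
  by rewrite -!mulrA; congr (_ * (_ * _)); exact: mulrC.
by rewrite NM0 -expfzDr // addrA subrK NM1 [M0%:R * _]mulrC mulrA.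
Qed.

End Genus.

Section Multiplication.
Variables (D E : {freeg pt}) (h : K).
Hypotheses (h0 : h != 0) (hP : forall P, ord P h = coeff P D - coeff P E).

Let hge P x : vge ord P (- coeff P E) (h * x) <-> vge ord P (- coeff P D) x.
Proof.
rewrite (vge_scale H _ _ _ h0) hP.
by have -> : - coeff P E - (coeff P D - coeff P E) = - coeff P D by lia.
Qed.

Lemma has_index_sections_equiv N : has_index (L D) [set 0] N -> has_index (L E) [set 0] N.
Proof.
apply: (@has_index_hom _ _ (h \*o idfun)).
- exact: subgroup0.
- exact: (subgroup_L H).
- by move=> x Lx P; apply/hge.
- by move=> x _ /=; split=> [->|/eqP]; rewrite ?mulr0 // mulf_eq0 (negPf h0) => /eqP.
move=> y Ly; exists (h^-1 * y); last by rewrite /= mulVKf // subrr.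
by move=> P; apply/hge; rewrite mulVKf.
Qed.

Lemma repartitionsZ (a : K) r : R r -> R (a *: r).
Proof.
move=> [sr fr]; split; first exact: stableZ.
have [->|a0] := eqVneq a 0.
  by apply: (sub_finite_set _ (@finite_set0 pt)) => P /=; rewrite scale0r; apply; left.
have [s hs] := ord_finite H a0.
apply: (@sub_finite_set _ _ ([set P | ~ vge ord P 0 (r P)] `|` [set` s])).
  move=> P /= nP; apply: contrapT => /not_orP[/contrapT rP Ps].
  apply: nP; apply/(vge_scale H _ _ _ a0); apply: vge_le rP.
  by case: (eqVneq (ord P a) 0) => [->//|/hs].
by rewrite finite_setU; split=> //; exact: finite_seq.
Qed.

(** Multiplication by h is an automorphism of R that carries R(D) + K onto R(E) + K. *)
Lemma has_index_adeles_equiv N : has_index R (AK D) N -> has_index R (AK E) N.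
Proof.
have hK r : h *: (h^-1 *: r) = r by rewrite scalerA mulfV // scale1r.
apply: (@has_index_hom _ _ ( *:%R h)).
- exact: (subgroup_AK H).
- exact: (subgroup_R H).
- by move=> r; exact: repartitionsZ.
- move=> r _; split=> -[sr [a Ha]].
    split; first exact: stableZ.
    exists (h * a) => P; have -> : (h *: r) P - h * a = h * (r P - a) by rewrite mulrBr.
    by apply/hge.
  split.
    by have := stableZ h^-1 sr; rewrite scalerA mulVf // scale1r.
  exists (h^-1 * a) => P; apply/hge.
  by rewrite mulrBr mulVKf //; exact: Ha.
move=> r Rr; exists (h^-1 *: r); first exact: repartitionsZ.
by rewrite /= hK subrr; exact: (subgroup_AK H E).1.
Qed.

End Multiplication.
End RiemannRoch.

(** * Linear functionals on repartitions *)

Lemma has_index_nonzero (V : zmodType) (W : set V) M m :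
  W 0 -> has_index W [set 0] M -> (m < M)%N ->
  exists f : 'I_m -> V, injective f /\ forall k, W (f k) /\ f k != 0.
Proof.
move=> W0 [b [Wb Hb]]; case: M b Wb Hb => // M b Wb Hb; rewrite ltnS => mM.
have inj k l : b k = b l -> k = l.
  move=> kl; have [o [_ u]] := Hb _ (Wb k).
  by rewrite -(u k) /= ?subrr // -(u l) //= kl subrr.
have [k0 [/= /subr0_eq Hk0 _]] := Hb _ W0.
(* The representatives list the elements of W, and [k0] is the index of 0; [lift k0] skips it. *)
exists (fun k => b (fintype.lift k0 (widen_ord mM k))); split=> [k l /inj/lift_inj|k].
  by case/(congr1 val) => kl; apply/val_inj.
split=> //; apply/eqP; rewrite Hk0 => /inj/eqP.
by apply/negP; rewrite eq_sym neq_lift.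
Qed.

Section FiniteDimension.
Variables (F : finFieldType) (K : fieldType) (iota : {rmorphism F -> K}).
Variables (V : lmodType K) (W W' : set V).
Hypotheses (sW : subgroup W) (WZ : forall c w, W w -> W (iota c *: w)).

Lemma quotient_dim_index r : has_quotient_dim iota W W' r ->
  has_index W W' (#|F| ^ r).
Proof.
move=> [b [Wb Hb]]; have -> : (#|F| ^ r)%N = #|{ffun 'I_r -> F}|.
  by rewrite card_ffun card_ord.
apply: (@has_index_finType _ _ _ _ (fun c : {ffun 'I_r -> F} => \sum_k iota (c k) *: b k)).
  by move=> c; apply: subgroup_sum => // k; apply: WZ.
exact: Hb.
Qed.

Hypotheses (sW' : subgroup W') (W'Z : forall c w, W' w -> W' (iota c *: w)).

Lemma quotient_coordinates r : has_quotient_dim iota W W' r ->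
  exists c : V -> 'rV[F]_r, [/\ forall x y, W x -> W y -> c (x - y) = c x - c y,
    forall a x, W x -> c (iota a *: x) = a *: c x,
    forall x, W x -> (c x = 0 <-> W' x) & forall v, exists2 x, W x & c x = v].
Proof.
move=> [b [Wb Hb]]; pose comb (v : 'rV[F]_r) := \sum_k iota (v ord0 k) *: b k.
have Wcomb v : W (comb v) by apply: subgroup_sum => // k; apply: WZ.
have combB u v : comb (u - v) = comb u - comb v.
  by rewrite /comb -sumrB; apply: eq_bigr => k _; rewrite !mxE rmorphB scalerBl.
have combZ a v : comb (a *: v) = iota a *: comb v.
  by rewrite /comb scaler_sumr; apply: eq_bigr => k _; rewrite mxE rmorphM scalerA.
have Hcomb w : W w -> exists v, W' (w - comb v) /\ forall u, W' (w - comb u) -> u = v.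
  move=> /Hb [c [Hc uc]]; exists (\row_k c k); split.
    suff -> : comb (\row_k c k) = \sum_k iota (c k) *: b k by [].
    by apply: eq_bigr => k _; rewrite mxE.
  move=> u Hu; apply/rowP => k; rewrite mxE (uc [ffun k => u ord0 k]) ?ffunE //.
  suff <- : comb u = \sum_k iota ([ffun k => u ord0 k] k) *: b k by [].
  by apply: eq_bigr => l _; rewrite ffunE.
(* Outside W the coordinates get the junk value 0, so linearity can be claimed on W only. *)
have /choice[c cP] : forall w, exists v, W w -> W' (w - comb v) /\ forall u, W' (w - comb u) -> u = v.
  move=> w; have [/Hcomb[v ?]|nW] := pselect (W w); first by exists v.
  by exists 0.
exists c; split.
- move=> x y Wx Wy; apply/esym/(cP _ (sW.2 _ _ Wx Wy)).2.
  have -> : x - y - comb (c x - c y) = (x - comb (c x)) - (y - comb (c y)).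
    by rewrite combB !opprB [comb (c y) - _]addrC addrACA [- y + _]addrC.
  by apply: sW'.2; [apply: (cP _ Wx).1|apply: (cP _ Wy).1].
- move=> a x Wx; apply/esym/(cP _ (WZ a Wx)).2.
  by rewrite combZ -scalerBr; apply: W'Z; apply: (cP _ Wx).1.
- have comb0 : comb 0 = 0 by rewrite -(subrr 0) combB subrr.
  move=> x Wx; split=> [cx0|W'x]; first by have := (cP _ Wx).1; rewrite cx0 comb0 subr0.
  by apply/esym/(cP _ Wx).2; rewrite comb0 subr0.
- move=> v; exists (comb v) => //; apply/esym/(cP _ (Wcomb v)).2.
  by rewrite subrr; exact: sW'.1.
Qed.

End FiniteDimension.

Section Functionals.
Variables (F : finFieldType) (K : fieldType) (iota : {rmorphism F -> K}).
Variables (pt : choiceType) (conj : pt -> pt -> Prop) (ord : pt -> K -> int).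
Hypothesis H : valuations iota conj ord.
Local Notation q := #|F|.
Implicit Types (D E : {freeg pt}) (P Q : pt) (r : pt -> K^o).
Local Notation R := (repartitions conj ord).
Local Notation A := (bounded_adeles conj ord).
Local Notation AK := (principal_adeles conj ord).
Local Notation L := (sections ord).
Local Notation rational := (rational conj).

(** The M + 1 elements x^k h with k <= M all lie in L(D), which has M elements. Two of them agree,
    so x is a root of some X^l - X^k; being regular everywhere and algebraic over F, it is
    constant. *)
Lemma sections0_constant D h M x : L D h -> h != 0 ->
  has_index (L D) [set 0] M -> L 0 x -> exists c, x = iota c.
Proof.
move=> Lh h0 [b [Lb Hb]] Lx.
have Lx0 P : vge ord P 0 x by have := Lx P; rewrite coeff0 oppr0.
apply: (constant_ex H) => //.
have Lxh k : L D (x ^+ k * h).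
  move=> P; rewrite -[- _]add0r; apply: (vgeM H) => //.
  elim: k => [|k IHk]; first by rewrite expr0 -(rmorph1 iota); exact: (vge_iota H).
  by rewrite exprS -[0]addr0; exact: (vgeM H).
have /choice[f fP] : forall k : 'I_M.+1, exists l, x ^+ k * h = b l.
  by move=> k; have [l [/subr0_eq ? _]] := Hb _ (Lxh k); exists l.
have [k [l [kl fkl]]] : exists k l : 'I_M.+1, (k < l)%N /\ f k = f l.
  apply: contrapT => nkl; have inj : injective f.
    move=> k l fkl; apply/val_inj => /=; apply/eqP; apply: contrapT => /negP.
    by rewrite neq_ltn => /orP[] lt; apply: nkl; [exists k, l|exists l, k].
  by have := leq_card f inj; rewrite !card_ord ltnn.
exists ('X^l - 'X^k).
  rewrite subr_eq0; apply/eqP => /(congr1 (fun p : {poly F} => size p)).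
  by rewrite !size_polyXn => -[lk]; rewrite lk ltnn in kl.
have xE : x ^+ l = x ^+ k by apply: (mulIf h0); rewrite !fP fkl.
by rewrite rmorphB /= !map_polyXn rootE hornerD hornerN !hornerXn xE subrr.
Qed.

Lemma constants_index D h M : L D h -> h != 0 ->
  has_index (L D) [set 0] M -> has_index (L 0) [set 0] q.
Proof.
move=> Lh h0 iD; apply: (@has_index_finType _ _ _ _ iota) => [c P|x].
  by rewrite coeff0 oppr0; exact: (vge_iota H).
move=> /(sections0_constant Lh h0 iD)[c ->].
exists c; split=> /= [|c' /subr0_eq]; first by rewrite subrr.
exact: fmorph_inj.
Qed.

Variable g : nat.
Hypothesis genus : has_quotient_dim iota R (AK 0) g.

Lemma genus_index : has_index R (AK 0) (q ^ g).
Proof.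
apply: quotient_dim_index genus; first exact: (subgroup_R H).
by move=> c r; exact: (repartitionsZ H).
Qed.

Lemma AK0Z a r : AK 0 r -> AK 0 (iota a *: r).
Proof.
move=> [sr [h Hr]]; split; first exact: stableZ.
exists (iota a * h) => P; rewrite fctE /GRing.scale /= -mulrBr.
by rewrite -[- _]add0r; apply: (vgeM H) => //; exact: (vge_iota H).
Qed.

Lemma adele_coordinates : exists c : (pt -> K^o) -> 'rV[F]_g,
  [/\ forall x y, R x -> R y -> c (x - y) = c x - c y,
    forall a x, R x -> c (iota a *: x) = a *: c x,
    forall x, R x -> (c x = 0 <-> AK 0 x) & forall v, exists2 x, R x & c x = v].
Proof.
apply: quotient_coordinates genus.
- exact: (subgroup_R H).
- by move=> c r; exact: (repartitionsZ H).
- exact: (subgroup_AK H).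
- by move=> c r; exact: AK0Z.
Qed.

Variable c : (pt -> K^o) -> 'rV[F]_g.
Hypotheses (cB : forall x y, R x -> R y -> c (x - y) = c x - c y)
  (cZ : forall a x, R x -> c (iota a *: x) = a *: c x)
  (ker_c : forall x, R x -> (c x = 0 <-> AK 0 x))
  (sur_c : forall v, exists2 x, R x & c x = v).

(** A functional on R / (R(0) + K) is given by its row of coefficients in the coordinates [c]; this
    makes Omega(0) the finite type of rows. *)
Definition functional (v : 'rV[F]_g) r : F := \sum_k v ord0 k * c r ord0 k.

Local Notation omega := functional.

(** Membership of [v] in Omega(E); vanishing on R(0) + K is already built into [c]. *)
Definition annihilates v E := forall r, A E r -> omega v r = 0.

Lemma A_subR E : A E `<=` R.
Proof. by move=> r /(@A_subAK _ _ _ _ _) /(AK_subR H). Qed.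

Lemma c0 : c 0 = 0.
Proof. by rewrite -(subrr 0) cB ?subrr //; exact: (subgroup_R H).1. Qed.

Lemma cD x y : R x -> R y -> c (x + y) = c x + c y.
Proof.
move=> Rx Ry; have sR := subgroup_R H.
have RN : R (- y) by exact: subgroupN.
have cN : c (- y) = - c y by rewrite -[- y]sub0r cB ?c0 ?sub0r //; exact: sR.1.
by rewrite -[in LHS](opprK y) cB // cN opprK.
Qed.

Lemma omegaD v x y : R x -> R y -> omega v (x + y) = omega v x + omega v y.
Proof.
move=> Rx Ry; rewrite /omega cD // -big_split /=.
by apply: eq_bigr => k _; rewrite mxE mulrDr.
Qed.

Lemma omegaB v x y : R x -> R y -> omega v (x - y) = omega v x - omega v y.
Proof.
move=> Rx Ry; rewrite /omega cB // -sumrB.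
by apply: eq_bigr => k _; rewrite !mxE mulrBr.
Qed.

Lemma omegaZ v a x : R x -> omega v (iota a *: x) = a * omega v x.
Proof.
move=> Rx; rewrite /omega cZ // mulr_sumr.
by apply: eq_bigr => k _; rewrite !mxE mulrCA.
Qed.

Lemma omega_sum v (I : finType) (f : I -> pt -> K^o) : (forall i, R (f i)) ->
  R (\sum_i f i) /\ omega v (\sum_i f i) = \sum_i omega v (f i).
Proof.
move=> Rf; apply: (big_ind2 (fun x y => R x /\ omega v x = y)) => //.
  split; first exact: (subgroup_R H).1.
  by rewrite /omega c0 big1 // => k _; rewrite mxE mulr0.
move=> x1 y1 x2 y2 [Rx1 <-] [Rx2 <-]; split; last exact: omegaD.
by apply: subgroupD => //; exact: (subgroup_R H).
Qed.

Lemma omega_AK0 v x : AK 0 x -> omega v x = 0.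
Proof.
move=> Hx; rewrite /omega; have -> : c x = 0 by apply/ker_c => //; exact: (AK_subR H Hx).
by rewrite big1 // => k _; rewrite mxE mulr0.
Qed.

(** Omega(E) is the annihilator of the image S of R(E) in F^g. Since S has as many elements as (R(E)
    + K) / (R(0) + K), the index N times |S| is q^g, and [card_annihilator] leaves at least N
    functionals. *)
Lemma card_annihilating E N : (forall P, 0 <= coeff P E) ->
  has_index R (AK E) N -> (N <= #|[set v | `[< annihilates v E >]]%SET|)%N.
Proof.
move=> E0 iN; have le0E P : coeff P 0 <= coeff P E by rewrite coeff0.
pose S := [set u | `[< exists2 r, A E r & c r = u >]]%SET.
have SP u : u \in S <-> exists2 r, A E r & c r = u.
  by rewrite inE; split=> [/asboolP|/asboolP].
have iS : has_index (AK E) (AK 0) #|S|.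
  rewrite -card_sig.
  have /choice[f fP] : forall u : {u | u \in S}, exists r, A E r /\ c r = val u.
    by move=> [u /= /SP[r ? ?]]; exists r.
  apply: (@has_index_finType _ _ _ _ f) => [u|w [sw [h Hw]]].
    by apply: A_subAK; exact: (fP u).1.
  have Aw : A E (w - constant_adele h) by split; [exact: stableB|].
  have Sw : c (w - constant_adele h) \in S by apply/SP; exists (w - constant_adele h).
  have Rw : R w by apply: (AK_subR H (D := E)); split=> //; exists h.
  have Kh : AK 0 (constant_adele h).
    by split=> //; exists h => P; rewrite subrr; exact: vge0.
  have Rh := AK_subR H Kh; have ch : c (constant_adele h) = 0 by apply/ker_c.
  exists (exist (fun u : 'rV[F]_g => u \in S) _ Sw); split=> [|[u Su]].
    apply/ker_c; last by rewrite cB ?(fP _).2 /= ?cB ?ch ?subr0 ?subrr //; apply: A_subR; exact: (fP _).1.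
    by apply: (subgroup_R H).2 => //; apply: A_subR; exact: (fP _).1.
  have Rf : R (f (exist (fun u : 'rV[F]_g => u \in S) u Su)) by apply: A_subR; exact: (fP _).1.
  move=> /ker_c Hu; apply/val_inj => /=; have := Hu ((subgroup_R H).2 _ _ Rw Rf).
  by rewrite cB // (fP _).2 /= => /subr0_eq; rewrite cB // ch subr0.
have cardE : (q ^ g = N * #|S|)%N.
  apply: (has_index_inj (subgroup_AK H 0) genus_index).
  apply: (@has_index_trans _ _ (AK E)) iN iS.
  - exact: (subgroup_R H).
  - exact: (subgroup_AK H).
  - exact: (AK_subR H).
  - exact: AK_mono.
have Spos : (0 < #|S|)%N.
  apply/card_gt0P; exists 0; apply/SP; exists 0; last exact: c0.
  exact: (subgroup_A H E).1.
have sA := subgroup_A H E.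
have S0 : 0 \in S by apply/SP; exists 0; [exact: sA.1|exact: c0].
have SD u v : u \in S -> v \in S -> u + v \in S.
  move=> /SP[x Ax <-] /SP[y Ay <-]; apply/SP; exists (x + y); first exact: subgroupD.
  by apply: cD; apply: (@A_subR E).
have SZ a u : u \in S -> a *: u \in S.
  move=> /SP[x Ax <-]; apply/SP; exists (iota a *: x).
    split=> [|P]; first by apply: stableZ; exact: Ax.1.
    by rewrite fctE -[- _]add0r; apply: (vgeM H); [exact: (vge_iota H)|exact: Ax.2].
  by apply: cZ; apply: (@A_subR E).
have := card_annihilator S0 SD SZ; rewrite cardE mulnC leq_pmul2l // => NS.
apply: leq_trans NS _.
apply/subset_leq_card/fintype.subsetP => v; rewrite !inE => /forall_inP Hv.
by move=> r Ar; apply/eqP/Hv/SP; exists r.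
Qed.

(** If h and h' in L(E) are distinct, the functionals r -> v(h r) and r -> v(h' r) differ, for
    otherwise v would vanish on (h - h') R = R. So |L(E)| <= q^g, and Riemann-Roch with N >= 1 gives
    q^(deg E + 1) <= q^(2g). *)
Lemma annihilating_degree v E : v != 0 -> has_index (L 0) [set 0] q ->
  rational E -> (forall P, 0 <= coeff P E) ->
  annihilates v E -> (absz (deg E) < 2 * g)%N.
Proof.
move=> v0 constants rE E0 vE.
have [N [M [iN iM NM]]] := riemann_roch_effective H genus_index constants rE E0.
have q1 : (1 < q)%N := finNzRing_gt1 F.
have N0 : (0 < N)%N by apply: has_index_gt0 iN; exact: (subgroup_R H).1.
suff Mq : (M <= q ^ g)%N.
  rewrite -(leq_exp2l _ _ q1) mul2n -addnn expnD.
  apply: leq_trans (leq_mul (leqnn (q ^ g)%N) Mq); rewrite -NM.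
  by rewrite leq_pmull.
have [b [Lb Hb]] := iM.
(* Lifts to R of the standard basis of F^g; modulo R(0) + K every repartition is a combination of
   them. *)
have /choice[e eP] : forall j, exists x, R x /\ c x = delta_mx ord0 j.
  by move=> j; have [x ? ?] := sur_c (delta_mx ord0 j); exists x.
have Re j : R (e j) := (eP j).1.
have omega_e u j : omega u (e j) = u ord0 j.
  rewrite /omega (eP j).2 (bigD1 j) //= mxE !eqxx mulr1 big1 ?addr0 // => k kj.
  by rewrite mxE (negPf kj) andbF mulr0.
have expand r : R r -> AK 0 (r - \sum_j iota (c r ord0 j) *: e j).
  move=> Rr; have Rs : R (\sum_j iota (c r ord0 j) *: e j).
    by have [] := omega_sum 0 (fun j => repartitionsZ H (iota (c r ord0 j)) (Re j)).
  apply/ker_c; first exact: (subgroup_R H).2.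
  apply/rowP => k; rewrite cB // !mxE.
  have := (omega_sum (delta_mx ord0 k) (fun j => repartitionsZ H (iota (c r ord0 j)) (Re j))).2.
  have deltaE x : omega (delta_mx ord0 k) x = c x ord0 k.
    rewrite /omega (bigD1 k) //= mxE !eqxx mul1r big1 ?addr0 // => l lk.
    by rewrite mxE (negPf lk) andbF mul0r.
  rewrite deltaE => ->; under eq_bigr => j _ do rewrite omegaZ // deltaE (eP j).2.
  rewrite (bigD1 k) //= mxE !eqxx mulr1 big1 ?addr0 ?subrr // => l lk.
  by rewrite mxE eq_sym (negPf lk) andbF mulr0.
(* The row of the functional r -> v(b_k r). It factors through the quotient because b_k R(0) lies in
   R(E), where v vanishes, and b_k K lies in K. *)
pose f k : 'rV[F]_g := \row_j omega v (b k *: e j).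
have fE k r : R r -> omega v (b k *: r) = \sum_j c r ord0 j * f k ord0 j.
  move=> Rr; have RZ j := repartitionsZ H (iota (c r ord0 j)) (repartitionsZ H (b k) (Re j)).
  have [Rs sE] := omega_sum v RZ.
  have -> : \sum_j c r ord0 j * f k ord0 j = omega v (\sum_j iota (c r ord0 j) *: (b k *: e j)).
    rewrite sE; apply: eq_bigr => j _; rewrite omegaZ ?mxE //.
    exact: (repartitionsZ H).
  apply/subr0_eq; rewrite -omegaB //; last exact: (repartitionsZ H).
  have -> : b k *: r - \sum_j iota (c r ord0 j) *: (b k *: e j) =
    b k *: (r - \sum_j iota (c r ord0 j) *: e j).
    rewrite scalerBr scaler_sumr; congr (_ - _); apply: eq_bigr => j _.
    by rewrite !scalerA mulrC.
  have [st [h Hh]] := expand _ Rr; set r' := r - _ in st Hh *.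
  have Kh : AK 0 (constant_adele (b k * h)).
    by split=> //; exists (b k * h) => P; rewrite subrr; exact: vge0.
  have -> : b k *: r' = b k *: (r' - constant_adele h) + constant_adele (b k * h).
    rewrite [in RHS]scalerBr.
    have -> : constant_adele (b k * h) = b k *: constant_adele h by [].
    by rewrite subrK.
  have Ar : A E (b k *: (r' - constant_adele h)).
    split; first by apply: stableZ; exact: stableB.
    move=> P; have -> : - coeff P E = - coeff P E + 0 by rewrite addr0.
    apply: (vgeM H); first exact: Lb.
    by have := Hh P; rewrite coeff0 oppr0.
  rewrite omegaD; [|exact: A_subR Ar|exact: (AK_subR H) Kh].
  by rewrite vE // omega_AK0 // addr0.
have inj : injective f.
  move=> k l fkl; have [o [_ u]] := Hb _ (Lb k).
  rewrite -(u k) /= ?subrr // -(u l) //=; apply/eqP; apply: contraNT v0 => kl.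
  apply/eqP/rowP => j; rewrite mxE -omega_e.
  have Rr := repartitionsZ H (b k - b l)^-1 (Re j).
  have -> : e j = b k *: ((b k - b l)^-1 *: e j) - b l *: ((b k - b l)^-1 *: e j).
    by rewrite -scalerBl scalerA mulfV // scale1r.
  by rewrite omegaB ?fE ?fkl ?subrr //; exact: (repartitionsZ H).
by have := leq_card f inj; rewrite card_ord card_mx mul1n.
Qed.

(** The divisor is sup(D, E). A repartition bounded by it is the sum of its restriction to the
    points where D dominates, which lies in R(D), and the rest, which lies in R(E); rationality
    keeps both parts stable. *)
Lemma annihilates_sup v D E : rational D -> rational E ->
  annihilates v D -> annihilates v E -> annihilates v (D + fgpos (E - D)).
Proof.
move=> rD rE vD vE r [sr Hr].
pose r1 P : K^o := if coeff P E <= coeff P D then r P else 0.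
have cS P : coeff P (D + fgpos (E - D)) = if coeff P E <= coeff P D then coeff P D else coeff P E.
  rewrite coeffD coeff_fgposE coeffB maxElt subr_gt0 ltNge.
  by case: (_ <= _) => /=; rewrite ?addr0 // addrC subrK.
have A1 : A D r1.
  split=> [P Q PQ|P]; rewrite /r1.
    by rewrite (rE _ _ PQ) (rD _ _ PQ) (sr _ _ PQ).
  by have := Hr P; rewrite cS; case: ifP => // _ _; exact: vge0.
have A2 : A E (r - r1).
  split=> [P Q PQ|P]; rewrite !fctE /r1.
    by rewrite (rE _ _ PQ) (rD _ _ PQ) (sr _ _ PQ).
  have := Hr P; rewrite cS; case: ifP => _; rewrite ?subrr ?subr0 // => _.
  exact: vge0.
by rewrite -(subrK r1 r) omegaD; [rewrite vE // vD // addr0|exact: A_subR A2|exact: A_subR A1].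
Qed.

(** A divisor E of maximal degree among those annihilated by v dominates every other E': the
    supremum has no larger degree, so the positive part of E' - E is effective of degree 0. The list
    consists of the divisors below E. *)
Lemma annihilated_divisors v : v != 0 -> has_index (L 0) [set 0] q ->
  exists2 s : seq {freeg pt}, (size s <= 2 ^ (2 * g).-1)%N &
    forall E, rational E -> (forall P, 0 <= coeff P E) -> annihilates v E -> E \in s.
Proof.
move=> v0 constants.
pose good E := [/\ rational E, forall P, 0 <= coeff P E & annihilates v E].
have [[E0 gE0]|none] := pselect (exists E, good E); last first.
  by exists [::] => // E rE pE aE; case: none; exists E.
pose deg_good n := `[< exists E, good E /\ absz (deg E) = n >].
have ex : exists n, deg_good n by exists (absz (deg E0)); apply/asboolP; exists E0.
have ub n : deg_good n -> (n <= (2 * g).-1)%N.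
  move=> /asboolP[E [[rE pE aE] <-]].
  by have := annihilating_degree v0 constants rE pE aE; case: (2 * g)%N.
case: (ex_maxnP ex ub) => n /asboolP[E [[rE pE aE] dE]] maxn.
have [s sz Hs] := subdivisors_bound pE.
exists s.
  apply: leq_trans sz _; rewrite leq_exp2l // ub //; apply/asboolP.
  by exists E.
move=> E' rE' pE' aE'; apply: Hs => P; rewrite pE' /=.
have pX Q : 0 <= coeff Q (fgpos (E' - E)) by rewrite coeff_fgposE le_max lexx.
have gS : good (E + fgpos (E' - E)).
  split; last exact: annihilates_sup.
    move=> Q Q' QQ'; rewrite !coeffD !coeff_fgposE !coeffB.
    by rewrite (rE _ _ QQ') (rE' _ _ QQ').
  by move=> Q; rewrite coeffD addr_ge0.
have : (absz (deg (E + fgpos (E' - E))%R) <= n)%N.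
  by apply: maxn; apply/asboolP; exists (E + fgpos (E' - E)).
have := deg_ge0 pX; have := deg_ge0 pE; rewrite -dE degD => ? ? ?.
have /(effective_deg0 pX)/(congr1 (coeff P)) : deg (fgpos (E' - E)) = 0 by lia.
by rewrite coeff_fgposE coeffB coeff0 => /eqP; rewrite eq_maxl subr_le0.
Qed.

End Functionals.

(** * Counting *)

Section Counting.
Variables (F : finFieldType) (K : fieldType) (iota : {rmorphism F -> K}).
Variables (pt : choiceType) (conj : pt -> pt -> Prop) (ord : pt -> K -> int).
Hypothesis H : valuations iota conj ord.
Local Notation q := #|F|.
Implicit Types (D E : {freeg pt}) (P Q : pt) (r : pt -> K^o).
Local Notation R := (repartitions conj ord).
Local Notation AK := (principal_adeles conj ord).
Local Notation L := (sections ord).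
Local Notation rational := (rational conj).

Definition divisor_difference (h : K) D E := forall P, ord P h = coeff P D - coeff P E.

Lemma divisor_differenceV h D E : h != 0 ->
  divisor_difference h D E -> divisor_difference h^-1 E D.
Proof. by move=> h0 Hh P; rewrite (ordV H) // Hh opprB. Qed.

Lemma effective_divisor D h : rational D -> L D h -> h != 0 ->
  exists E, [/\ rational E, forall P, 0 <= coeff P E & divisor_difference h E D].
Proof.
move=> rD Lh h0; have [s hs] := ord_finite H h0.
have [P|E HE] := @divisor_of_fun _ (fun P => coeff P D + ord P h) (dom D ++ s).
  rewrite mem_cat mem_dom; have [->|//] := eqVneq (coeff P D) 0.
  by rewrite add0r => /hs ->.
exists E; split=> [P Q PQ|P|P]; rewrite !HE.
- by rewrite (rD _ _ PQ) (ord_conj H _ PQ).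
- by have [/eqP|] := Lh P; [rewrite (negPf h0)|lia].
- by rewrite addrC addKr.
Qed.

Variable g : nat.
Hypothesis genus : has_quotient_dim iota R (AK 0) g.

Section Family.
Variables (N i a : nat) (d : int) (D : 'I_N -> {freeg pt}) (r : 'I_N -> nat).
Hypotheses (rD : forall j, rational (D j)) (dD : forall j, deg (D j) = d)
  (LD : forall j, has_index (L (D j)) [set 0] (q ^ r j)) (ir : forall j, (i <= r j)%N)
  (inequivalent : forall j l h, h != 0 -> divisor_difference h (D j) (D l) -> j = l).
Hypotheses (i_gt0 : (0 < i)%N) (a_gt0 : (0 < a)%N) (aE : a%:Z = i%:Z - d - 1 + g%:Z).

Let q_gt1 : (1 < q)%N. Proof. exact: finNzRing_gt1. Qed.

(** Nonzero sections are counted in place of effective divisors, so that nothing has to be divided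
    by q - 1; the last factor q on the right bounds the number of sections that share a divisor
    within one class. *)
Lemma counting_bound :
  (N * (q ^ i).-1 * (q ^ a).-1 <= q ^ g * 2 ^ (2 * g).-1 * q)%N.
Proof.
case: (posnP N) => [-> //|N0].
have qpos m : (0 < q ^ m)%N by rewrite expn_gt0 ltnW.
have /choice[eta etaP] : forall j, exists f : 'I_(q ^ i).-1 -> K,
    injective f /\ forall k, L (D j) (f k) /\ f k != 0.
  move=> j; apply: has_index_nonzero (LD j) _.
    exact: (subgroup_L H (D j)).1.
  by rewrite prednK // leq_exp2l.
(* The field of constants is found from the first nonzero section at hand, which exists because N >
   0 and i > 0. *)
have [constants constant] : has_index (L 0) [set 0] q /\ forall x, L 0 x -> exists t, x = iota t.
  have k0 : (0 < (q ^ i).-1)%N.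
    by rewrite -ltnS prednK // (leq_trans q_gt1) // -{1}(expn1 q) leq_exp2l.
  have [Lh h0] := (etaP (Ordinal N0)).2 (Ordinal k0).
  split; first exact: (constants_index H Lh h0 (LD _)).
  by move=> x; exact: (sections0_constant H Lh h0 (LD _)).
have [c [cB cZ ker_c sur_c]] := adele_coordinates H genus.
pose ann := annihilates conj ord c.
pose VS E := [set v : 'rV[F]_g | (v != 0) && `[< ann v E >]]%SET.
have /choice[E EP] : forall jk : 'I_N * 'I_(q ^ i).-1, exists E,
   [/\ rational E, forall P, 0 <= coeff P E & divisor_difference (eta jk.1 jk.2) E (D jk.1)].
  by move=> [j k]; have [Lh h0] := (etaP j).2 k; apply: effective_divisor.
have cardE jk : ((q ^ a).-1 <= size (enum (VS (E jk))))%N.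
  have [rE E0 hE] := EP jk; have [Lh h0] := (etaP jk.1).2 jk.2.
  have [M [M' [iM iM' MM]]] := riemann_roch H (genus_index H genus) constants (rD jk.1).
  have iE : has_index R (AK (E jk)) M.
    apply: (has_index_adeles_equiv H _ (divisor_differenceV h0 hE)) iM.
    by rewrite invr_eq0.
  rewrite (has_index_inj (subgroup0 _) iM' (LD _)) in MM.
  (* Riemann-Roch reads M = q^(g + r - d - 1), and r >= i bounds the exponent below by a. *)
  have qa : (q ^ a <= M)%N.
    have q0 : (q%:R : rat) != 0 by rewrite pnatr_eq0 -lt0n ltnW.
    have qq0 : 0 < (q%:R : rat) by rewrite ltr0n ltnW.
    have qd0 : 0 < (q%:R : rat) ^ (d + 1) by rewrite exprz_gt0.
    rewrite -(ler_nat rat) -(ler_pM2r qd0) -(dD jk.1) MM dD natrX exprnP.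
    rewrite natrX !exprnP -!expfzDr // ler_eXz2l ?ltr1n //.
    by have := ir jk.1; lia.
  have := card_annihilating H genus cB cZ ker_c E0 iE; rewrite -cardE => le1.
  rewrite -ltnS prednK // (leq_trans (leq_trans qa le1)) //.
  rewrite (cardsD1 0) addnC -[X in (_ <= X)%N]addn1 leq_add ?leq_b1 //.
  by apply/subset_leq_card/fintype.subsetP => v; rewrite !inE.
(* [ref] depends on the class and on E but not on the section, so comparing a section with it
   isolates the scalar that E leaves open. The default 0 occurs only where no such function
   exists. *)
have /choice[ref refP] : forall jE : 'I_N * {freeg pt}, exists h,
   forall h', h' != 0 -> divisor_difference h' jE.2 (D jE.1) ->
     h != 0 /\ divisor_difference h jE.2 (D jE.1).
  move=> jE; have [[h [h0 Hh]]|none] := pselect (exists h, h != 0 /\ divisor_difference h jE.2 (D jE.1)).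
    by exists h.
  by exists 0 => h' h0 Hh'; case: none; exists h'.
have /choice[lam lamP] : forall jk, exists t : F, eta jk.1 jk.2 = iota t * ref (jk.1, E jk).
  move=> jk; have [Lh h0] := (etaP jk.1).2 jk.2; have [_ _ hE] := EP jk.
  have [ref0 hr] := refP (jk.1, E jk) _ h0 hE.
  have Lx : L 0 (eta jk.1 jk.2 / ref (jk.1, E jk)).
    move=> P; right; rewrite coeff0 oppr0 (ordM H) ?invr_eq0 // (ordV H) //.
    by rewrite hE hr subrr.
  by have [t xt] := constant _ Lx; exists t; rewrite -xt divfK.
have /choice[S SP] : forall v : 'rV[F]_g, exists s : seq {freeg pt}, v != 0 ->
   (size s <= 2 ^ (2 * g).-1)%N /\ forall E, rational E -> (forall P, 0 <= coeff P E) -> ann v E -> E \in s.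
  move=> v; have [->|v0] := eqVneq v 0; first by exists [::].
  by have [s ? ?] := annihilated_divisors H genus cB cZ ker_c sur_c v0 constants; exists s.
pose T := ('I_N * 'I_(q ^ i).-1 * 'I_(q ^ a).-1)%type.
pose V (jkl : T) : 'rV[F]_g := nth 0 (enum (VS (E jkl.1))) jkl.2.
have VP (jkl : T) : V jkl != 0 /\ ann (V jkl) (E jkl.1).
  have : V jkl \in enum (VS (E jkl.1)).
    by apply: mem_nth; apply: leq_trans (cardE _).
  by rewrite mem_enum inE => /andP[-> /asboolP].
have ES (jkl : T) : E jkl.1 \in S (V jkl).
  have [V0 annV] := VP jkl; have [rE E0 _] := EP jkl.1.
  exact: (SP _ V0).2.
have idx (jkl : T) : (seq.index (E jkl.1) (S (V jkl)) < 2 ^ (2 * g).-1)%N.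
  by apply: leq_trans (SP _ (VP jkl).1).1; rewrite index_mem.
pose f (jkl : T) := (V jkl, Ordinal (idx jkl), lam jkl.1).
(* The functional and the position in its list give E; E gives the class, by inequivalence; E and
   the scalar then give the section; and the functional gives its own index among those killing
   R(E). *)
have f_inj : injective f.
  move=> x y [VE [iE] lE].
  have EE : E x.1 = E y.1.
    by rewrite -(nth_index 0 (ES x)) -(nth_index 0 (ES y)) iE VE.
  have jE : x.1.1 = y.1.1.
    have [_ _ hx] := EP x.1; have [_ _ hy] := EP y.1.
    have hx0 := ((etaP x.1.1).2 x.1.2).2; have hy0 := ((etaP y.1.1).2 y.1.2).2.
    apply: (@inequivalent _ _ (eta y.1.1 y.1.2 / eta x.1.1 x.1.2)).
      by rewrite mulf_neq0 // invr_eq0.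
    move=> P; rewrite (ordM H) ?invr_eq0 // (ordV H) // hx hy EE; lia.
  have kE : x.1 = y.1.
    apply/eqP; rewrite -pair_eqE /= jE eqxx /=; apply/eqP/(etaP y.1.1).1.
    by rewrite (lamP y.1) -{1}jE (lamP x.1) lE EE jE.
  apply/eqP; rewrite -pair_eqE /= kE eqxx /=; apply/eqP/val_inj/eqP.
  move: VE; rewrite /V kE => /eqP; rewrite nth_uniq ?enum_uniq //.
  - exact: leq_trans (cardE _).
  - exact: leq_trans (cardE _).
have := leq_card f f_inj.
by rewrite !card_prod !card_ord card_mx mul1n.
Qed.

End Family.
End Counting.

(** * Discrete valuation rings *)

Section DiscreteValuation.
Variables (K : fieldType) (O M : set K) (t : K).

Definition local_generator (t : K) := M t /\ forall h, M h -> exists2 u, O u & h = t * u.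

Definition order_of (h : K) (k : int) :=
  exists t u, [/\ local_generator t, O u, ~ M u & h = t ^ k * u].

(* Nothing Noetherian: instead of the Krull intersection theorem, every nonzero element of
   [O] is required to divide a power of [t]. *)
Record dvr : Prop := {
  dvr_sO : subgroup O;
  dvr_sM : subgroup M;
  dvr_O1 : O 1;
  dvr_OM : forall x y, O x -> O y -> O (x * y);
  dvr_MO : M `<=` O;
  dvr_MM : forall x y, O x -> M y -> M (x * y);
  dvr_M1 : ~ M 1;
  dvr_OV : forall x, O x -> ~ M x -> O x^-1;
  dvr_gen : local_generator t;
  dvr_t0 : t != 0;
  dvr_div : forall h, O h -> h != 0 -> exists e u, O u /\ t ^+ e = h * u;
  dvr_frac : forall h, exists x y, [/\ O x, O y, y != 0 & h = x / y]
}.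

Hypothesis H : dvr.
Let sO := dvr_sO H. Let sM := dvr_sM H. Let O1 := dvr_O1 H. Let OM := dvr_OM H.
Let MO := dvr_MO H. Let MM := dvr_MM H. Let M1 := dvr_M1 H. Let OV := dvr_OV H.
Let gen_t := dvr_gen H. Let t0 := dvr_t0 H. Let div_t := dvr_div H. Let frac := dvr_frac H.

Definition local_units : set K := [set u | O u /\ ~ M u].

Lemma local_units_neq0 u : local_units u -> u != 0.
Proof. by case=> _ nMu; apply/eqP => u0; apply: nMu; rewrite u0; exact: sM.1. Qed.

Lemma local_unitsV u : local_units u -> local_units u^-1.
Proof.
move=> Uu; have u0 := local_units_neq0 Uu; case: Uu => Ou nMu.
split; first exact: OV.
by move=> Mu; apply: M1; rewrite -(mulfV u0); exact: MM.
Qed.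

Lemma local_unitsM u v : local_units u -> local_units v -> local_units (u * v).
Proof.
move=> Uu [Ov nMv]; split; first by apply: OM => //; exact: Uu.1.
move=> /(MM (local_unitsV Uu).1); rewrite mulKf //.
exact: local_units_neq0 Uu.
Qed.

Lemma local_unitsX u (k : int) : local_units u -> local_units (u ^ k).
Proof.
move=> Uu; have nat_case (n : nat) : local_units (u ^+ n).
  by elim: n => [|n IHn]; rewrite ?expr0 // exprS; exact: local_unitsM.
by case: k => n; [exact: nat_case|apply: local_unitsV; exact: nat_case].
Qed.

Lemma not_unit_M x y : O x -> M y -> x * y != 1.
Proof. by move=> Ox My; apply/eqP => xy; apply: M1; rewrite -xy; exact: MM. Qed.

Let Mt : M t := gen_t.1.

Lemma O_exp (n : nat) : O (t ^+ n).
Proof.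
by elim: n => [|n IHn]; rewrite ?expr0 // exprS; apply: OM => //; exact: MO.
Qed.

Lemma generator_unit s : local_generator s -> exists2 w, local_units w & s = t * w.
Proof.
move=> [Ms gen_s]; have [w Ow sE] := gen_t.2 _ Ms; have [w' Ow' tE] := gen_s _ Mt.
exists w => //; split=> // Mw.
suff : w' * w != 1 by rewrite -(inj_eq (mulfI t0)) mulr1 mulrCA -sE mulrC -tE eqxx.
exact: not_unit_M.
Qed.

(** [order_of] allows any generator. Another generator is t times a unit, and the power of that unit
    is absorbed into the unit part of h. *)
Lemma order_ofP h k : order_of h k <-> exists2 u, local_units u & h = t ^ k * u.
Proof.
split=> [[s [u [/generator_unit[w Uw ->] Ou nMu ->]]]|[u [Ou nMu] ->]].
  exists (w ^ k * u); first by apply: local_unitsM => //; exact: local_unitsX.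
  by rewrite expfzMl mulrA.
by exists t, u.
Qed.

Lemma order_of_neq0 h k : order_of h k -> h != 0.
Proof.
move=> /order_ofP[u Uu ->]; rewrite mulf_neq0 ?expfz_neq0 //.
exact: local_units_neq0.
Qed.

Lemma order_ofM h h' k k' : order_of h k -> order_of h' k' -> order_of (h * h') (k + k').
Proof.
move=> /order_ofP[u Uu ->] /order_ofP[u' Uu' ->]; apply/order_ofP.
exists (u * u'); first exact: local_unitsM.
by rewrite expfzDr // mulrACA.
Qed.

Lemma order_ofV h k : order_of h k -> order_of h^-1 (- k).
Proof.
move=> /order_ofP[u Uu ->]; apply/order_ofP; exists u^-1; first exact: local_unitsV.
by rewrite invfM -invr_expz.
Qed.

Lemma order_of_integral h k : order_of h k -> O h -> 0 <= k.
Proof.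
move=> /order_ofP[u Uu ->]; case: k => // n; rewrite NegzE => Oh.
have U := local_unitsV Uu.
have : t ^ (- n.+1%:Z) * u * u^-1 * t ^+ n * t != 1.
  by apply: not_unit_M => //; apply: (OM _ (O_exp n)); apply: OM => //; exact: U.1.
rewrite mulfK ?local_units_neq0 // -mulrA -exprSr exprnP -expfzDr // addNr expr0z eqxx.
by [].
Qed.

Lemma order_of_inj h k l : order_of h k -> order_of h l -> k = l.
Proof.
move=> hk hl; have h0 := order_of_neq0 hk.
have le a b : order_of h a -> order_of h b -> a <= b.
  move=> ha hb; rewrite -subr_ge0; apply: (@order_of_integral 1) => //.
  by rewrite -(mulfV h0); apply: order_ofM => //; exact: order_ofV.
by apply/eqP; rewrite eq_le !le.
Qed.

(** For h in O, some t^e is a multiple of h, so no power of t beyond e divides h: otherwise t^e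
    would be t^e times an element of M. With the largest power of t taken out, the cofactor is
    outside M. The general case follows by writing h as a fraction. *)
Lemma order_of_ex h : h != 0 -> exists k, order_of h k.
Proof.
have integral x : O x -> x != 0 -> exists k, order_of x k.
  move=> Ox x0; have [e [u [Ou eu]]] := div_t Ox x0.
  pose D k := `[< exists2 w, O w & x = t ^+ k * w >].
  have D0 : exists k, D k by exists 0%N; apply/asboolP; exists x; rewrite ?mul1r.
  have Dub k : D k -> (k <= e)%N.
    move=> /asboolP[w Ow xE]; rewrite leqNgt; apply/negP => lt_ek.
    have : w * u * t ^+ (k - e).-1 * t != 1.
      by apply: not_unit_M => //; apply: OM; [exact: OM|exact: O_exp].
    have E : t ^+ e * (w * u * t ^+ (k - e).-1 * t) = t ^+ e.
      rewrite -mulrA -exprSr prednK ?subn_gt0 // mulrCA -exprD subnKC 1?ltnW //.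
      by rewrite eu xE mulrC !mulrA.
    by rewrite -(inj_eq (mulfI (expf_neq0 e t0))) E mulr1 eqxx.
  case: (ex_maxnP D0 Dub) => k /asboolP[w Ow xE] kmax.
  exists k; apply/order_ofP; exists w; last by rewrite xE.
  split=> // /(gen_t.2 _)[w' Ow' wE].
  suff : D k.+1 by move/kmax; rewrite ltnn.
  by apply/asboolP; exists w' => //; rewrite xE wE mulrA exprSr.
move=> h0; have [x [y [Ox Oy y0 hE]]] := frac h.
have x0 : x != 0 by apply: contraNneq h0 => x0; rewrite hE x0 mul0r.
have [[k xk] [l yl]] := (integral _ Ox x0, integral _ Oy y0).
by exists (k - l); rewrite hE; apply: order_ofM => //; exact: order_ofV.
Qed.

(** A lower bound on the order becomes membership in O, where the ultrametric inequality is closure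
    under addition. *)
Lemma order_of_scale h k : (h = 0 \/ exists2 l, order_of h l & k <= l) <->
  O (t ^ (- k) * h).
Proof.
split=> [[->|[l /order_ofP[u Uu ->] kl]]|Oh].
- by rewrite mulr0; exact: sO.1.
- rewrite mulrA -expfzDr //; apply: OM; last exact: Uu.1.
  have : 0 <= - k + l by rewrite addrC subr_ge0.
  by case: (- k + l) => // n _; exact: O_exp.
have [->|h0] := eqVneq h 0; [by left|right].
have [l hl] := order_of_ex h0; exists l => //.
rewrite -subr_ge0 addrC; apply: order_of_integral Oh.
by apply: order_ofM => //; apply/order_ofP; exists 1 => //; rewrite mulr1.
Qed.

Lemma order_ofD h h' k : (h = 0 \/ exists2 l, order_of h l & k <= l) ->
  (h' = 0 \/ exists2 l, order_of h' l & k <= l) ->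
  (h + h' = 0 \/ exists2 l, order_of (h + h') l & k <= l).
Proof.
by rewrite !order_of_scale mulrDr => Oh Oh'; exact: subgroupD.
Qed.

Lemma order_of_unit u : local_units u -> order_of u 0.
Proof. by move=> Uu; apply/order_ofP; exists u; rewrite ?mul1r. Qed.

Lemma order_of_generator : order_of t 1.
Proof. by apply/order_ofP; exists 1; rewrite ?expr1z ?mulr1. Qed.

Lemma order_of_O h : O h <-> (h = 0 \/ exists2 l, order_of h l & 0 <= l).
Proof. by rewrite order_of_scale oppr0 expr0z mul1r. Qed.

Lemma order_of_M h : M h <-> (h = 0 \/ exists2 l, order_of h l & 1 <= l).
Proof.
rewrite order_of_scale; split=> [/(gen_t.2 _)[u Ou ->]|Oh].
  by rewrite mulKf.
by rewrite -(mulVKf t0 h) mulrC; exact: MM.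
Qed.

End DiscreteValuation.

(** * Frobenius maps *)

Section MmapMorphism.
Variables (F : finFieldType) (E E' : fieldType).
Variables (j : {rmorphism F -> E}) (j' : {rmorphism F -> E'}) (s : {rmorphism E -> E'}).
Hypothesis sj : forall c, s (j c) = j' c.

Lemma rmorph_mmap n (v : 'I_n -> E) (f : {mpoly F[n]}) :
  s (mmap j v f) = mmap j' (fun i => s (v i)) f.
Proof.
rewrite /mmap rmorph_sum; apply: eq_bigr => m _ /=.
rewrite rmorphM sj /mmap1 rmorph_prod; congr (_ * _).
by apply: eq_bigr => i _; rewrite rmorphXn.
Qed.

End MmapMorphism.

Lemma mmap_var (F : finFieldType) (E : fieldType) (j : {rmorphism F -> E}) n (v : 'I_n -> E) i :
  mmap j v 'X_i = v i.
Proof. by rewrite mmapX mmap1U. Qed.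

Section Frobenius.
Variables (F : finFieldType) (E : fieldType).
Local Notation q := #|F|.

Lemma pnat_card_finField (j : {rmorphism F -> E}) m : (GRing.pchar E).-nat (q ^ m)%N.
Proof.
have [p pp pF] := finPcharP F.
have : p.-nat #|[set: F]|%SET by apply: abelem_pgroup; exact: fin_ring_pchar_abelem pF.
rewrite cardsT => qp; rewrite pnatX (eq_pnat _ (rho := p)) ?qp //.
by move=> p'; rewrite (fmorph_pchar j); exact: pcharf_eq.
Qed.

(** The argument [j] witnesses that E has the characteristic of F, which is what makes the map
    additive and gives it a ring morphism structure. *)
Definition frobenius (j : {rmorphism F -> E}) (m : nat) (x : E) : E := x ^+ (q ^ m).

Variable j : {rmorphism F -> E}.
Local Notation frob := (frobenius j).

Lemma frobenius_zmod_morphism m : zmod_morphism (frob m).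
Proof.
move=> x y; have /exprDn_pchar D := pnat_card_finField j m.
apply: (addIr (y ^+ (q ^ m))); rewrite /frobenius -D !subrK.
by [].
Qed.

Lemma frobenius_monoid_morphism m : monoid_morphism (frob m).
Proof. by split=> [|x y]; rewrite /frobenius ?expr1n ?exprMn. Qed.

HB.instance Definition _ m :=
  GRing.isZmodMorphism.Build E E (frob m) (frobenius_zmod_morphism m).
HB.instance Definition _ m :=
  GRing.isMonoidMorphism.Build E E (frob m) (frobenius_monoid_morphism m).

Lemma frobeniusD m n x : frob (m + n) x = frob m (frob n x).
Proof. by rewrite /frobenius -exprM expnD mulnC. Qed.

Lemma frobenius0 x : frob 0 x = x. Proof. by rewrite /frobenius expr1. Qed.

Lemma frobenius_base m c : frob m (j c) = j c.
Proof.
elim: m => [|m IHm]; first exact: frobenius0.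
by rewrite -addn1 frobeniusD {1}/frobenius /= /frobenius expn1 -rmorphXn expf_card.
Qed.

Lemma frobenius_fixed x : frob 1 x = x -> exists c, x = j c.
Proof.
rewrite /frobenius expn1 => xq.
have : root (map_poly j ('X^q - 'X)) x.
  by rewrite rmorphB /= map_polyXn map_polyX rootE !hornerE xq subrr.
rewrite finField_genPoly rmorph_prod /= rootE horner_prod => /eqP/eqP.
move=> /prodf_eq0[c _]; rewrite rmorphB /= map_polyX map_polyC !hornerE subr_eq0.
by move=> /eqP; exists c.
Qed.

Lemma frobenius_inj m : injective (frob m).
Proof. exact: fmorph_inj. Qed.

Lemma frobenius_periodM m k x : frob m x = x -> frob (m * k) x = x.
Proof.
by move=> mx; elim: k => [|k IHk]; rewrite ?muln0 ?frobenius0 // mulnS frobeniusD IHk.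
Qed.

(** All iterates of Frobenius on x are roots of one polynomial over F, so two of them coincide, and
    injectivity cancels the common part. *)
Lemma frobenius_period x : algebraicOver j x -> exists2 m, (0 < m)%N & frob m x = x.
Proof.
move=> [p p0 px]; have P0 : map_poly j p != 0 by rewrite map_poly_eq0.
have rootP k : root (map_poly j p) (frob k x).
  rewrite rootE; have <- : map_poly (frob k) (map_poly j p) = map_poly j p.
    by rewrite -map_poly_comp; apply: eq_map_poly => c /=; exact: frobenius_base.
  by rewrite horner_map (eqP px) rmorph0.
pose n := size (map_poly j p).
have : ~~ uniq [seq frob k x | k <- iota 0 n].
  apply/negP => us; suff : (n < n)%N by rewrite ltnn.
  rewrite -{1}(size_iota 0 n) -(size_map (frob^~ x)); apply: max_poly_roots => //.
  by apply/allP => _ /mapP[k _ ->].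
move=> /(uniqPn 0)[k [l [kl]]]; rewrite size_map size_iota => ln.
rewrite !(nth_map 0%N) ?size_iota ?(ltn_trans kl) // !nth_iota ?(ltn_trans kl) // !add0n.
rewrite -(subnKC (ltnW kl)) frobeniusD => /frobenius_inj E'.
by exists (l - k)%N; rewrite ?subn_gt0.
Qed.

Lemma frobenius_common_period n (v : 'I_n -> E) : (forall i, algebraicOver j (v i)) ->
  exists2 m, (0 < m)%N & forall i, frob m (v i) = v i.
Proof.
move=> alg; have /choice[f fP] : forall i, exists m, (0 < m)%N /\ frob m (v i) = v i.
  by move=> i; have [m ? ?] := frobenius_period (alg i); exists m.
exists (\prod_i f i)%N; first by rewrite prodn_gt0 // => i; exact: (fP i).1.
by move=> i; rewrite (bigD1 i) //= frobenius_periodM //; exact: (fP i).2.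
Qed.

End Frobenius.

(** * Affine charts and values at a point *)

Section Homogenization.
Variables (F : finFieldType) (E : fieldType) (j : {rmorphism F -> E}) (n : nat).
Implicit Types (f : {mpoly F[n.+1]}) (v : 'I_n.+1 -> E).

Lemma mmap_homog e f v z : f \is e.-homog ->
  mmap j (fun k => z * v k) f = z ^+ e * mmap j v f.
Proof.
move=> /dhomogP hf; rewrite /mmap mulr_sumr !big_seq; apply: eq_bigr => m mf.
have <- : mdeg m = e by exact: hf.
rewrite mulrCA; congr (_ * _); rewrite /mmap1 mdegE expr_sum -big_split /=.
by apply: eq_bigr => k _; rewrite exprMn.
Qed.

Definition homogenize (i : 'I_n.+1) (d : nat) f : {mpoly F[n.+1]} :=
  \sum_(m <- msupp f) f@_m *: ('X_[m] * 'X_i ^+ (d - mdeg m)).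

Lemma homogenize_homog i d f : (msize f <= d)%N -> homogenize i d f \is d.-homog.
Proof.
move=> fd; rewrite /homogenize big_seq; apply: rpred_sum => m mf; apply: dhomogZ.
have md : (mdeg m <= d)%N by apply: leq_trans fd; apply: ltnW; apply: msize_mdeg_lt.
rewrite -[in X in X.-homog](subnKC md); apply: dhomogM; first by rewrite dhomogX.
by rewrite mpolyXn dhomogX /= mdegMn mdeg1 mul1n.
Qed.

Lemma mmap_homogenize i d f v : v i = 1 -> mmap j v (homogenize i d f) = mmap j v f.
Proof.
move=> vi; rewrite /homogenize raddf_sum /=; apply: eq_bigr => m _.
by rewrite mmapZ rmorphM rmorphXn /= mmapX mmap_var vi expr1n mulr1.
Qed.

End Homogenization.

Section Chart.
Variables (F : finFieldType) (C : curve F) (P : Defs.point C) (i0 : 'I_(ambient_dim C).+1).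
Local Notation L := (Defs.closure C).
Local Notation K := (funfield C).
Local Notation n := (ambient_dim C).
Local Notation iota := (@to_funfield F C).
Local Notation jL := (@to_closure F C).
Local Notation x := (@generic_point F C).
Local Notation a := (coords (val P)).
Hypothesis ai0 : a i0 = 1.

Definition affine_coord (k : 'I_n.+1) : K := x k / x i0.
Local Notation y := affine_coord.

Lemma generic_coord_neq0 : x i0 != 0.
Proof.
apply/eqP => xi0; have h : ('X_i0 : {mpoly F[n.+1]}) \is 1.-homog by rewrite dhomogX /= mdeg1.
have := (generic_pointP h).1; rewrite mmap_var => /(_ xi0 _ (valP P)).
by rewrite mmap_var ai0 => /eqP; rewrite oner_eq0.
Qed.

Lemma affine_coord_i0 : y i0 = 1.
Proof. by rewrite /y divff // generic_coord_neq0. Qed.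

Lemma mmap_generic e (f : {mpoly F[n.+1]}) : f \is e.-homog ->
  mmap iota x f = x i0 ^+ e * mmap iota y f.
Proof.
move=> hf; rewrite -(mmap_homog _ _ _ hf); congr mmap; apply/funext => k.
by rewrite mulrC divfK // generic_coord_neq0.
Qed.

(** Homogenizing f turns vanishing on the chart into vanishing of a form at the generic point, hence
    at every point of the curve. This is what makes values at P well defined. *)
Lemma mmap_chart_eq0 (f : {mpoly F[n.+1]}) : mmap iota y f = 0 -> eval_at P f = 0.
Proof.
move=> fy; have hf := homogenize_homog i0 (leqnn (msize f)).
have := (generic_pointP hf).1; rewrite (mmap_generic hf) mmap_homogenize ?affine_coord_i0 //.
by rewrite fy mulr0 => /(_ erefl _ (valP P)); rewrite mmap_homogenize.
Qed.

(* [has_value h c]: the function [h] is regular at [P], with value [c] there. *)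
Definition has_value (h : K) (c : L) := exists f u : {mpoly F[n.+1]},
  [/\ eval_at P u != 0, h = mmap iota y f / mmap iota y u & c = eval_at P f / eval_at P u].

Lemma has_value_den (u : {mpoly F[n.+1]}) : eval_at P u != 0 -> mmap iota y u != 0.
Proof. by apply: contraNneq => /mmap_chart_eq0 ->. Qed.

Lemma has_value_mmap f : has_value (mmap iota y f) (eval_at P f).
Proof. by exists f, 1; rewrite /eval_at !rmorph1 oner_neq0 !divr1. Qed.

Lemma has_value_inj h c c' : has_value h c -> has_value h c' -> c = c'.
Proof.
move=> [f [u [u0 -> ->]]] [f' [u' [u'0 hE ->]]].
have /eqP := hE; rewrite eqr_div ?has_value_den // -!rmorphM -subr_eq0 -rmorphB /=.
move=> /eqP/mmap_chart_eq0; rewrite /eval_at rmorphB !rmorphM /= => /subr0_eq/eqP.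
by rewrite -eqr_div // => /eqP.
Qed.

Lemma has_valueB h c h' c' : has_value h c -> has_value h' c' -> has_value (h - h') (c - c').
Proof.
move=> [f [u [u0 -> ->]]] [f' [u' [u'0 -> ->]]].
exists (f * u' - f' * u), (u * u'); split.
- by rewrite /eval_at rmorphM mulf_neq0.
- by rewrite rmorphB !rmorphM /= -[- (_ / _)]mulNr addf_div ?has_value_den // mulNr.
- by rewrite /eval_at rmorphB !rmorphM /= -[- (_ / _)]mulNr addf_div // mulNr.
Qed.

Lemma has_valueM h c h' c' : has_value h c -> has_value h' c' -> has_value (h * h') (c * c').
Proof.
move=> [f [u [u0 -> ->]]] [f' [u' [u'0 -> ->]]].
exists (f * f'), (u * u'); split.
- by rewrite /eval_at rmorphM mulf_neq0.
- by rewrite !rmorphM /= mulf_div.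
- by rewrite /eval_at !rmorphM /= mulf_div.
Qed.

Lemma has_valueV h c : has_value h c -> c != 0 -> has_value h^-1 c^-1.
Proof.
move=> [f [u [u0 -> ->]]]; rewrite mulf_eq0 invr_eq0 negb_or => /andP[f0 _].
by exists u, f; rewrite f0 !invf_div.
Qed.

Lemma has_value_const c : has_value (iota c) (jL c).
Proof. by have := has_value_mmap c%:MP; rewrite /eval_at !mmapC. Qed.

Lemma has_value0 : has_value 0 0. Proof. by have := has_value_const 0; rewrite !rmorph0. Qed.

Lemma has_value1 : has_value 1 1. Proof. by have := has_value_const 1; rewrite !rmorph1. Qed.

Lemma has_valueN h c : has_value h c -> has_value (- h) (- c).
Proof. by rewrite -(sub0r h) -(sub0r c); apply: has_valueB; exact: has_value0. Qed.

Lemma has_valueD h c h' c' : has_value h c -> has_value h' c' -> has_value (h + h') (c + c').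
Proof. by move=> rh /has_valueN; rewrite -{2}(opprK h') -{2}(opprK c'); exact: has_valueB. Qed.

Lemma has_value_sum (I : finType) (h : I -> K) (c : I -> L) :
  (forall i, has_value (h i) (c i)) -> has_value (\sum_i h i) (\sum_i c i).
Proof. by move=> r; apply: (big_ind2 has_value) => // [|*]; [exact: has_value0|exact: has_valueD]. Qed.

Lemma has_value_prod (I : finType) (h : I -> K) (c : I -> L) :
  (forall i, has_value (h i) (c i)) -> has_value (\prod_i h i) (\prod_i c i).
Proof. by move=> r; apply: (big_ind2 has_value) => // [|*]; [exact: has_value1|exact: has_valueM]. Qed.

Lemma has_valueX h c m : has_value h c -> has_value (h ^+ m) (c ^+ m).
Proof.
by move=> r; elim: m => [|m IHm]; [exact: has_value1|rewrite !exprS; exact: has_valueM].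
Qed.

Lemma has_value_horner (p : {poly K}) (p' : {poly L}) h c :
  size p' = size p -> (forall i, has_value p`_i p'`_i) -> has_value h c -> has_value p.[h] p'.[c].
Proof.
move=> sp pp' rh; rewrite !horner_coef sp; apply: has_value_sum => i.
by apply: has_valueM => //; exact: has_valueX.
Qed.

Lemma has_value_horner_map (p : {poly F}) h c :
  has_value h c -> has_value (map_poly iota p).[h] (map_poly jL p).[c].
Proof.
move=> rh; apply: has_value_horner => //; first by rewrite !size_map_poly.
by move=> i; rewrite !coef_map; exact: has_value_const.
Qed.

(** Passes between quotients of forms of equal degree and quotients of arbitrary polynomials in the
    affine coordinates; numerator and denominator are homogenized to a common degree. *)
Lemma local_ringE h : local_ring P h <-> exists c, has_value h c.
Proof.
split=> [[e [f [u [hf hu u0 ->]]]]|[_ [f [u [u0 -> _]]]]].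
  exists (eval_at P f / eval_at P u), f, u; split=> //.
  by rewrite !(mmap_generic hf, mmap_generic hu) -mulf_div divff ?mul1r // expf_neq0 // generic_coord_neq0.
pose d := maxn (msize f) (msize u).
have hf := homogenize_homog i0 (leq_maxl (msize f) (msize u)).
have hu := homogenize_homog i0 (leq_maxr (msize f) (msize u)).
exists d, (homogenize i0 d f), (homogenize i0 d u); split=> //.
  by rewrite /eval_at mmap_homogenize.
rewrite (mmap_generic hf) (mmap_generic hu) !mmap_homogenize ?affine_coord_i0 //.
by rewrite -mulf_div divff ?mul1r // expf_neq0 // generic_coord_neq0.
Qed.

Lemma maximal_idealE h : maximal_ideal P h <-> has_value h 0.
Proof.
split=> [[e [f [u [hf hu u0 fP ->]]]]|[f [u [u0 -> /esym/eqP]]]].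
  exists f, u; split=> //; last by rewrite fP mul0r.
  by rewrite !(mmap_generic hf, mmap_generic hu) -mulf_div divff ?mul1r // expf_neq0 // generic_coord_neq0.
rewrite mulf_eq0 invr_eq0 (negPf u0) orbF => /eqP fP.
pose d := maxn (msize f) (msize u).
have hf := homogenize_homog i0 (leq_maxl (msize f) (msize u)).
have hu := homogenize_homog i0 (leq_maxr (msize f) (msize u)).
exists d, (homogenize i0 d f), (homogenize i0 d u); split=> //.
- by rewrite /eval_at mmap_homogenize.
- by rewrite /eval_at mmap_homogenize.
rewrite (mmap_generic hf) (mmap_generic hu) !mmap_homogenize ?affine_coord_i0 //.
by rewrite -mulf_div divff ?mul1r // expf_neq0 // generic_coord_neq0.
Qed.

End Chart.

Lemma chart_exists (F : finFieldType) (C : curve F) (P : Defs.point C) :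
  exists i, coords (val P) i = 1.
Proof.
by have /existsP[i /andP[/eqP ai _]] := valP (val P); exists i.
Qed.

(** * Local generators *)

Section AlgebraicDependence.
Variables (F : finFieldType) (K : fieldType) (iota : {rmorphism F -> K}).
Hypothesis trdeg1 : ~ exists y : 'I_2 -> K, alg_independent iota y.

Definition eval_coef (z : K) : {poly F} -> K := horner_eval z \o map_poly iota.

HB.instance Definition _ z := GRing.RMorphism.on (eval_coef z).

(** In transcendence degree 1, z and w satisfy a polynomial relation. Read as a polynomial in w over
    F[z] and divided by the largest possible power of w, it has a nonzero constant term c, and c(z)
    is then a multiple of w. This bounds orders in the local rings and confines the zeros of
    forms. *)
Lemma algebraic_dependence z w : w != 0 ->
  exists (c : {poly F}) (b : {poly {poly F}}),
    c != 0 /\ (map_poly iota c).[z] = w * (map_poly (eval_coef z) b).[w].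
Proof.
move=> w0; pose y (i : 'I_2) := if i == ord0 then z else w.
have [p py p0] : exists2 p : {mpoly F[2]}, mmap iota y p = 0 & p <> 0.
  apply: contrapT => np; apply: trdeg1; exists y => p py.
  by apply: contrapT => p0; apply: np; exists p.
pose o1 : 'I_2 := fintype.lift ord0 ord0.
pose mon (m : 'X_{1..2}) : {poly {poly F}} := (p@_m *: 'X^(m ord0)) *: 'X^(m o1).
pose Q := \sum_(m <- msupp p) mon m.
have evQ : (map_poly (eval_coef z) Q).[w] = 0.
  rewrite -py /Q /mmap rmorph_sum /= horner_sum; apply: eq_bigr => m _.
  rewrite /mon map_polyZ map_polyXn hornerZ hornerXn /= /eval_coef /= /horner_eval.
  rewrite map_polyZ map_polyXn hornerZ hornerXn -mulrA; congr (_ * _).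
  by rewrite /mmap1 big_ord_recl big_ord1.
have Q0 : Q != 0.
  have [m0 m0p] : exists m, m \in msupp p.
    case E : (msupp p) => [|m s]; last by exists m; rewrite mem_head.
    by case: p0; apply/eqP; rewrite -msupp_eq0 E.
  apply/eqP => /(congr1 (fun Q : {poly {poly F}} => Q`_(m0 o1)`_(m0 ord0))).
  rewrite /Q coef_sum coef_sum coef0 coef0 (bigD1_seq m0) ?msupp_uniq //=.
  rewrite /mon coefZ coefXn eqxx mulr1 coefZ coefXn eqxx mulr1 big1 ?addr0.
    by move/eqP; rewrite mcoeff_eq0 m0p.
  move=> m mm0; rewrite coefZ coefXn; case: eqP => [e1|_]; last by rewrite mulr0 coef0.
  rewrite mulr1 coefZ coefXn; case: eqP => [e0|_]; last by rewrite mulr0.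
  case/eqP: mm0; apply/mnmP => i; have [->|] := eqVneq i ord0; first by rewrite e0.
  by move=> i0; suff -> : i = o1 by []; apply/val_inj; case: i i0 => [[|[|]]].
have [k [Q' Q'0 QE]] := multiplicity_XsubC Q 0; rewrite Q0 /= in Q'0.
have /factor_theorem[b bE] : root (Q' - (Q'.[0])%:P) 0 by rewrite rootE !hornerE subrr.
exists Q'.[0], (- b); split=> //.
have evQ' : (map_poly (eval_coef z) Q').[w] = 0.
  move: evQ; rewrite QE rmorphM rmorphXn /= rmorphB /= map_polyX map_polyC /= rmorph0.
  rewrite subr0 hornerM hornerXn => /eqP; rewrite mulf_eq0 expf_eq0 (negPf w0) andbF orbF.
  by move/eqP.
have := congr1 (fun Q : {poly {poly F}} => (map_poly (eval_coef z) Q).[w]) bE.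
rewrite /= !rmorphB rmorphM /= rmorphB /= map_polyX !map_polyC /= rmorph0 subr0.
rewrite !hornerE evQ' sub0r rmorphN hornerN mulrN [w * _]mulrC => <-.
by rewrite opprK.
Qed.

End AlgebraicDependence.

Section Generator.
Variables (F : finFieldType) (C : curve F) (P : Defs.point C) (i0 : 'I_(ambient_dim C).+1).
Local Notation L := (Defs.closure C).
Local Notation K := (funfield C).
Local Notation n := (ambient_dim C).
Local Notation iota := (@to_funfield F C).
Local Notation jL := (@to_closure F C).
Local Notation x := (@generic_point F C).
Local Notation a := (coords (val P)).
Hypothesis ai0 : a i0 = 1.
Local Notation y := (affine_coord i0).
Local Notation has_value := (has_value P i0).

Definition regular (h : K) := exists c, has_value h c.

Lemma regularM h h' : regular h -> regular h' -> regular (h * h').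
Proof. by move=> [c r] [c' r']; exists (c * c'); exact: has_valueM. Qed.

Lemma regular_sum (I : finType) (h : I -> K) :
  (forall i, regular (h i)) -> regular (\sum_i h i).
Proof.
by move=> /choice[c rc]; exists (\sum_i c i); exact: (has_value_sum ai0).
Qed.

Lemma regular_horner (p : {poly K}) h :
  (forall i, regular p`_i) -> regular h -> regular p.[h].
Proof.
move=> rp [c rh]; rewrite horner_coef; apply: regular_sum => i.
by apply: regularM => //; exists (c ^+ i); exact: has_valueX.
Qed.

Lemma has_value_det m (A : 'M[K]_m) (B : 'M[L]_m) :
  (forall i k, has_value (A i k) (B i k)) -> has_value (\det A) (\det B).
Proof.
move=> AB; apply: (has_value_sum ai0) => s; apply: has_valueM; last by apply: has_value_prod => i.
by apply: has_valueX; apply: (has_valueN ai0); exact: has_value1.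
Qed.

(** B has an invertible minor of size n. The corresponding minor of A has a determinant with nonzero
    value at P, hence is invertible over the local ring, and the relations can be solved for every
    w_k in terms of the one in the omitted column [k0]. *)
Lemma corank1_relations p (A : 'M[K]_(p, n.+1)) (B : 'M[L]_(p, n.+1)) (w : 'I_n.+1 -> K) :
  (forall i k, has_value (A i k) (B i k)) -> \rank B = n ->
  (forall i, \sum_k A i k * w k = 0) ->
  exists k0, forall k, exists2 o, regular o & w k = w k0 * o.
Proof.
move=> AB rB Aw; pose f := maxrankfun B; set r := \rank B in rB f.
have full : row_full (rowsub f B)^T.
  by rewrite /row_full mxrank_tr; exact: maxrowsub_free.
pose h := fullrankfun full.
pose N : 'M[L]_r := \matrix_(k, i) B (f i) (h k).
pose NA : 'M[K]_r := \matrix_(k, i) A (f i) (h k).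
have uN : \det N != 0.
  rewrite -unitfE -unitmxE; have <- : rowsub h (rowsub f B)^T = N.
    by apply/matrixP => k i; rewrite !mxE.
  exact: fullrowsub_unit.
have NAN k i : has_value (NA k i) (N k i) by rewrite !mxE.
have rdet := has_value_det NAN.
have uNA : NA \in unitmx.
  rewrite unitmxE unitfE; apply: contraNneq uN => d0; rewrite d0 in rdet.
  by rewrite (has_value_inj ai0 rdet (has_value0 P i0)).
have hinj := @fullrankfun_inj _ _ _ _ full.
have [k0 k0P] : exists k0, [set h k | k : 'I_r]%SET = [set~ k0]%SET.
  have cS : #|[set h k | k : 'I_r]%SET| = n by rewrite card_imset // card_ord.
  have [k0] : exists k0, k0 \in ~: [set h k | k : 'I_r]%SET.
    by apply/card_gt0P; have := cardsC [set h k | k : 'I_r]%SET; rewrite cS card_ord; lia.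
  rewrite inE => nk0; exists k0; apply/eqP; rewrite eqEcard; apply/andP; split.
    by apply/fintype.subsetP => k; rewrite !inE; apply: contraTneq => ->.
  by rewrite cS cardsC1 card_ord.
exists k0; have regNA k i : regular (NA k i) by exists (N k i).
have reg_inv k i : regular (invmx NA k i).
  rewrite /invmx uNA mxE; apply: regularM.
    by exists (\det N)^-1; apply: has_valueV.
  rewrite mxE; apply: regularM.
    by exists ((-1) ^+ (i + k)); apply: has_valueX; apply: (has_valueN ai0); exact: has_value1.
  exists (\det (row' i (col' k N))); apply: has_value_det => k' i'; rewrite !mxE.
  exact: AB.
pose v : 'rV[K]_r := \row_i - A (f i) k0.
pose w' : 'rV[K]_r := \row_k w (h k).
have wE : w' = w k0 *: (v *m invmx NA).
  rewrite scalemxAl; apply: (canRL (mulmxK uNA)); apply/rowP => i; rewrite !mxE.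
  have := Aw (f i); rewrite (bigD1 k0) //= => /eqP; rewrite addr_eq0 mulrC mulrN => /eqP ->.
  rewrite opprK (eq_bigl (mem [set h k | k : 'I_r]%SET)) => [|k]; last first.
    by rewrite [RHS]/= k0P !inE.
  rewrite big_imset /=; last by move=> ? ? _ _; exact: hinj.
  by rewrite big_mkcond; apply: eq_bigr => k _; rewrite !mxE mulrC.
move=> k; have [->|kk0] := eqVneq k k0.
  by exists 1; rewrite ?mulr1 //; exists 1; exact: has_value1.
have : k \in [set h k | k : 'I_r]%SET by rewrite k0P !inE.
case/imsetP => k' _ ->; exists ((v *m invmx NA) ord0 k').
  rewrite mxE; apply: regular_sum => i; apply: regularM => //.
  by rewrite mxE; exists (- B (f i) k0); apply: (has_valueN ai0).
by have := congr1 (fun u : 'rV[K]_r => u ord0 k') wE; rewrite !mxE.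
Qed.

End Generator.

Lemma euler_formula (F : finFieldType) n e (f : {mpoly F[n]}) : f \is e.-homog ->
  f *+ e = \sum_k 'X_k * mderiv k f.
Proof.
move=> /dhomogP hf.
have -> : \sum_k 'X_k * mderiv k f =
    \sum_(m <- msupp f) \sum_(k < n) f@_m *: ((m k)%:R *: 'X_[m]).
  rewrite exchange_big /=; apply: eq_bigr => k _.
  rewrite {1}[f]mpolyE linear_sum mulr_sumr /=; apply: eq_bigr => m _.
  rewrite mderivZ mderivX -!scalerAr; congr (_ *: _).
  have [->|mk] := posnP (m k); first by rewrite !scale0r.
  by rewrite -mpolyXD addmC submK // lep1mP -lt0n.
rewrite {1}[f]mpolyE -sumrMnl !big_seq; apply: eq_bigr => m mf.
have <- : mdeg m = e by exact: hf.
rewrite -scaler_sumr -scaler_suml -natr_sum -mdegE scalerMnr.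
by rewrite scaler_nat.
Qed.

(** * First-order expansion along Frobenius *)

Section FrobeniusDifferences.
Variables (F : finFieldType) (C : curve F) (P : Defs.point C) (i0 : 'I_(ambient_dim C).+1).
Local Notation L := (Defs.closure C).
Local Notation K := (funfield C).
Local Notation n := (ambient_dim C).
Local Notation iota := (@to_funfield F C).
Local Notation jL := (@to_closure F C).
Local Notation x := (@generic_point F C).
Local Notation a := (coords (val P)).
Hypothesis ai0 : a i0 = 1.
Local Notation y := (affine_coord i0).
Local Notation has_value := (has_value P i0).
Local Notation regular := (regular P i0).
Variable m : nat.
Hypotheses (m_gt0 : (0 < m)%N) (period : forall k, frobenius jL m (a k) = a k).

Definition frob_coord k : K := frobenius iota m (y k).
Local Notation fy := frob_coord.

Definition frob_diff k : K := fy k - y k.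
Local Notation w := frob_diff.

Lemma mmap_frob_coord f : mmap iota fy f = frobenius iota m (mmap iota y f).
Proof. by rewrite (rmorph_mmap (frobenius_base iota m)). Qed.

Lemma eval_at_frobenius f : frobenius jL m (eval_at P f) = eval_at P f.
Proof.
rewrite /eval_at (rmorph_mmap (frobenius_base jL m)) /=.
by congr mmap; apply/funext => k; rewrite period.
Qed.

Lemma has_value_frob_coord f : has_value (mmap iota fy f) (eval_at P f).
Proof.
rewrite mmap_frob_coord -eval_at_frobenius; apply: has_valueX.
exact: has_value_mmap.
Qed.

Lemma has_value_coord k : has_value (y k) (a k).
Proof. by have := has_value_mmap P i0 'X_k; rewrite /eval_at !mmap_var. Qed.

Lemma has_value_frob_diff k : has_value (w k) 0.
Proof.
have := has_valueB ai0 (has_value_frob_coord 'X_k) (has_value_coord k).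
by rewrite /eval_at !mmap_var subrr.
Qed.

(** The identity is exact: higher-order terms are absorbed in the coefficients [g k], of which only
    the values at P are prescribed. *)
Definition taylor f := exists g : 'I_n.+1 -> K,
  (forall k, has_value (g k) (eval_at P (mderiv k f))) /\
  mmap iota fy f = mmap iota y f + \sum_k g k * w k.

Lemma taylorC c : taylor c%:MP.
Proof.
exists (fun=> 0); split=> [k|]; last first.
  by rewrite !mmapC big1 ?addr0 // => k _; rewrite mul0r.
by rewrite mderivC /eval_at mmap0; exact: has_value0.
Qed.

Lemma taylorX i : taylor 'X_i.
Proof.
exists (fun k => (i == k)%:R); split=> [k|].
  have -> : eval_at P (mderiv k 'X_i) = (i == k)%:R.
    rewrite mderivX mnm1E /eval_at mmapZ rmorph_nat mmapX.
    case: eqP => [->|_]; rewrite ?mul0r //.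
    have -> : (U_(k) - U_(k))%MM = 0%MM by apply/mnmP => l; rewrite mnmBE subnn mnm0E.
    by rewrite mmap11 mulr1.
  by case: (i == k); [exact: has_value1|exact: has_value0].
rewrite !mmap_var (bigD1 i) //= eqxx mul1r big1 => [|k ki]; last first.
  by rewrite eq_sym (negPf ki) mul0r.
by rewrite addr0 addrC subrK.
Qed.

Lemma taylorD f f' : taylor f -> taylor f' -> taylor (f + f').
Proof.
move=> [g [gP gE]] [g' [g'P g'E]]; exists (fun k => g k + g' k); split=> [k|].
  by rewrite mderivD /eval_at rmorphD; apply: (has_valueD ai0); [exact: gP|exact: g'P].
rewrite !rmorphD /= gE g'E addrACA -big_split /=; congr (_ + _).
by apply: eq_bigr => k _; rewrite mulrDl.
Qed.

Lemma taylorM f f' : taylor f -> taylor f' -> taylor (f * f').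
Proof.
move=> [g [gP gE]] [g' [g'P g'E]].
(* From F F' - f f' = (F - f) F' + f (F' - f'), with capitals for values at y^Q. The mixed arguments
   do no harm, since f'(y^Q) and f'(y) have the same value at P. *)
exists (fun k => g k * mmap iota fy f' + mmap iota y f * g' k); split=> [k|].
  rewrite mderivM /eval_at rmorphD !rmorphM; apply: (has_valueD ai0); apply: has_valueM.
  - exact: gP.
  - exact: has_value_frob_coord.
  - exact: has_value_mmap.
  - exact: g'P.
under eq_bigr => k _ do rewrite mulrDl [g k * _ * _]mulrAC -[mmap iota y f * _ * _]mulrA.
rewrite big_split /= -mulr_suml -mulr_sumr.
have -> : \sum_k g k * w k = mmap iota fy f - mmap iota y f by rewrite gE addrC addKr.
have -> : \sum_k g' k * w k = mmap iota fy f' - mmap iota y f' by rewrite g'E addrC addKr.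
rewrite !rmorphM /=; ring.
Qed.

Lemma taylor_all f : taylor f.
Proof.
elim/mpolyind: f => [|c mm f _ _ IHf]; first by rewrite -mpolyC0; exact: taylorC.
apply: taylorD => //; rewrite -mul_mpolyC; apply: taylorM; first exact: taylorC.
rewrite mpolyXE_id; elim/big_ind: _ => [|f1 f2|i _]; [|exact: taylorM|].
  by rewrite -mpolyC1; exact: taylorC.
elim: (mm i) => [|e IHe]; first by rewrite expr0 -mpolyC1; exact: taylorC.
by rewrite exprS; apply: taylorM => //; exact: taylorX.
Qed.

(** For z = f(y) with value 0, the expansion gives z^Q - z as a combination of the w_k. Since
    z^(Q-1) - 1 has value -1, it is a unit and can be divided out, leaving z itself. *)
Lemma maximal_ideal_frob_diff h : has_value h 0 ->
  exists2 o : 'I_n.+1 -> K, (forall k, regular (o k)) & h = \sum_k o k * w k.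
Proof.
move=> [f [u [u0 -> /esym/eqP]]]; rewrite mulf_eq0 invr_eq0 (negPf u0) orbF => /eqP f0.
have [g [gP]] := taylor_all f; rewrite mmap_frob_coord /frobenius => gE.
pose Q := (#|F| ^ m)%N; have Q1 : (0 < Q.-1)%N.
  by rewrite -ltnS prednK ?expn_gt0 ?(ltnW (finNzRing_gt1 F)) // -{1}(expn0 #|F|) ltn_exp2l ?finNzRing_gt1.
pose z := mmap iota y f; have zv : has_value z 0 by rewrite -f0; exact: has_value_mmap.
have dv : has_value (z ^+ Q.-1 - 1) (- 1).
  have := has_valueB ai0 (has_valueX Q.-1 zv) (has_value1 P i0).
  by rewrite expr0n eqn0Ngt Q1 sub0r.
have d0 : z ^+ Q.-1 - 1 != 0.
  apply: contraTneq isT => d0; rewrite d0 in dv.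
  by have /eqP := has_value_inj ai0 dv (has_value0 P i0); rewrite oppr_eq0 oner_eq0.
have zE : z * (z ^+ Q.-1 - 1) = \sum_k g k * w k.
  apply: (addrI z); rewrite -gE mulrBr mulr1 -exprS prednK; first by rewrite addrC subrK.
  by rewrite expn_gt0 ltnW // finNzRing_gt1.
exists (fun k => (z ^+ Q.-1 - 1)^-1 / mmap iota y u * g k) => [k|].
  apply: regularM; last by eexists; exact: gP.
  apply: regularM; first by exists (- 1)^-1; apply: has_valueV => //; rewrite oppr_eq0 oner_eq0.
  by exists (eval_at P u)^-1; apply: has_valueV => //; exact: has_value_mmap.
under eq_bigr => k _ do rewrite -[_ * g k * _]mulrA.
by rewrite -mulr_sumr -zE mulrCA; congr (_ * _); rewrite mulrAC mulVf ?mul1r.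
Qed.

Lemma frob_coord_i0 : w i0 = 0.
Proof. by rewrite /w /fy (affine_coord_i0 ai0) rmorph1 subrr. Qed.

Lemma euler_row (v : 'I_(neqs C)) :
  \sum_k a k * eval_at P (mderiv k (eqs v)) = 0.
Proof.
have [e he] := eqs_homog v.
have vP : eval_at P (eqs v) = 0 by apply/eqP; move: (valP P) => /forallP/(_ v).
transitivity (eval_at P ((eqs v) *+ e)); last by rewrite /eval_at rmorphMn /= [mmap _ _ _]vP mul0rn.
have -> : (eqs v) *+ e = \sum_k 'X_k * mderiv k (eqs v) :> {mpoly F[n.+1]}.
  exact: euler_formula.
rewrite /eval_at rmorph_sum; apply: eq_bigr => k _.
by rewrite rmorphM /= mmap_var.
Qed.

End FrobeniusDifferences.

(** * The local ring at a smooth point *)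

Section LocalRing.
Variables (F : finFieldType) (C : curve F) (P : Defs.point C).
Local Notation L := (Defs.closure C).
Local Notation K := (funfield C).
Local Notation n := (ambient_dim C).
Local Notation iota := (@to_funfield F C).
Local Notation jL := (@to_closure F C).
Local Notation x := (@generic_point F C).
Local Notation a := (coords (val P)).

Lemma generic_point_eqs i0 (v : 'I_(neqs C)) : a i0 = 1 ->
  mmap iota (affine_coord i0) (eqs v) = 0.
Proof.
move=> ai0; have [e he] := eqs_homog v.
have := (generic_pointP he).2; rewrite (mmap_generic ai0 he) => eq0.
have /eqP : x i0 ^+ e * mmap iota (affine_coord i0) (eqs v) = 0.
  by apply: eq0 => Q /forallP/(_ v)/eqP.
by rewrite mulf_eq0 expf_eq0 (negPf (generic_coord_neq0 ai0)) andbF => /eqP.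
Qed.

(** The equations give relations among the w_k whose matrix has rank n - 1 at P, one short of what
    [corank1_relations] requires. The missing relation is w_i0 = 0, which holds because the
    coordinate y_i0 is 1. *)
Lemma smooth_generator i0 m : a i0 = 1 -> (0 < m)%N ->
  (forall k, frobenius jL m (a k) = a k) ->
  exists k0, forall k, exists2 o, regular P i0 o &
    frob_diff i0 m k = frob_diff i0 m k0 * o.
Proof.
move=> ai0 m0 am.
have /choice[g gP] : forall v, taylor P i0 m (eqs v).
  by move=> v; exact: (taylor_all ai0 am).
pose A : 'M[K]_(neqs C + 1, n.+1) := col_mx (\matrix_(v, k) g v k) (delta_mx 0 i0).
pose J : 'M[L]_(neqs C, n.+1) := \matrix_(v, k) eval_at P (mderiv k (eqs v)).
pose B : 'M[L]_(neqs C + 1, n.+1) := col_mx J (delta_mx 0 i0).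
apply: (@corank1_relations _ _ _ _ ai0 _ A B).
- move=> i k; rewrite !mxE; case: (fintype.split i) => v; rewrite !mxE; first exact: (gP v).1.
  case: (_ && _); [exact: has_value1|exact: has_value0].
- have rJ : (\rank J).+1 = n by exact: (curve_smooth (valP P)).
  rewrite -addsmxE mxrank_disjoint_sum.
    by rewrite mxrank_delta addn1.
  (* By Euler's formula the Jacobian kills the coordinate vector of P, while the added row takes the
     value 1 on it; so that row is independent of the others. *)
  pose u : 'cV[L]_n.+1 := \col_k a k.
  have Ju : J *m u = 0.
    apply/matrixP => v j; rewrite !mxE -[RHS](euler_row P v).
    by apply: eq_bigr => k _; rewrite !mxE mulrC.
  have eu : (delta_mx 0 i0 : 'rV[L]_n.+1) *m u = 1%:M.
    by rewrite -rowE; apply/matrixP => ? ?; rewrite !mxE !ord1 ai0.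
  apply/eqP; rewrite -submx0; apply/rV_subP => v; rewrite sub_capmx.
  move=> /andP[/submxP[D DE] /submxP[c cE]].
  have c0 : c = 0.
    by rewrite -[c]mulmx1 -eu mulmxA -cE DE -mulmxA Ju mulmx0.
  by rewrite cE c0 mul0mx sub0mx.
move=> i; have AE k : A i k = match fintype.split i with inl v => g v k | inr _ => (k == i0)%:R end.
  by rewrite !mxE; case: (fintype.split i) => v; rewrite !mxE // ord1 eqxx.
under eq_bigr => k _ do rewrite AE.
case: (fintype.split i) => v.
  have := (gP v).2; rewrite mmap_frob_coord (generic_point_eqs v ai0) rmorph0 add0r.
  by move=> <-.
rewrite (bigD1 i0) //= eqxx mul1r (frob_coord_i0 ai0) add0r big1 // => k /negPf ->.
by rewrite mul0r.
Qed.

Lemma maximal_ideal_generator : exists t, uniformizer P t.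
Proof.
have [i0 ai0] := chart_exists P.
have [m m0 am] := frobenius_common_period (fun k => closure_algebraic (a k)).
have [k0 k0P] := smooth_generator ai0 m0 am.
exists (frob_diff i0 m k0); split.
  by apply/(maximal_idealE ai0); exact: has_value_frob_diff.
move=> h /(maximal_idealE ai0)/(maximal_ideal_frob_diff ai0 m0 am)[o ro ->].
have /choice[o' o'P] : forall k, exists o', regular P i0 o' /\ frob_diff i0 m k = frob_diff i0 m k0 * o'.
  by move=> k; have [o' ? ?] := k0P k; exists o'.
exists (\sum_k o k * o' k).
  apply/(local_ringE ai0); apply: (regular_sum ai0) => k; apply: regularM => //.
  exact: (o'P k).1.
by rewrite mulr_sumr; apply: eq_bigr => k _; rewrite (o'P k).2 mulrCA.
Qed.

Lemma funfield_not_algebraic Q : (1 < Q)%N -> ~ forall h : K, h ^+ Q = h.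
Proof.
move=> Q1 hQ; have [[y yind] _] := curve_dim1 C.
have : ('X_ord0 ^+ Q - 'X_ord0 : {mpoly F[1]}) = 0.
  by apply: yind; rewrite rmorphB rmorphXn /= !mmap_var hQ subrr.
move=> /(congr1 (mcoeff U_(ord0))); rewrite mcoeffB mcoeff0 mpolyXn !mcoeffX eqxx.
case: eqP => [/(congr1 (fun m : 'X_{1..1} => mdeg m))|_].
  by rewrite mdegMn !mdeg1 mul1n => Q1'; rewrite Q1' in Q1.
by rewrite sub0r => /eqP; rewrite oppr_eq0 oner_eq0.
Qed.

(** If t were 0, every w_k would vanish, so y^Q = y and every element of K would satisfy h^Q = h,
    contradicting the existence of a transcendental element. *)
Lemma uniformizer_neq0 t : uniformizer P t -> t != 0.
Proof.
move=> [Mt gen]; apply/eqP => t0.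
have [i0 ai0] := chart_exists P.
have [m m0 am] := frobenius_common_period (fun k => closure_algebraic (a k)).
have w0 k : frob_diff i0 m k = 0.
  have /(gen _)[u _ ->] : maximal_ideal P (frob_diff i0 m k).
    by apply/(maximal_idealE ai0); exact: has_value_frob_diff.
  by rewrite t0 mul0r.
apply: (@funfield_not_algebraic (#|F| ^ m)).
  by rewrite -{1}(expn0 #|F|) ltn_exp2l ?finNzRing_gt1.
have fixed f : (mmap iota (affine_coord i0) f) ^+ (#|F| ^ m) = mmap iota (affine_coord i0) f.
  rewrite -[LHS]/(frobenius iota m _) -mmap_frob_coord; congr mmap; apply/funext => k.
  exact/subr0_eq/w0.
move=> h; have [e [f [u [hf hu _ ->]]]] := funfield_generated h.
rewrite (mmap_generic ai0 hf) (mmap_generic ai0 hu) -mulf_div divff ?mul1r.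
  by rewrite expr_div_n !fixed.
by rewrite expf_neq0 // (generic_coord_neq0 ai0).
Qed.

Lemma local_ring_dvr t : uniformizer P t -> dvr (local_ring P) (maximal_ideal P) t.
Proof.
move=> ut; have [i0 ai0] := chart_exists P.
have OE := local_ringE ai0; have ME := maximal_idealE ai0.
have O_value h c : has_value P i0 h c -> local_ring P h by move=> hc; apply/OE; exists c.
have unit h : local_ring P h -> ~ maximal_ideal P h -> exists2 c, has_value P i0 h c & c != 0.
  by move=> /OE[c hc] nMh; exists c => //; apply: contra_notN nMh => /eqP c0; apply/ME; rewrite -c0.
have OX h c k : has_value P i0 h c -> regular P i0 (h ^+ k).
  by move=> hc; exists (c ^+ k); exact: has_valueX.
split=> //.
- split; first exact: O_value (has_value0 P i0).
  by move=> h h' /OE[c hc] /OE[c' hc']; exact: O_value (has_valueB ai0 hc hc').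
- split; first exact/ME/has_value0.
  by move=> h h' /ME h0 /ME h'0; apply/ME; have := has_valueB ai0 h0 h'0; rewrite subr0.
- exact: O_value (has_value1 P i0).
- by move=> h h' /OE[c hc] /OE[c' hc']; exact: O_value (has_valueM hc hc').
- by move=> h /ME; exact: O_value.
- by move=> h h' /OE[c hc] /ME h'0; apply/ME; have := has_valueM hc h'0; rewrite mulr0.
- move=> /ME h0; have /eqP := has_value_inj ai0 h0 (has_value1 P i0).
  by rewrite eq_sym oner_eq0.
- by move=> h Oh nMh; have [c hc c0] := unit _ Oh nMh; exact: O_value (has_valueV hc c0).
- exact: uniformizer_neq0.
- move=> h Oh h0; have /ME tv := ut.1; have /OE[c0 hc0] := Oh.
  (* [c(t) = h b(t, h)] with [c = 'X^e * c'] and [c'.[0] != 0], so that [c'(t)] is a unit. *)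
  have [c [b [cn0 cE]]] := algebraic_dependence (curve_dim1 C).2 t h0.
  have [e [c' c'0 c'E]] := multiplicity_XsubC c 0; rewrite cn0 /= in c'0.
  have vd := has_value_horner_map ai0 c' tv.
  rewrite rootE in c'0; have d0 : (map_poly jL c').[0] != 0.
    by rewrite -[X in _.[X]](rmorph0 jL) horner_map fmorph_eq0.
  have reg_e (p : {poly F}) : regular P i0 (eval_coef iota t p).
    by eexists; exact: (has_value_horner_map ai0 p tv).
  have reg_b : regular P i0 (map_poly (eval_coef iota t) b).[h].
    apply: (regular_horner ai0); last by exists c0.
    by move=> k; rewrite coef_map; exact: reg_e.
  exists e; rewrite c'E rmorphM rmorphXn /= rmorphB /= map_polyX map_polyC /= rmorph0 subr0 in cE.
  rewrite hornerM hornerXn in cE.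
  exists ((map_poly (eval_coef iota t) b).[h] / (map_poly iota c').[t]); split.
    apply/OE; apply: regularM => //; eexists; exact: has_valueV vd d0.
  rewrite mulrA -cE mulrAC divff ?mul1r //.
  apply: contraNneq d0 => d0; rewrite d0 in vd.
  by apply/eqP; exact: (has_value_inj ai0 vd (has_value0 P i0)).
move=> h; have [e [f [u [hf hu u0 hE]]]] := funfield_generated h.
exists (mmap iota (affine_coord i0) f), (mmap iota (affine_coord i0) u); split.
- exact: O_value (has_value_mmap P i0 f).
- exact: O_value (has_value_mmap P i0 u).
- by apply: contraNneq u0 => u0; rewrite (mmap_generic ai0 hu) u0 mulr0.
rewrite hE (mmap_generic ai0 hf) (mmap_generic ai0 hu) -mulf_div divff ?mul1r //.
by rewrite expf_neq0 // (generic_coord_neq0 ai0).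
Qed.

End LocalRing.

(** * Orders *)

Section Zeros.
Variables (F : finFieldType) (C : curve F).
Local Notation L := (Defs.closure C).
Local Notation K := (funfield C).
Local Notation n := (ambient_dim C).
Local Notation iota := (@to_funfield F C).
Local Notation jL := (@to_closure F C).
Local Notation x := (@generic_point F C).
Local Notation point := (Defs.point C).
Implicit Types P : point.

Lemma finite_points (R : seq L) :
  finite_set [set P : point | forall k, coords (val P) k \in R].
Proof.
pose T := [seq [ffun k => nth 0 R (g k)] | g : {ffun 'I_n.+1 -> 'I_(size R)}].
pose cs P : {ffun 'I_n.+1 -> L} := sval (sval P).
have inj : {in cs @^-1` [set` T] &, injective cs}.
  by move=> P Q _ _ PQ; do 2!apply: val_inj.
apply: sub_finite_set (finite_preimage inj (finite_seq T)) => P /= PR.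
have lt k : (seq.index (coords (val P) k) R < size R)%N by rewrite index_mem.
apply/fintype.imageP; exists [ffun k => Ordinal (lt k)] => //.
by apply/ffunP => k; rewrite !ffunE /= nth_index.
Qed.

(** On a chart, each coordinate y_k has a nonzero polynomial c(y_k) that is a regular multiple of
    f(y). Where f vanishes the coordinate is a root of c, so each coordinate takes finitely many
    values. *)
Lemma finite_zeros e (f : {mpoly F[n.+1]}) : f \is e.-homog -> mmap iota x f != 0 ->
  finite_set [set P : point | eval_at P f = 0].
Proof.
move=> hf f0.
have /choice[r rP] : forall ik : 'I_n.+1 * 'I_n.+1, exists s : seq L, forall P : point,
    coords (val P) ik.1 = 1 -> eval_at P f = 0 -> coords (val P) ik.2 \in s.
  move=> [i k] /=; have [[P0 aP0]|none] := pselect (exists P : point, coords (val P) i = 1); last first.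
    by exists [::] => P ai; case: none; exists P.
  have w0 : mmap iota (affine_coord i) f != 0.
    by apply: contraNneq f0 => w0; rewrite (mmap_generic aP0 hf) w0 mulr0.
  have [c [b [cn0 cE]]] := algebraic_dependence (curve_dim1 C).2 (affine_coord i k) w0.
  have [s sE] := closed_field_poly_normal (map_poly jL c).
  exists s => P ai fP.
  have yk := has_value_coord P i k.
  have vd := has_value_horner_map ai c yk.
  have : regular P i (map_poly (eval_coef iota (affine_coord i k)) b).[mmap iota (affine_coord i) f].
    apply: (regular_horner ai); last by eexists; exact: has_value_mmap.
    by move=> l; rewrite coef_map; eexists; exact: (has_value_horner_map ai b`_l yk).
  move=> [d hd]; have := has_valueM (has_value_mmap P i f) hd.
  rewrite -cE fP mul0r => v0; have /eqP := has_value_inj ai vd v0.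
  rewrite sE hornerZ mulf_eq0 lead_coef_eq0 map_poly_eq0 (negPf cn0) /=.
  by rewrite -[_ == 0]/(root _ _) root_prod_XsubC.
pose R := flatten [seq r ik | ik : 'I_n.+1 * 'I_n.+1].
apply: sub_finite_set (finite_points R) => P fP k /=.
have [i ai] := chart_exists P.
apply/flattenP; exists (r (i, k)); last exact: rP.
by apply/fintype.imageP; exists (i, k).
Qed.

(** The default value is taken at h = 0 only. *)
Definition order_at P (h : K) : int := xget 0 [set k | has_order P h k].

Lemma dvr_at P : exists t, dvr (local_ring P) (maximal_ideal P) t.
Proof. by have [t ut] := maximal_ideal_generator P; exists t; exact: local_ring_dvr. Qed.

Lemma order_atP P h : h != 0 -> has_order P h (order_at P h).
Proof.
move=> h0; have [t Ht] := dvr_at P.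
exact: (xgetPex 0 (order_of_ex Ht h0)).
Qed.

Lemma has_orderE P h k : has_order P h k <-> h != 0 /\ order_at P h = k.
Proof.
have [t Ht] := dvr_at P; split=> [hk|[h0 <-]]; last exact: order_atP.
have h0 := order_of_neq0 Ht hk; split=> //.
exact: (order_of_inj Ht (order_atP P h0) hk).
Qed.

Lemma vge_order P k h :
  vge order_at P k h <-> (h = 0 \/ exists2 l, has_order P h l & k <= l).
Proof.
split=> [[->|kh]|[->|[l /has_orderE[_ <-]]]]; try by [left|right].
have [->|h0] := eqVneq h 0; [by left|right].
by exists (order_at P h) => //; exact: order_atP.
Qed.

Lemma local_ring_vge P h : local_ring P h <-> vge order_at P 0 h.
Proof. by have [t Ht] := dvr_at P; rewrite vge_order; exact: (order_of_O Ht). Qed.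

Lemma maximal_ideal_vge P h : maximal_ideal P h <-> vge order_at P 1 h.
Proof. by have [t Ht] := dvr_at P; rewrite vge_order; exact: (order_of_M Ht). Qed.

Lemma order_at_unit P h : local_ring P h -> ~ maximal_ideal P h -> order_at P h = 0.
Proof.
move=> Oh nMh; have [t Ht] := dvr_at P.
by have /has_orderE[] : has_order P h 0 by exact: (order_of_unit Ht).
Qed.

Lemma order_at_finite h : h != 0 ->
  exists s : seq point, forall P, order_at P h != 0 -> P \in s.
Proof.
have [e [f [u [hf hu u0 ->]]]] := funfield_generated h.
rewrite mulf_eq0 negb_or => /andP[f0 _].
have /finite_seqP[s sP] : finite_set ([set P : point | eval_at P f = 0] `|` [set P : point | eval_at P u = 0]).
  by rewrite finite_setU; split; apply: finite_zeros; eassumption.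
exists s => P; apply: contraNT => Ps; apply/eqP.
have [uP fP] : eval_at P u != 0 /\ eval_at P f != 0.
  have : ~ ([set P : point | eval_at P f = 0] `|` [set P : point | eval_at P u = 0]) P by rewrite sP /=; apply/negP.
  by move=> /not_orP[/eqP ? /eqP ?].
apply: order_at_unit; first by exists e, f, u.
have [i ai] := chart_exists P; move=> /(maximal_idealE ai) v0.
have : has_value P i (mmap iota x f / mmap iota x u) (eval_at P f / eval_at P u).
  rewrite (mmap_generic ai hf) (mmap_generic ai hu) -mulf_div divff ?mul1r.
    by exists f, u.
  by rewrite expf_neq0 // (generic_coord_neq0 ai).
move=> /(has_value_inj ai v0)/esym/eqP.
by rewrite mulf_eq0 invr_eq0 (negPf uP) (negPf fP).
Qed.

End Zeros.

(** * Conjugate points and residue fields *)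

Section FiniteSubspace.
Variables (F : finFieldType) (K : fieldType) (iota : {rmorphism F -> K}).
Variables (V : lmodType K) (W : set V).
Hypotheses (sW : subgroup W) (WZ : forall c w, W w -> W (iota c *: w)).

(** An independent family of r elements has q^r distinct combinations in W, which bounds r; a family
    of maximal size spans. *)
Lemma finite_subspace_dim : finite_set W -> exists r, has_quotient_dim iota W [set 0] r.
Proof.
move=> /finite_seqP[s Ws].
pose indep r := exists b : 'I_r -> V, (forall k, W (b k)) /\
  forall c : {ffun 'I_r -> F}, \sum_k iota (c k) *: b k = 0 -> c = [ffun=> 0].
have diff r (b : 'I_r -> V) (c c' : {ffun 'I_r -> F}) :
    \sum_k iota (c k) *: b k - \sum_k iota (c' k) *: b k =
    \sum_k iota ([ffun k => c k - c' k] k) *: b k.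
  by rewrite -sumrB; apply: eq_bigr => k _; rewrite ffunE rmorphB scalerBl.
have indep_inj r (b : 'I_r -> V) : (forall c : {ffun 'I_r -> F}, \sum_k iota (c k) *: b k = 0 -> c = [ffun=> 0]) ->
    forall c c' : {ffun 'I_r -> F}, \sum_k iota (c k) *: b k = \sum_k iota (c' k) *: b k -> c = c'.
  move=> ib c c' /eqP; rewrite -subr_eq0 diff => /eqP/ib/ffunP cc'.
  by apply/ffunP => k; have := cc' k; rewrite !ffunE => /subr0_eq.
have ub r : `[< indep r >] -> (r <= size s)%N.
  move=> /asboolP[b [Wb ib]]; have r_lt : (r < #|F| ^ r)%N by rewrite ltn_expl // finNzRing_gt1.
  apply: leq_trans (ltnW r_lt) _.
  pose comb (c : {ffun 'I_r -> F}) := \sum_k iota (c k) *: b k.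
  have scomb c : comb c \in s.
    have : W (comb c) by apply: subgroup_sum => // k; exact: WZ.
    by rewrite Ws.
  have lt c : (seq.index (comb c) s < size s)%N by rewrite index_mem.
  have inj : injective (fun c => Ordinal (lt c)).
    move=> c c' /(congr1 (fun k : 'I_(size s) => nth 0 s k)) /=.
    by rewrite !nth_index //; exact: indep_inj.
  by have := leq_card _ inj; rewrite card_ffun !card_ord.
have ex : exists r, `[< indep r >].
  by exists 0%N; apply/asboolP; exists (fun=> 0); split=> [k|c _]; [exact: sW.1|apply/ffunP => -[]].
case: (ex_maxnP ex ub) => r /asboolP[b [Wb ib]] rmax; exists r, b; split=> // w Ww.
have [c cE] : exists c : {ffun 'I_r -> F}, w = \sum_k iota (c k) *: b k.
  apply: contrapT => nspan.
  suff /rmax : `[< indep r.+1 >] by rewrite ltnn.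
  apply/asboolP; exists (fun i => if unlift ord0 i is Some k then b k else w).
  split=> [i|c]; first by case: unliftP.
  rewrite big_ord_recl unlift_none; under eq_bigr => k _ do rewrite liftK.
  have [c0|c0] := eqVneq (c ord0) 0; last first.
    move=> /eqP; rewrite addr_eq0 => /eqP wE; case: nspan.
    exists [ffun k => - (c (fintype.lift ord0 k) / c ord0)].
    have ic0 : iota (c ord0) != 0 by rewrite fmorph_eq0.
    rewrite -[w]scale1r -(mulVf ic0) -scalerA wE scalerN -scaleNr scaler_sumr.
    apply: eq_bigr => k _; rewrite ffunE scalerA; congr (_ *: _).
    by rewrite rmorphN fmorph_div mulNr mulrC.
  rewrite c0 rmorph0 scale0r add0r => E.
  have := ib [ffun k => c (fintype.lift ord0 k)]; under eq_bigr => k _ do rewrite ffunE.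
  move=> /(_ E)/ffunP cl; apply/ffunP => i; rewrite ffunE.
  by have [k ->|->//] := unliftP ord0 i; have := cl k; rewrite !ffunE.
exists c; split=> [|c' /= /subr0_eq]; first by rewrite /= -cE subrr.
by rewrite cE => /(indep_inj _ _ ib).
Qed.

End FiniteSubspace.

Lemma prod_shift (R : comRingType) (m : nat) (f : nat -> R) :
  f m = f 0%N -> \prod_(k < m) f k.+1 = \prod_(k < m) f k.
Proof.
case: m => [|m] fm; first by rewrite !big_ord0.
by rewrite big_ord_recr big_ord_recl /= fm mulrC.
Qed.

Section Conjugates.
Variables (F : finFieldType) (E : fieldType) (j : {rmorphism F -> E}).
Variables (n m : nat) (v : 'I_n -> E).
Hypotheses (m_gt0 : (0 < m)%N) (period : forall i, frobenius j m (v i) = v i).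

(** A whole conjugate of the vector [v] becomes one element of the domain E[X]. A root of [G] is
    therefore an entire conjugate, with the same k for all coordinates. *)
Let B k : {poly E} := \poly_(i < n) (if insub i is Some o then frobenius j k (v o) else 0).

Let coefB k (i : 'I_n) : (B k)`_i = frobenius j k (v i).
Proof. by rewrite coef_poly ltn_ord valK. Qed.

Let mapB (s : {rmorphism E -> E}) k l : (forall i, s (frobenius j k (v i)) = frobenius j l (v i)) ->
  map_poly s (B k) = B l.
Proof.
move=> sv; apply/polyP => i; rewrite coef_map !coef_poly; case: ifP => [lt|_]; last exact: rmorph0.
by rewrite insubT /= sv.
Qed.

Let G : {poly {poly E}} := \prod_(k < m) ('X - (B k)%:P).

(* The polynomial [G] has the Frobenius conjugates of [v] as roots, and coefficients in [F]. *)
Lemma conjugates_frobenius (s : {rmorphism E -> E}) : (forall c, s (j c) = j c) ->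
  exists2 k, (k < m)%N & forall i, s (v i) = frobenius j k (v i).
Proof.
(* Frobenius permutes the factors of [G] cyclically, by the period m. Hence the coefficients lie in
   F and are fixed by s, which must send the root [B 0] to another root. *)
move=> sj; have frobG : map_poly (map_poly (frobenius j 1)) G = G.
  have mB k : map_poly (frobenius j 1) (B k) = B k.+1.
    by apply: mapB => i; exact: (esym (frobeniusD j 1 k (v i))).
  rewrite rmorph_prod /=; under eq_bigr => k _ do rewrite rmorphB /= map_polyX map_polyC /= mB.
  apply: (@prod_shift _ m (fun k => 'X - (B k)%:P)); congr ('X - _%:P).
  by apply/polyP => i; rewrite !coef_poly; case: ifP => // lt; rewrite insubT /= period frobenius0.
have sG : map_poly (map_poly s) G = G.
  apply/polyP => u; rewrite coef_map; apply/polyP => w; rewrite coef_map.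
  have /frobenius_fixed[c ->] : frobenius j 1 G`_u`_w = G`_u`_w.
    by rewrite -[in RHS]frobG !coef_map.
  exact: sj.
have : (map_poly (map_poly s) G).[map_poly s (B 0)] = 0.
  rewrite horner_map /= {1}/G horner_prod (bigD1 (Ordinal m_gt0)) //=.
  by rewrite hornerXsubC subrr mul0r rmorph0.
rewrite sG /G horner_prod => /eqP/prodf_eq0[k _]; rewrite hornerXsubC subr_eq0 => /eqP BE.
exists k => // i; have := congr1 (fun p : {poly E} => p`_i) BE.
by rewrite coef_map !coefB frobenius0.
Qed.

End Conjugates.

Section Orbits.
Variables (F : finFieldType) (C : curve F).
Local Notation L := (Defs.closure C).
Local Notation K := (funfield C).
Local Notation n := (ambient_dim C).
Local Notation jL := (@to_closure F C).
Local Notation point := (Defs.point C).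
Local Notation cs P := (coords (sval P : proj_point L n)).
Implicit Types P Q : point.

Lemma point_inj P Q : (forall i, cs P i = cs Q i) -> P = Q.
Proof. by move=> PQ; do 2!apply: val_inj; apply/ffunP => i; exact: PQ. Qed.

Lemma frobenius_point_ex k P : exists Q : point, forall i, cs Q i = frobenius jL k (cs P i).
Proof.
pose w : {ffun 'I_n.+1 -> L} := [ffun i => frobenius jL k (cs P i)].
have nw : normalized w.
  have /existsP[i /andP[/eqP ai /forallP a0]] := valP (sval P).
  apply/existsP; exists i; rewrite ffunE [cs P i]ai rmorph1 eqxx; apply/forallP => l.
  apply/implyP => li; have /implyP/(_ li)/eqP al := a0 l.
  by rewrite ffunE [cs P l]al rmorph0.
pose Q0 : proj_point L n := exist _ w nw.
have zQ : zero_locus jL (@eqs F C) Q0.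
  apply/forallP => v; have /forallP/(_ v)/eqP Pv := valP P.
  have -> : coords Q0 = fun i => frobenius jL k (cs P i).
    by apply/funext => i; rewrite /coords /= ffunE.
  by rewrite -(rmorph_mmap (frobenius_base jL k)) [mmap _ _ _]Pv rmorph0.
by exists (exist _ Q0 zQ) => i; rewrite /coords /= ffunE.
Qed.

Definition frobenius_point k P : point := projT1 (cid (frobenius_point_ex k P)).

Lemma frobenius_pointE k P i : cs (frobenius_point k P) i = frobenius jL k (cs P i).
Proof. exact: (projT2 (cid (frobenius_point_ex k P)) i). Qed.

Lemma conj_frobenius k P : conjugate_points P (frobenius_point k P).
Proof.
exists (frobenius jL k); first exact: frobenius_base.
by move=> i; rewrite [LHS]frobenius_pointE.
Qed.

Lemma point_period P : exists2 m, (0 < m)%N & forall i, frobenius jL m (cs P i) = cs P i.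
Proof. by apply: frobenius_common_period => i; exact: closure_algebraic. Qed.

Lemma conjugateP P Q m : (0 < m)%N -> (forall i, frobenius jL m (cs P i) = cs P i) ->
  conjugate_points P Q <-> exists2 k, (k < m)%N & Q = frobenius_point k P.
Proof.
move=> m0 per; split=> [[s sj sP]|[k _ ->]]; last exact: conj_frobenius.
have [k km sk] := conjugates_frobenius m0 per sj.
exists k => //; apply: point_inj => i; rewrite frobenius_pointE -sk; exact: sP.
Qed.

Lemma conjugate_refl P : conjugate_points P P.
Proof. by exists idfun. Qed.

(** The endomorphism in [conjugate_points] comes without an inverse. On the coordinates of P it acts
    as the k-th power of Frobenius, and the (m - k)-th power completes the period. *)
Lemma conjugate_sym P Q : conjugate_points P Q -> conjugate_points Q P.
Proof.
have [m m0 per] := point_period P; move=> /(conjugateP _ m0 per)[k km ->].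
have {2}-> : P = frobenius_point (m - k) (frobenius_point k P).
  apply: point_inj => i; rewrite !frobenius_pointE -frobeniusD subnK ?per //.
  exact: ltnW.
exact: conj_frobenius.
Qed.

Lemma conjugate_trans P Q R :
  conjugate_points P Q -> conjugate_points Q R -> conjugate_points P R.
Proof.
move=> [s sj sP] [s' s'j s'Q]; exists (s' \o s) => [c|i] /=; first by rewrite sj s'j.
by rewrite -sP s'Q.
Qed.

Lemma eval_at_conjugate P Q : conjugate_points P Q ->
  exists s : {rmorphism L -> L}, forall f, eval_at Q f = s (eval_at P f).
Proof.
move=> [s sj sP]; exists s => f; rewrite /eval_at (rmorph_mmap sj).
by congr mmap; apply/funext.
Qed.

Lemma order_at_conjugate P Q h : conjugate_points P Q -> order_at Q h = order_at P h.
Proof.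
move=> /eval_at_conjugate[s sE].
have OE : local_ring Q = local_ring P.
  apply/funext => h'; apply/propext; split=> -[e [f [u [hf hu u0 ->]]]];
    by exists e, f, u; split=> //; move: u0; rewrite sE fmorph_eq0.
have ME : maximal_ideal Q = maximal_ideal P.
  apply/funext => h'; apply/propext; split=> -[e [f [u [hf hu u0 f0 ->]]]]; exists e, f, u; split=> //.
  - by move: u0; rewrite sE fmorph_eq0.
  - by apply/eqP; rewrite -(fmorph_eq0 s) -sE f0.
  - by rewrite sE fmorph_eq0.
  - by rewrite sE f0 rmorph0.
rewrite /order_at; congr xget; apply/funext => k.
by rewrite /has_order /uniformizer OE ME.
Qed.

End Orbits.

Section FiniteSubfield.
Variables (F : finFieldType) (L : fieldType) (j : {rmorphism F -> L}) (W : set L^o).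
Hypotheses (sW : subgroup W) (Wj : forall c, W (j c)) (WM : forall x y : L, W x -> W y -> W (x * y)).

(** Multiplication by x permutes the nonzero elements of W, so their product is unchanged by the
    factor x^(N-1). *)
Lemma finite_subfield_expn N (x : L) : has_index W [set 0] N -> W x -> x ^+ N = x.
Proof.
move=> [b [Wb Hb]] Wx; have inj k l : b k = b l -> k = l.
  move=> kl; have [o [_ u]] := Hb _ (Wb k).
  by rewrite -(u k) /= ?subrr // -(u l) //= kl subrr.
have [k0 [/= /subr0_eq Hk0 _]] := Hb _ sW.1.
have N0 : (0 < N)%N by case: (k0) => k /(leq_ltn_trans _); apply.
have [->|x0] := eqVneq x 0; first by rewrite expr0n eqn0Ngt N0.
have /choice[f fP] : forall k, exists l, x * b k = b l.
  by move=> k; have [l [/= /subr0_eq ? _]] := Hb _ (WM Wx (Wb k)); exists l.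
have f_inj : injective f.
  by move=> k l fkl; apply: inj; apply: (mulfI x0); rewrite !fP fkl.
have bk0 k : (b k != 0) = (k != k0).
  by rewrite Hk0; apply/idP/idP; apply: contra => /eqP; [move=> ->|move/inj ->].
have prod0 : \prod_(k | k != k0) b k != 0 by apply/prodf_neq0 => k; rewrite bk0.
have : \prod_(k | k != k0) b k = x ^+ N.-1 * \prod_(k | k != k0) b k.
  rewrite [LHS](reindex_inj f_inj) /=.
  have -> : x ^+ N.-1 = \prod_(k < N | k != k0) x.
    by rewrite prodr_const cardC1 card_ord.
  rewrite -big_split /=; apply: eq_big => k; last by move=> _; rewrite fP.
  by rewrite -!bk0 -fP mulf_eq0 (negPf x0).
rewrite -{1}[\prod_(_ | _) _]mul1r => /(mulIf prod0) xN.
by rewrite -[in LHS](prednK N0) exprS -xN mulr1.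
Qed.

End FiniteSubfield.

Section ResidueField.
Variables (F : finFieldType) (C : curve F).
Local Notation L := (Defs.closure C).
Local Notation K := (funfield C).
Local Notation n := (ambient_dim C).
Local Notation jL := (@to_closure F C).
Local Notation point := (Defs.point C).
Local Notation cs P := (coords (sval P : proj_point L n)).
Implicit Types P Q : point.
Local Notation q := #|F|.

Definition residue_field P i0 : set L^o := [set c | exists h, has_value P i0 h c].

Lemma residue_field_frobenius P i0 m c : (forall i, frobenius jL m (cs P i) = cs P i) ->
  residue_field P i0 c -> frobenius jL m c = c.
Proof.
by move=> per [h [f [u [_ _ ->]]]]; rewrite rmorphM fmorphV /= !eval_at_frobenius.
Qed.

Lemma residue_field_index P i0 N : cs P i0 = 1 ->
  has_index (residue_field P i0) [set 0] N ->
  has_index (local_ring P) (maximal_ideal P) N.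
Proof.
move=> ai0 [b [Wb Hb]]; have /choice[e eP] := Wb.
exists e; split=> [k|h /(local_ringE ai0)[c hc]].
  by apply/(local_ringE ai0); exists (b k).
have [k [/= /subr0_eq Hk uk]] := Hb c (ex_intro _ h hc).
exists k; split=> [|l /(maximal_idealE ai0) hl].
  by apply/(maximal_idealE ai0); have := has_valueB ai0 hc (eP k); rewrite -Hk subrr.
by apply: uk; apply: (has_value_inj ai0 _ hl); exact: has_valueB (eP l).
Qed.

(** The values at P form a finite field with q^r elements. All of them are roots of X^(q^m) - X, so
    r <= m; the coordinates of P are among them and are thus fixed by the r-th power of Frobenius,
    so r >= m by minimality. *)
Lemma residue_degree P m : (0 < m)%N -> (forall i, frobenius jL m (cs P i) = cs P i) ->
  (forall k, (0 < k < m)%N -> ~ forall i, frobenius jL k (cs P i) = cs P i) ->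
  has_index (local_ring P) (maximal_ideal P) (q ^ m).
Proof.
move=> m0 per minm; have [i0 ai0] := chart_exists P.
pose W := residue_field P i0.
have sW : subgroup W.
  split=> [|c c' [h hc] [h' hc']]; first by exists 0; exact: has_value0.
  by exists (h - h'); exact: has_valueB.
have WM (x y : L) : W x -> W y -> W (x * y).
  by move=> [h hx] [h' hy]; exists (h * h'); exact: has_valueM.
have Wj c : W (jL c) by exists (to_funfield C c); exact: has_value_const.
have W1 : W 1 by exists 1; exact: has_value1.
have q1 : (1 < q)%N := finNzRing_gt1 F.
pose p : {poly L} := 'X^(q ^ m) - 'X.
have sp : size p = (q ^ m).+1.
  have qm : (1 < q ^ m)%N by rewrite -{1}(expn0 q) ltn_exp2l.
  by rewrite size_polyDl ?size_polyXn // size_polyN size_polyX ltnS.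
have p0 : p != 0 by rewrite -size_poly_eq0 sp.
have Wp c : W c -> root p c.
  by move=> /(residue_field_frobenius per); rewrite rootE !hornerE /frobenius => ->; rewrite subrr.
have finW : finite_set W.
  have [s sE] := closed_field_poly_normal p.
  apply: sub_finite_set (finite_seq s) => c /Wp; rewrite sE /=.
  by rewrite rootE hornerZ mulf_eq0 lead_coef_eq0 (negPf p0) /= -[_ == 0]/(root _ _) root_prod_XsubC.
have WZ c w : W w -> W (jL c *: w) by move=> Ww; exact: WM.
have [r /(quotient_dim_index sW WZ) iN] := finite_subspace_dim sW WZ finW.
suff -> : m = r by exact: residue_field_index iN.
have per_r i : frobenius jL r (cs P i) = cs P i.
  apply: finite_subfield_expn iN _ => //; exists (affine_coord i0 i).
  exact: has_value_coord.
have r0 : (0 < r)%N.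
  rewrite lt0n; apply/eqP => r0.
  have [b [Wb Hb]] := iN; rewrite r0 expn0 in b Wb Hb *.
  have [k [/= k0 _]] := Hb 0 sW.1; have [l [/= l1 _]] := Hb 1 W1.
  move: k0 l1; rewrite !ord1 sub0r => /eqP; rewrite oppr_eq0 => /eqP ->.
  by rewrite subr0 => /eqP; rewrite oner_eq0.
apply/eqP; rewrite eqn_leq; apply/andP; split.
  by rewrite leqNgt; apply/negP => rm; apply: (minm r) => //; rewrite r0.
rewrite -(leq_exp2l _ _ q1) -ltnS -sp.
have [b [Wb Hb]] := iN.
have inj : injective b.
  move=> k l kl; have [o [_ u]] := Hb _ (Wb k).
  by rewrite -(u k) /= ?subrr // -(u l) //= kl subrr.
rewrite -[X in (X < _)%N]size_enum_ord -(size_map b) max_poly_roots //.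
  by apply/allP => _ /mapP[k _ ->]; exact: Wp.
by rewrite map_inj_uniq // enum_uniq.
Qed.

Lemma orbit_seq P : exists s : seq point,
  [/\ uniq s, forall Q, Q \in s <-> conjugate_points P Q
    & has_index (local_ring P) (maximal_ideal P) (q ^ size s)].
Proof.
pose per m := (0 < m)%N && [forall i, frobenius jL m (cs P i) == cs P i].
have ex : exists m, per m.
  by have [m m0 pm] := point_period P; exists m; rewrite /per m0; apply/forallP => i; rewrite pm.
case: (ex_minnP ex) => m /andP[m0 /forallP pm] minm.
have {}pm i : frobenius jL m (cs P i) = cs P i by exact/eqP.
have minP k : (0 < k < m)%N -> ~ forall i, frobenius jL k (cs P i) = cs P i.
  move=> /andP[k0 km] pk; have : (m <= k)%N.
    by apply: minm; rewrite /per k0; apply/forallP => i; rewrite pk.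
  by rewrite leqNgt km.
exists [seq frobenius_point k P | k <- iota 0 m]; split.
- rewrite map_inj_in_uniq ?iota_uniq // => k l; rewrite !mem_iota !add0n /=.
  have lt k' l' : (k' < l')%N -> (l' < m)%N -> frobenius_point k' P <> frobenius_point l' P.
    move=> kl lm E; apply: (minP (l' - k')%N).
      by rewrite subn_gt0 kl (leq_ltn_trans (leq_subr _ _)).
    move=> i; apply: (@frobenius_inj _ _ jL k').
    by rewrite -frobeniusD subnKC 1?ltnW // -!frobenius_pointE E.
  by move=> km lm kl; case: (ltngtP k l) => // /lt; [move/(_ lm)|move/(_ km)/nesym].
- move=> Q; rewrite (conjugateP Q m0 pm); split=> [/mapP[k]|[k km ->]].
    by rewrite mem_iota => /andP[_ km] ->; exists k.
  by apply/mapP; exists k => //; rewrite mem_iota.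
by rewrite size_map size_iota; exact: residue_degree.
Qed.

End ResidueField.

(** * Constants *)

Section ZariskiClosed.
Variables (F : finFieldType) (L : fieldType) (j : {rmorphism F -> L}) (n : nat).

Lemma meval_map_mpoly (f : {mpoly F[n]}) (v : 'I_n -> L) :
  (map_mpoly j f).@[v] = mmap j v f.
Proof.
rewrite /map_mpoly /mmap raddf_sum /=; apply: eq_bigr => m _.
rewrite mevalM mevalC; congr (_ * _); rewrite /mmap1 rmorph_prod /=.
by apply: eq_bigr => i _; rewrite rmorphXn /= mevalXU.
Qed.

Lemma map_mpoly_homog e (f : {mpoly F[n]}) : f \is e.-homog -> map_mpoly j f \is e.-homog.
Proof.
move=> /dhomogP hf; apply/dhomogP => m; rewrite mcoeff_msupp mcoeff_map_mpoly fmorph_eq0.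
by rewrite -mcoeff_msupp; exact: hf.
Qed.

End ZariskiClosed.

Lemma zariski_closedU (L : fieldType) n (Z1 Z2 : set (proj_point L n)) :
  zariski_closed Z1 -> zariski_closed Z2 -> zariski_closed (Z1 `|` Z2).
Proof.
move=> [S1 h1 ->] [S2 h2 ->].
exists [set f | exists f1 f2, [/\ S1 f1, S2 f2 & f = f1 * f2]].
  move=> _ [f1 [f2 [/h1[e1 he1] /h2[e2 he2] ->]]]; exists (e1 + e2)%N; exact: dhomogM.
apply/seteqP; split=> P /=.
  case=> PS _ [f1 [f2 [Sf1 Sf2 ->]]]; first by rewrite mevalM (PS _ Sf1) mul0r.
  by rewrite mevalM (PS _ Sf2) mulr0.
move=> PS; apply: contrapT => /not_orP[/existsNP[f1 /not_implyP[Sf1 /eqP f10]]].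
move=> /existsNP[f2 /not_implyP[Sf2 /eqP f20]].
have /eqP := PS (f1 * f2) (ex_intro _ f1 (ex_intro _ f2 (And3 Sf1 Sf2 erefl))).
by rewrite mevalM mulf_eq0 (negPf f10) (negPf f20).
Qed.

Lemma zariski_closed0 (L : fieldType) n : zariski_closed (set0 : set (proj_point L n)).
Proof.
exists [set 1]; first by move=> _ ->; exists 0%N; exact: dhomog1.
apply/seteqP; split=> P //= /(_ 1 erefl)/eqP.
by rewrite meval1 oner_eq0.
Qed.

Lemma zariski_irreducible_cover (L : fieldType) n (Z : set (proj_point L n))
    (I : eqType) (s : seq I) (Y : I -> set (proj_point L n)) :
  zariski_irreducible Z -> (forall i, zariski_closed (Y i)) ->
  (forall P, Z P -> exists2 i, i \in s & Y i P) -> exists i, Z `<=` Y i.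
Proof.
move=> [[P0 ZP0] irr] cY.
have cU (t : seq I) : zariski_closed [set P | exists2 i, i \in t & Y i P].
  elim: t => [|i t IHt].
    have -> : [set P | exists2 i, i \in ([::] : seq I) & Y i P] = set0 by apply/seteqP; split=> // P [].
    exact: zariski_closed0.
  have -> : [set P | exists2 k, k \in i :: t & Y k P] =
      Y i `|` [set P | exists2 k, k \in t & Y k P].
    apply/seteqP; split=> P /=.
      move=> [k]; rewrite inE => /orP[/eqP ->|kt Yk]; first by left.
      by right; exists k.
    by move=> [Yi|[k kt Yk]]; [exists i|exists k]; rewrite ?mem_head // inE kt orbT.
  exact: zariski_closedU.
elim: s => [/(_ _ ZP0)[]|i t IHt cover] //.
have [|Zi|Zt] := irr _ _ (cY i) (cU t); last by apply: IHt => P /Zt.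
  move=> P /cover[k]; rewrite inE => /orP[/eqP ->|kt Yk]; first by left.
  by right; exists k.
by exists i.
Qed.

Section Constants.
Variables (F : finFieldType) (C : curve F).
Local Notation L := (Defs.closure C).
Local Notation K := (funfield C).
Local Notation n := (ambient_dim C).
Local Notation iota := (@to_funfield F C).
Local Notation jL := (@to_closure F C).
Local Notation x := (@generic_point F C).
Local Notation point := (Defs.point C).

(* The geometric points at which [h] takes the value [b], for [h] regular on the curve. *)
Let level (h : K) (b : L) : set (proj_point L n) := [set P | forall e (f u : {mpoly F[n.+1]}),
  f \is e.-homog -> u \is e.-homog -> mmap iota x f = h * mmap iota x u ->
  mmap jL (coords P) f = b * mmap jL (coords P) u].

Let level_closed h b : zariski_closed (level h b).
Proof.
exists [set G | exists e (f u : {mpoly F[n.+1]}), [/\ f \is e.-homog, u \is e.-homog,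
    mmap iota x f = h * mmap iota x u & G = map_mpoly jL f - b *: map_mpoly jL u]].
  move=> _ [e [f [u [hf hu _ ->]]]]; exists e.
  by apply: rpredB; [exact: map_mpoly_homog|apply: dhomogZ; exact: map_mpoly_homog].
apply/seteqP; split=> P /= HP.
  move=> _ [e [f [u [hf hu fu ->]]]].
  by rewrite mevalB mevalZ !meval_map_mpoly (HP e f u) // subrr.
move=> e f u hf hu fu; apply/subr0_eq; rewrite -!meval_map_mpoly -mevalZ -mevalB.
by apply: HP; exists e, f, u.
Qed.

(** The values of h at geometric points are roots of p, so finitely many of the closed sets
    [level h b] cover the curve, and by irreducibility one of them is the whole curve. Comparing a
    point with its Frobenius conjugate shows that this b lies in F, and then h = f/u equals b at the
    generic point. *)
Lemma constant_functions (h : K) : (forall P : point, local_ring P h) ->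
  (exists2 p : {poly F}, p != 0 & root (map_poly iota p) h) -> exists c, h = iota c.
Proof.
move=> Oh [p p0 ph].
have [s sE] := closed_field_poly_normal (map_poly jL p).
have value_level P i b : coords (val P) i = 1 -> has_value P i h b -> level h b (val P : proj_point L n).
  move=> ai hb e f u hf hu fu.
  have x0 := generic_coord_neq0 ai.
  have fE : mmap iota (affine_coord i) f = h * mmap iota (affine_coord i) u.
    apply: (mulfI (expf_neq0 e x0)); rewrite -(mmap_generic ai hf) fu (mmap_generic ai hu).
    by rewrite mulrCA.
  apply: (has_value_inj ai (has_value_mmap P i f)); rewrite fE.
  by apply: has_valueM => //; exact: has_value_mmap.
have [|P ZP|b Zb] := @zariski_irreducible_cover _ _ _ _ s (level h) (curve_geom_irreducible C).
- exact: level_closed.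
- pose Q : point := exist _ P ZP; have [i ai] := chart_exists Q.
  have [b hb] := (local_ringE ai h).1 (Oh Q).
  exists b; last exact: (value_level Q i).
  have := has_value_horner_map ai p hb; rewrite (eqP ph) => v0.
  have /eqP := has_value_inj ai v0 (has_value0 Q i).
  rewrite sE hornerZ mulf_eq0 lead_coef_eq0 map_poly_eq0 (negPf p0) /=.
  by rewrite -[_ == 0]/(root _ _) root_prod_XsubC.
have [[P0 ZP0] _] := curve_geom_irreducible C; pose Q : point := exist _ P0 ZP0.
have [e [f [u [hf hu u0 hE]]]] := Oh Q.
have gen0 (R : point) : eval_at R u != 0 -> mmap iota x u != 0.
  by apply: contraNneq => /((generic_pointP hu).1) uR; apply/eqP; exact: uR _ (valP R).
have fu : mmap iota x f = h * mmap iota x u by rewrite hE divfK // (gen0 Q).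
have fb R : zero_locus jL (@eqs F C) R -> mmap jL (coords R) f = b * mmap jL (coords R) u.
  by move=> ZR; exact: (Zb _ ZR e f u hf hu fu).
have [c bc] : exists c, b = jL c.
  apply: frobenius_fixed; pose Q' := frobenius_point 1 Q.
  have frobE g : eval_at Q' g = frobenius jL 1 (eval_at Q g).
    rewrite /eval_at (rmorph_mmap (frobenius_base jL 1)); congr mmap; apply/funext => i.
    exact: frobenius_pointE.
  have := fb _ (valP Q'); rewrite -!/(eval_at Q' _) !frobE.
  rewrite (fb _ ZP0 : eval_at Q f = b * eval_at Q u) rmorphM /=.
  by move=> /(mulIf _) ->//; rewrite fmorph_eq0.
exists c; apply: (mulIf (gen0 Q u0)); rewrite -fu; apply/subr0_eq.
rewrite -mmapZ -mmapB; apply/(generic_pointP (e := e)).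
  by apply: rpredB => //; exact: dhomogZ.
by move=> R ZR; rewrite mmapB mmapZ fb // bc subrr.
Qed.

End Constants.

(** * Linear equivalence classes *)

Lemma curve_valuations (F : finFieldType) (C : curve F) :
  valuations (@to_funfield F C) (@conjugate_points F C) (@order_at F C).
Proof.
have unit_order (P : Defs.point C) h i c : coords (val P) i = 1 -> has_value P i h c -> c != 0 -> order_at P h = 0.
  move=> ai hc c0; apply: order_at_unit; first by apply/(local_ringE ai); exists c.
  by move=> /(maximal_idealE ai)/(has_value_inj ai hc)/eqP; rewrite (negPf c0).
split.
- exact: conjugate_refl.
- exact: conjugate_sym.
- exact: conjugate_trans.
- move=> P h h' h0 h'0; have [t Ht] := dvr_at P.
  suff /has_orderE[] : has_order P (h * h') (order_at P h + order_at P h') by [].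
  by apply: (order_ofM Ht); exact: order_atP.
- move=> P k h h'; have [t Ht] := dvr_at P; rewrite !vge_order.
  exact: (order_ofD Ht).
- move=> P c c0; have [i ai] := chart_exists P.
  by apply: (unit_order P _ i _ ai (has_value_const P i c)); rewrite fmorph_eq0.
- by move=> P Q h; exact: order_at_conjugate.
- by move=> h; exact: order_at_finite.
- move=> P; have [s [us sP sI]] := orbit_seq P; exists s; split=> //.
  suff [<- <-] : local_ring P = vge (@order_at F C) P 0 /\ maximal_ideal P = vge (@order_at F C) P 1 by [].
  by split; apply/funext => h; apply/propext; [exact: local_ring_vge|exact: maximal_ideal_vge].
- move=> P; have [t Ht] := dvr_at P; exists t; first exact: (dvr_t0 Ht).
  by have /has_orderE[] := order_of_generator Ht.
- move=> h Oh; apply: constant_functions => P.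
  exact/local_ring_vge.
Qed.

(** Multiplication by h identifies both indices in the Riemann-Roch formulas of D and E, so the
    powers of q agree. This replaces the product formula. *)
Lemma class_degree (F : finFieldType) (K : fieldType) (iota : {rmorphism F -> K})
    (pt : choiceType) (conj : pt -> pt -> Prop) (ord : pt -> K -> int)
    (H : valuations iota conj ord) g (D E : {freeg pt}) h :
  has_quotient_dim iota (repartitions conj ord) (principal_adeles conj ord 0) g ->
  has_index (sections ord 0) [set 0] #|F| -> rational conj D -> rational conj E ->
  h != 0 -> divisor_difference ord h D E -> deg D = deg E.
Proof.
move=> genus constants rD rE h0 hDE.
have [N [M [iN iM NM]]] := riemann_roch H (genus_index H genus) constants rD.
have [N' [M' [iN' iM' NM']]] := riemann_roch H (genus_index H genus) constants rE.
have NN : N' = N.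
  apply: (has_index_inj (subgroup_AK H E) iN').
  exact: (has_index_adeles_equiv H h0 hDE iN).
have MM : M' = M.
  apply: (has_index_inj (subgroup0 K) iM').
  exact: (has_index_sections_equiv H h0 hDE iM).
rewrite NN MM -NM in NM'; have N0 : (N%:R : rat) != 0.
  by rewrite pnatr_eq0 -lt0n; apply: has_index_gt0 iN; exact: (subgroup_R H).1.
have q1 := finNzRing_gt1 F.
have q0 : 0 < (#|F|%:R : rat) by rewrite ltr0n ltnW.
have q1' : (#|F|%:R : rat) != 1 by rewrite pnatr_eq1 gtn_eqF.
move: NM' => /(mulfI N0)/(ieexprIz q0 q1') E'.
by apply: (addIr 1).
Qed.

Section Classes.
Variables (F : finFieldType) (C : curve F).
Local Notation K := (funfield C).
Local Notation iota := (@to_funfield F C).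
Local Notation conj := (@conjugate_points F C).
Local Notation ord := (@order_at F C).
Local Notation divisor := (divisor C).
Implicit Types D E : divisor.

Lemma repartitionsE : [set r | repartition r] = repartitions conj ord.
Proof.
have lE (P : Defs.point C) h : local_ring P h = vge ord P 0 h.
  by apply/propext; exact: local_ring_vge.
apply/seteqP; split=> r [sr fr]; split=> //; apply: sub_finite_set fr => P /=;
  by rewrite lE.
Qed.

Lemma principal_adelesE : [set r | repartition r /\ exists h : K, forall P, local_ring P (r P - h)]
  = principal_adeles conj ord 0.
Proof.
have HV := curve_valuations C.
apply/seteqP; split=> r.
  move=> [[sr _] [h Hh]]; split=> //; exists h => P; rewrite coeff0 oppr0.
  exact/local_ring_vge.
move=> Hr; have : repartitions conj ord r by exact: (AK_subR HV Hr).
rewrite -repartitionsE => Rr; split=> //; have [_ [h Hh]] := Hr; exists h => P.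
by apply/local_ring_vge; have := Hh P; rewrite coeff0 oppr0.
Qed.

Lemma global_sectionsE D : global_sections D = sections ord D.
Proof.
apply/seteqP; split=> h.
  by move=> [-> P|Hh P]; apply/vge_order; [left|right; exact: Hh].
move=> Hh; have [->|h0] := eqVneq h 0; [by left|right=> P].
by have /vge_order[/eqP|] := Hh P; first by rewrite (negPf h0).
Qed.

Lemma linearly_equivalentE D E :
  linearly_equivalent D E <-> exists2 h, h != 0 & divisor_difference ord h D E.
Proof.
split=> -[h h0 Hh]; exists h => // P; first by have /has_orderE[] := Hh P.
by apply/has_orderE; split=> //; exact: Hh.
Qed.

Lemma linearly_equivalent_sym D E : linearly_equivalent D E -> linearly_equivalent E D.
Proof.
rewrite !linearly_equivalentE => -[h h0 Hh]; exists h^-1; first by rewrite invr_eq0.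
exact: (divisor_differenceV (curve_valuations C)).
Qed.

Lemma linearly_equivalent_trans D E G :
  linearly_equivalent D E -> linearly_equivalent E G -> linearly_equivalent D G.
Proof.
rewrite !linearly_equivalentE => -[h h0 Hh] [h' h'0 Hh']; exists (h * h').
  by rewrite mulf_neq0.
move=> P; rewrite (ordM (curve_valuations C)) // Hh Hh'.
by rewrite addrA subrK.
Qed.

Lemma divisor_class_eq D E : linearly_equivalent D E -> divisor_class D = divisor_class E.
Proof.
move=> DE; apply/seteqP; split=> G [rG HG]; split=> //.
  exact: linearly_equivalent_trans (linearly_equivalent_sym DE) HG.
exact: linearly_equivalent_trans DE HG.
Qed.

End Classes.

(** [Pic] and [has_h0] may speak of different divisors of a class. The one with known sections is
    kept, and [class_degree] transfers the degree to it. *)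
Lemma class_count (F : finFieldType) (C : curve F) (g : nat) (hg : has_genus C g)
    (d : int) (i a N : nat) (c : 'I_N -> set (divisor C)) :
  (0 < i)%N -> (0 < a)%N -> a%:Z = i%:Z - d - 1 + g%:Z -> injective c ->
  (forall j, Pic C d (c j) /\ exists2 r : nat, has_h0 (c j) r & (i <= r)%N) ->
  (N * (#|F| ^ i).-1 * (#|F| ^ a).-1 <= #|F| ^ g * 2 ^ (2 * g).-1 * #|F|)%N.
Proof.
move=> i0 a0 aE c_inj Wc; have HV := curve_valuations C.
have genus : has_quotient_dim (@to_funfield F C)
    (repartitions (@conjugate_points F C) (@order_at F C))
    (principal_adeles (@conjugate_points F C) (@order_at F C) 0) g.
  by rewrite -repartitionsE -principal_adelesE.
have /choice[Dr DrP] : forall j, exists Dr : divisor C * nat, [/\ rational (@conjugate_points F C) Dr.1,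
    deg Dr.1 = d, c j = divisor_class Dr.1,
    has_index (sections (@order_at F C) Dr.1) [set 0] (#|F| ^ Dr.2) & (i <= Dr.2)%N].
  move=> j; have [[D0 [rD0 dD0] cE] [r [D cD hD] ir]] := Wc j.
  have [rD D0D] : rational_divisor D /\ linearly_equivalent D0 D by move: cD; rewrite -cE.
  have iD : has_index (sections (@order_at F C) D) [set 0] (#|F| ^ r).
    rewrite -global_sectionsE; apply: quotient_dim_index hD.
      by rewrite global_sectionsE; exact: (subgroup_L HV).
    move=> t h; rewrite global_sectionsE => Lh P.
    by rewrite -[- _]add0r; apply: (vgeM HV) => //; exact: (vge_iota HV).
  exists (D, r); split=> //=; last by rewrite -cE; exact: divisor_class_eq.
  have /linearly_equivalentE[h h0 Hh] := D0D.
  (* Since i > 0 there is a nonzero section, which supplies the equality L(0) = F that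
     [class_degree] requires. *)
  have [|f [_ /(_ ord0)[Lf f0]]] := @has_index_nonzero _ _ _ 1 (subgroup_L HV D).1 iD.
    by rewrite -{1}(expn0 #|F|) ltn_exp2l ?finNzRing_gt1 // (leq_trans i0).
  by rewrite -dD0 (class_degree HV genus (constants_index HV Lf f0 iD) rD0 rD h0 Hh).
have rD j : rational (@conjugate_points F C) (Dr j).1 by have [] := DrP j.
have dD j : deg (Dr j).1 = d by have [] := DrP j.
have LD j : has_index (sections (@order_at F C) (Dr j).1) [set 0] (#|F| ^ (Dr j).2).
  by have [] := DrP j.
have ir j : (i <= (Dr j).2)%N by have [] := DrP j.
have ineq j l h : h != 0 -> divisor_difference (@order_at F C) h (Dr j).1 (Dr l).1 -> j = l.
  move=> h0 hjl; apply: c_inj; have [_ _ -> _ _] := DrP j; have [_ _ -> _ _] := DrP l.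
  by apply: divisor_class_eq; apply/linearly_equivalentE; exists h.
exact: (counting_bound HV genus rD dD LD ir ineq i0 a0 aE).
Qed.

Theorem theorem2p9 (F : finFieldType) (hq : (5 <= #|F|)%N)
    (C : curve F) (g : nat) (hg : has_genus C g) (d i : int)
    (hdi : (0 <= d <= g%:Z - 1 /\ 1 <= i) \/
           (g%:Z - 1 <= d <= 2 * g%:Z - 2 /\ 1 <= i - d - 1 + g%:Z)) :
  let W := [set c | Pic C d c /\ exists2 r : nat, has_h0 c r & i <= r%:Z] in
  finite_set W /\
  (#|` fset_set W|%:R : rat) <= 16 ^+ g * #|F|%:R ^ (d - 2 * i + 2).
Proof.
move=> W; have q1 := finNzRing_gt1 F.
have [i' iE] : exists i' : nat, i = i' by exists `|i|%N; lia.
have [a aE] : exists a : nat, a%:Z = i - d - 1 + g%:Z by exists `|(i - d - 1 + g%:Z)%R|%N; lia.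
(* In case (i), a = i + (g - 1 - d) >= i; in case (ii), i = a + (d + 1 - g) >= a. Either range of d
   is empty unless g >= 1. *)
have [i0 a0 g0] : [/\ (0 < i')%N, (0 < a)%N & (0 < g)%N].
  by case: hdi => -[/andP[h1 h2] h3]; split; lia.
subst i; set M := (#|F| ^ g * 2 ^ (2 * g).-1 * #|F|)%N.
(* The bound is stated for finite subsets because finiteness of [W] itself is deduced from it. *)
have bound (B : {fset (set (divisor C))}) : [set` B] `<=` W ->
    (#|` B| * (#|F| ^ i').-1 * (#|F| ^ a).-1 <= M)%N.
  move=> BW; apply: (@class_count _ _ _ hg d i' a _ (fun j : 'I_(#|` B|) => nth set0 B j)) => //.
    by move=> j l /eqP; rewrite nth_uniq ?fset_uniq // => /eqP/val_inj.
  by move=> j; have [|? [r ? ?]] := BW (nth set0 B j); [rewrite /= mem_nth|split=> //; exists r].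
have pos m : (0 < m)%N -> (0 < (#|F| ^ m).-1)%N.
  by move=> m0; rewrite -ltnS prednK ?expn_gt0 ?(ltnW q1) // -{1}(expn0 #|F|) ltn_exp2l.
have fW : finite_set W.
  apply: contrapT => infW; have [B BW] := infinite_set_fset M.+1 infW.
  move=> MB; suff : (M < M)%N by rewrite ltnn.
  apply: leq_trans MB _; apply: leq_trans (bound B BW).
  by rewrite -mulnA leq_pmulr // muln_gt0 !pos.
split=> //; have := bound (fset_set W); rewrite fset_setK // => /(_ (fun _ => id)).
set N := #|` _|.
(* Applied to q^i and to q^a, this is the source of the factor 4. *)
have half m : (0 < m)%N -> (#|F| ^ m <= 2 * (#|F| ^ m).-1)%N by move=> /pos; lia.
move=> NM; have {}NM : (N * #|F| ^ (i' + a) <= 16 ^ g * #|F| ^ g.+1)%N.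
  apply: (@leq_trans (4 * M)).
    apply: leq_trans (leq_mul (leqnn 4) NM); rewrite expnD.
    apply: leq_trans (leq_mul (leqnn N) (leq_mul (half _ i0) (half _ a0))) _.
    by apply/eq_leq; ring.
  (* The power 2^(2g+1) is at most 2^(4g) = 16^g because g >= 1. *)
  have -> : (4 * M = 2 ^ (2 * g).+1 * #|F| ^ g.+1)%N.
    by rewrite /M -[in RHS](prednK (_ : 0 < 2 * g)%N) ?muln_gt0 // !expnS; ring.
  by rewrite leq_mul2r (_ : 16 = 2 ^ 4)%N // -expnM leq_exp2l //; apply/orP; right; lia.
have q0 : (0 : rat) < #|F|%:R by rewrite ltr0n ltnW.
have -> : d - 2 * i'%:Z + 2 = g.+1%:Z - (i' + a)%:Z by lia.
rewrite expfzDr ?gt_eqF // -invr_expz mulrA ler_pdivlMr ?exprz_gt0 //.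
by rewrite -!exprnP -!natrX -!natrM ler_nat.
Qed.
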